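(* Let $G=(V,E)$ be a connected locally finite graph, let $\Gamma\subseteq\mathrm{Aut}(G)$ be a closed subgroup acting quasi-transitively on $G$, and let $\mathbf{w}$ be the relative weight function induced by $\Gamma$. Let $\mathbf{P}$ be a $\Gamma$-invariant probability measure on $2^{V\times V}$ whose configurations $\omega$, viewed as graphs on $V$, have uniformly bounded degrees a.s. Then $\mathbf{P}$ is hyperfinite if and only if for any random nonempty subset $A\subseteq V$ whose law is jointly $\Gamma$-invariant with $\mathbf{P}$, the induced subgraph $\omega'=\omega|_A$ satisfies $\Phi_V^{\mathbf{w}}(\omega')=0$ a.s.
   Context: $\Gamma$ acts quasi-transitively if it has finitely many orbits on $V$. $\mathrm{Aut}(G)$ carries the topology of pointwise convergence. With $m$ a Haar measure on the locally compact group $\Gamma$ and $\Gamma_v=\{\gamma\in\Gamma:\gamma v=v\}$, the relative weight function is $\mathbf{w}^x(y)=m(\Gamma_y)/m(\Gamma_x)$, and $\mathbf{w}^x(A)=\sum_{y\in A}\mathbf{w}^x(y)$. A configuration $\omega\in2^{V\times V}$ is regarded as a (random) graph on the vertex set $V$, not necessarily a subgraph of $G$. Uniformly bounded degrees a.s. means there is a constant $D$ such that a.s. every vertex has degree at most $D$ in $\omega$. A random subset $A$ is jointly $\Gamma$-invariant with $\mathbf{P}$ if $(\omega,A)$ are defined on a common probability space with $\omega$ of law $\mathbf{P}$ and the joint law of $(\omega,A)$ on $2^{V\times V}\times2^V$ is invariant under the diagonal action of $\Gamma$. $\omega|_A$ is the subgraph of $\omega$ induced on $A$. Hyperfiniteness: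 $\mathbf{P}$ is hyperfinite if for $\mathbf{P}$-a.e. $\omega$ there is an increasing family of random subgraphs $\omega_1\subseteq\omega_2\subseteq\dots\subseteq\omega$ (possibly defined on a larger probability space) such that (1) the joint law of $(\omega,(\omega_n)_{n\in\mathbb{N}})$ is $\Gamma$-invariant; (2) $\bigcup_n\omega_n=\omega$; (3) for every $n\ge1$, all connected components of $\omega_n$ are finite a.s. For a graph $K$ with nonempty vertex set $V(K)\subseteq V$, the weighted Cheeger constant is $$\Phi_V^{\mathbf{w}}(K)=\inf_{F}\frac{\mathbf{w}^o(\partial_VF)}{\mathbf{w}^o(F)},$$ where $F$ ranges over finite nonempty subsets of $V(K)$, $\partial_VF$ is the outer vertex boundary of $F$ in $K$, and $o\in V$ is any reference vertex (the ratio does not depend on it). *)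

(* Defs.v *)
From HB Require Import structures.
From mathcomp Require Import all_boot all_order all_algebra.
From mathcomp Require Import all_classical all_reals all_analysis.

Set Implicit Arguments.
Unset Strict Implicit.
Unset Printing Implicit Defensive.

Local Open Scope classical_set_scope.
Local Open Scope ring_scope.

Section Graphs.
Variable V : choiceType.

Record sgraph := SGraph {
  adj : rel V;
  adj_sym : symmetric adj;
  adj_irr : irreflexive adj }.

Definition neighbours (e : rel V) (x : V) : set V := [set y | e x y].

Definition component (e : rel V) (x : V) : set V :=
  [set y | exists2 p : seq V, path e x p & last x p = y].

Definition connected_graph (G : sgraph) := forall x, component (adj G) x = setT.

Definition locally_finite_graph (G : sgraph) :=
  forall x, finite_set (neighbours (adj G) x).

(* A graph whose vertex set is a subset of V; the values of edge K outside
   vertices K are irrelevant. *)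
Record subset_graph := SubsetGraph {
  vertices : set V;
  edge : rel V }.

Definition outer_vertex_boundary (K : subset_graph) (F : set V) : set V :=
  [set y | [/\ vertices K y, ~ F y & exists2 x, F x & edge K x y]].

End Graphs.

Section Automorphisms.
Context {V : choiceType}.
Variable G : sgraph V.

Record aut := Aut {
  aut_fun :> V -> V;
  aut_inv : V -> V;
  aut_funK : cancel aut_fun aut_inv;
  aut_invK : cancel aut_inv aut_fun;
  aut_adj : {mono aut_fun : x y / adj G x y} }.

Lemma aut_ext (g h : aut) : g =1 h -> g = h.
Proof.
case: g => g g' gK g'K ga; case: h => h h' hK h'K ha /= /funext gh.
subst h; have gh' : g' = h' by apply/funext => x; rewrite -{1}(h'K x) gK.
by subst h'; f_equal; exact: Prop_irrelevance.
Qed.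

Definition aut1 : aut := @Aut id id (fun=> erefl) (fun=> erefl) (fun _ _ => erefl).

Definition autM (g h : aut) : aut.
Proof.
apply: (@Aut (g \o h) (aut_inv h \o aut_inv g)).
- by move=> x /=; rewrite !aut_funK.
- by move=> x /=; rewrite !aut_invK.
- by move=> x y /=; rewrite !aut_adj.
Defined.

Definition autV (g : aut) : aut.
Proof.
apply: (@Aut (aut_inv g) g).
- exact: aut_invK.
- exact: aut_funK.
- by move=> x y; rewrite -(aut_adj g) !aut_invK.
Defined.

HB.instance Definition _ := gen_eqMixin aut.
HB.instance Definition _ := gen_choiceMixin aut.

Fact autA : associative autM. Proof. by move=> *; exact: aut_ext. Qed.
Fact aut1l : left_id aut1 autM. Proof. by move=> *; exact: aut_ext. Qed.
Fact aut1r : right_id aut1 autM. Proof. by move=> *; exact: aut_ext. Qed.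
Fact autVl : left_inverse aut1 autV autM.
Proof. by move=> g; apply: aut_ext => x /=; exact: aut_funK. Qed.
Fact autVr : right_inverse aut1 autV autM.
Proof. by move=> g; apply: aut_ext => x /=; exact: aut_invK. Qed.

HB.instance Definition _ := isGroup.Build aut autA aut1l aut1r autVl autVr.

Definition aut_ptws (g : aut) : {ptws V -> discrete_topology V} := g.

HB.instance Definition _ := Topological.copy aut (initial_topology aut_ptws).

End Automorphisms.

Section Subgroups.
Context {V : choiceType} {G : sgraph V}.
Variable Gam : groupClosed (aut G).

Fact groupClosedP : group_closed Gam.
Proof. by split; [exact: gpred1 | exact: gpredF]. Qed.

Definition subgrp := {g : aut G | g \in Gam}.

HB.instance Definition _ := SubChoice.on subgrp.
HB.instance Definition _ :=
  SubChoice_isSubGroup.Build (aut G) (mem Gam) subgrp groupClosedP.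
HB.instance Definition _ := isPointed.Build subgrp 1%g.
HB.instance Definition _ :=
  Topological.copy subgrp (initial_topology (val : subgrp -> aut G)).

Definition closed_subgroup := closed [set g : aut G | g \in Gam].

Definition vertex_orbit (x : V) : set V := [set (g : aut G) x | g in [set` Gam]].

Definition quasi_transitive := finite_set (range vertex_orbit).

Definition stabiliser (x : V) : set subgrp := [set g | (val g : aut G) x = x].

Definition borel_subgrp := g_sigma_algebraType (@open subgrp).

Definition left_translate (g : subgrp) (B : set subgrp) : set subgrp :=
  [set (g * h)%g | h in B].

(* For closed Gam the group is locally compact and second countable (V is
   countable as soon as G is connected and locally finite), so that a Borel
   measure finite on compact sets is automatically Radon. *)
Definition haar_measure (R : realType)
    (m : {measure set borel_subgrp -> \bar R}) :=
  [/\ forall (g : subgrp) (B : set borel_subgrp),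
        measurable B -> m (left_translate g B) = m B,
      forall K : set subgrp, compact K -> (m K < +oo)%E
    & (0 < m setT)%E].

Definition weight (R : realType) (m : {measure set borel_subgrp -> \bar R})
    (x y : V) : \bar R :=
  (m (stabiliser y) / m (stabiliser x))%E.

End Subgroups.

Definition set_weight (R : realType) (V : choiceType) (w : V -> \bar R)
    (A : set V) : \bar R :=
  \esum_(y in A) w y.

Definition cheeger (R : realType) (V : choiceType) (w : V -> \bar R)
    (K : subset_graph V) : \bar R :=
  ereal_inf
    [set (set_weight w (outer_vertex_boundary K F) / set_weight w F)%E
      | F in [set F : set V |
          [/\ finite_set F, F !=set0 & F `<=` vertices K]]].

Section ProductSigmaAlgebra.
Variables (I : Type) (d : measure_display) (T : measurableType d).

Definition cylinders : set (set (I -> T)) :=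
  [set C | exists i (B : set T), measurable B /\ C = [set f | B (f i)]].

Definition power := g_sigma_algebraType cylinders.

HB.instance Definition _ := Measurable.on power.

End ProductSigmaAlgebra.

(* 2^V and 2^(V * V) *)
Notation vset V := (power V bool).
Notation config V := (power (V * V) bool).

Section Configurations.
Context {V : choiceType}.

(* A configuration is read as an undirected graph: x and y are joined as soon
   as (x, y) or (y, x) belongs to it. Symmetry is not assumed. *)
Definition config_adj (w : config V) : rel V :=
  fun x y => w (x, y) || w (y, x).

Definition config_sub (w w' : config V) := forall e, w e -> w' e.

Definition induced_subgraph (w : config V) (A : vset V) : subset_graph V :=
  SubsetGraph [set x | A x]
    (fun x y => [&& A x, A y & config_adj w x y]).

Variable G : sgraph V.

Definition act_vset (g : aut G) (A : vset V) : vset V :=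
  fun x => A (g^-1%g x).

Definition act_config (g : aut G) (w : config V) : config V :=
  fun e => w (g^-1%g e.1, g^-1%g e.2).

Definition act_pair (g : aut G) (p : config V * vset V) :=
  (act_config g p.1, act_vset g p.2).

Definition act_filtration (g : aut G) (p : config V * power nat (config V)) :
    config V * power nat (config V) :=
  (act_config g p.1, fun n => act_config g (p.2 n)).

End Configurations.

Section Laws.
Context {R : realType} {V : choiceType} {G : sgraph V}.
Variable Gam : groupClosed (aut G).

Definition law_invariant d (T : measurableType d) (act : aut G -> T -> T)
    (mu : set T -> \bar R) :=
  forall g : aut G, g \in Gam ->
  forall B : set T, measurable B -> mu (act g @^-1` B) = mu B.

Definition has_law d d' (Om : measurableType d) (T : measurableType d')
    (Q : probability Om R) (X : {RV Q >-> T}) (P : probability T R) :=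
  forall B : set T, measurable B -> distribution Q X B = P B.

Definition bounded_degrees (P : probability (config V) R) :=
  exists D : nat, \forall w \ae P,
    forall x, (neighbours (config_adj w) x #<= `I_D)%card.

Definition hyperfinite (P : probability (config V) R) :=
  exists (d : measure_display) (Om : measurableType d) (Q : probability Om R)
    (w : {RV Q >-> config V}) (wn : {RV Q >-> power nat (config V)}),
  has_law w P /\
  [/\ \forall t \ae Q, forall n,
        config_sub (wn t n) (wn t n.+1) /\ config_sub (wn t n) (w t),
      law_invariant (@act_filtration V G)
        (pushforward Q (fun t => (w t, wn t))),
      \forall t \ae Q, \bigcup_n [set` wn t n] = [set` w t]
    & forall n, \forall t \ae Q, forall x,
        finite_set (component (config_adj (wn t n)) x)].

Definition jointly_invariant (P : probability (config V) R)
    d (Om : measurableType d) (Q : probability Om R)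
    (w : {RV Q >-> config V}) (A : {RV Q >-> vset V}) :=
  has_law w P /\
  law_invariant (@act_pair V G) (pushforward Q (fun t => (w t, A t))).

End Laws.

(* Main.v *)
From HB Require Import structures.
Require Import Defs.
From mathcomp Require Import all_boot all_order all_algebra finmap.
From mathcomp Require Import all_classical all_reals all_analysis.
From mathcomp Require Import measurable_realfun lra.

Set Implicit Arguments.
Unset Strict Implicit.
Unset Printing Implicit Defensive.
Import Order.TTheory GRing.Theory Num.Theory.
Local Open Scope classical_set_scope.
Local Open Scope ring_scope.

(** Write [W x] for the Haar measure of the stabiliser of [x]. It is positive
    and finite, because stabilisers are open and compact, and the relative
    weights are [W y / W x]. Counting the pairs of a vertex and a group element
    in two ways gives the mass transport principle [mass_transport]: for an
    invariant [f >= 0], the sums of [f z y * W x] over the orbit of [x] and of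
    [f x z * W z] over the orbit of [y] agree. Letting every point of a finite
    set [F] spread its mass over the boundary of [F] in proportion to [W], one
    obtains [block_transport]: if finite sets [F] are present with an
    equivariant random intensity, then, summed over a finite transversal of the
    orbits, the expected intensity of the sets through a vertex, each counted
    with its boundary ratio, equals the expected intensity of the sets whose
    boundary meets a vertex. Both directions are instances of this identity.

    _Hyperfinite implies vanishing Cheeger constant._ Let [E] be the event that
    every finite subset of [A] has boundary ratio at least [c > 0] in the
    induced subgraph. Take as blocks the traces on [A] of the finite clusters
    of the [n]-th approximation, on the event [E]. The first side of the
    identity is at least [c] times the probability that [x] lies in [A] and [E]
    holds. If [y] is in the boundary of a block, then an edge at [y] is missing
    from the approximation, and at most [D] clusters are adjacent to [y]; hence
    the second side is at most [D] times the probability of a missing edge at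
    [y], which tends to [0]. So [E] is null ([forward_null]). The approximations
    and [A] need not live on one probability space. This is harmless, as only
    the conditional probability, given the configuration, that a given finite
    set is a cluster enters the computation: it is a Radon-Nikodym derivative,
    a function of the configuration that can be evaluated on the space of [A].

    _Vanishing Cheeger constant implies hyperfinite._ Add independent fair coins
    at the pairs (time, vertex), and fix a tolerance [eps]. Starting from all
    of [V], at time [k] consider the finite components of the configuration
    restricted to the remaining vertices whose coin shows heads, select those
    with boundary ratio at most [eps], and remove them together with their
    boundaries. A connected finite set of ratio at most [eps] that survived
    forever would, by the independence of the coins, be isolated by the coins
    at a late time and be removed; thus the set of vertices that are never
    removed induces a subgraph of positive Cheeger constant
    ([rest_expands], [connected_reduction]), and by hypothesis it is empty. The
    separator, that is the union of the boundaries of all selected sets, then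
    cuts the configuration into finite pieces ([selected_closed]). Each vertex
    lies in at most one selected set, so by mass transport its probability
    of being in the separator is at most a constant times [eps]
    ([separator_small]). With [eps = 2^-(j+1)] and the Borel-Cantelli lemma,
    deleting the edges that touch one of the separators of index [j >= n] gives
    the required increasing sequence ([coupling_hyperfinite]). *)

(** * Countable families and measurability *)

Section Countable.

Lemma countable_enum (I : choiceType) (i0 : I) : countable [set: I] ->
  exists e : nat -> I, forall i, exists n, e n = i.
Proof.
move=> /countable_injP[f finj].
exists (fun n => xget i0 [set i | f i = n]) => i; exists (f i).
case: xgetP => [j _ /= fj|/(_ i) /= []//].
by apply: finj; rewrite ?inE.
Qed.

Lemma countable_fset (I : choiceType) :
  countable [set: I] -> countable [set: {fset I}].
Proof.
move=> /countable_injP[f finj].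
have finj' : injective f by move=> x y fxy; apply: finj; rewrite ?inE.
apply/countable_injP.
exists (fun A : {fset I} => choice.pickle (map f (enum_fset A))) => A B _ _.
move=> /(pcan_inj (@choice.pickleK (seq nat))) /(inj_map finj') e.
by apply/fsetP => x; rewrite -[x \in A]/(x \in enum_fset A) e.
Qed.

Lemma countable_prod (I J : choiceType) :
  countable [set: I] -> countable [set: J] -> countable [set: I * J].
Proof. by move=> cI cJ; rewrite -setXTT; exact: countableX. Qed.

End Countable.

Section Measurability.
Context d (T : measurableType d).

(** This lemma and its companions below let the measurability of an event be
    read off its logical form, with quantifiers over countable types. *)
Lemma measurable_exists (I : choiceType) (P : I -> T -> Prop) :
  countable [set: I] -> (forall i, measurable [set t | P i t]) ->
  measurable [set t | exists i, P i t].
Proof.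
move=> cI mP.
have -> : [set t | exists i, P i t] = \bigcup_i [set t | P i t].
  by apply/seteqP; split => t /= [i]; [exists i|move=> _; exists i].
exact: countable_bigcupT_measurable.
Qed.

Lemma measurable_not (P : T -> Prop) :
  measurable [set t | P t] -> measurable [set t | ~ P t].
Proof. exact: measurableC. Qed.

Lemma measurable_and (P P' : T -> Prop) : measurable [set t | P t] ->
  measurable [set t | P' t] -> measurable [set t | P t /\ P' t].
Proof. exact: measurableI. Qed.

Lemma measurable_or (P P' : T -> Prop) : measurable [set t | P t] ->
  measurable [set t | P' t] -> measurable [set t | P t \/ P' t].
Proof. exact: measurableU. Qed.

Lemma measurable_imp (P P' : T -> Prop) : measurable [set t | P t] ->
  measurable [set t | P' t] -> measurable [set t | P t -> P' t].
Proof.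
move=> mP mP'; have -> : [set t | P t -> P' t] = [set t | ~ P t \/ P' t].
  by apply/seteqP; split => t /=; have := pselect (P t); tauto.
by apply: measurable_or => //; exact: measurable_not.
Qed.

Lemma measurable_forall (I : choiceType) (P : I -> T -> Prop) :
  countable [set: I] -> (forall i, measurable [set t | P i t]) ->
  measurable [set t | forall i, P i t].
Proof.
move=> cI mP.
have -> : [set t | forall i, P i t] = [set t | ~ exists i, ~ P i t].
  by apply/seteqP; split => t /=; rewrite -forallNE => H i; [rewrite notK|exact: contrapT].
by apply/measurable_not/measurable_exists => // i; exact: measurable_not.
Qed.

Lemma measurable_const (P : Prop) : measurable [set _ : T | P].
Proof.
have [p|p] := pselect P.
  by rewrite (_ : [set _ | P] = setT) //; apply/seteqP; split.
by rewrite (_ : [set _ | P] = set0) //; apply/seteqP; split.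
Qed.

Lemma measurable_exists_in (I : choiceType) (P : I -> Prop) (P' : I -> T -> Prop) :
  countable [set: I] -> (forall i, measurable [set t | P' i t]) ->
  measurable [set t | exists2 i, P i & P' i t].
Proof.
move=> cI mP.
have -> : [set t | exists2 i, P i & P' i t] = [set t | exists i, P i /\ P' i t].
  by apply/seteqP; split => t /= [i]; [exists i|case; exists i].
by apply: measurable_exists => // i; apply: measurable_and => //; exact: measurable_const.
Qed.

End Measurability.

Section PowerMeasurable.
Context d (T : measurableType d) (I : Type) d' (T' : measurableType d').

Lemma measurable_coord (i : I) :
  measurable_fun [set: power I T'] (fun f : power I T' => f i).
Proof.
move=> _ B mB; rewrite setTI; apply: sub_sigma_algebra.
by exists i, B.
Qed.

Lemma measurable_fun_power (f : T -> power I T') :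
  (forall i, measurable_fun [set: T] (fun t => f t i)) ->
  measurable_fun [set: T] f.
Proof.
move=> mf.
apply: (@measurability _ _ T (power I T' : measurableType _) _ f (@cylinders I d' T')).
  by [].
move=> _ [_ [i [B [mB ->]]] <-] /=.
exact: mf.
Qed.

End PowerMeasurable.

Lemma measurable_fun_prop d (T : measurableType d) (f : T -> bool) :
  measurable [set t | f t] -> measurable_fun [set: T] f.
Proof.
by move=> mf; apply: (measurable_fun_bool true); rewrite setTI.
Qed.

Lemma measurable_atom d (T : measurableType d) (I : Type) (f : T -> power I bool) i :
  measurable_fun [set: T] f -> measurable [set t | f t i].
Proof.
move=> mf.
have : measurable_fun [set: T] (fun t => f t i).
  exact: (measurableT_comp (@measurable_coord I _ bool i) mf).
by move=> /(_ measurableT [set true]); rewrite setTI; apply.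
Qed.

Section AlmostEverywhere.
Context d (T : measurableType d) (R : realType) (mu : {measure set T -> \bar R}).

Lemma ae_forall_countable (I : choiceType) (P : I -> T -> Prop) :
  countable [set: I] -> (forall i, \forall t \ae mu, P i t) ->
  \forall t \ae mu, forall i, P i t.
Proof.
move=> cI aP; have [[i0]|] := pselect (inhabited I).
  have [e esurj] := countable_enum i0 cI.
  have := ae_foralln (fun n => aP (e n)).
  by apply: filterS => t Pt i; have [n <-] := esurj i.
by move=> nI; apply: aeW => t i; exfalso; apply: nI.
Qed.

Lemma ae_measure0 (P : T -> Prop) : measurable [set t | P t] ->
  mu [set t | P t] = 0%E -> \forall t \ae mu, ~ P t.
Proof.
by move=> mP P0; exists [set t | P t]; split => // t /= /contrapT.
Qed.

Lemma measure0_ae_not (P : T -> Prop) : measurable [set t | P t] ->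
  (\forall t \ae mu, ~ P t) -> mu [set t | P t] = 0%E.
Proof.
move=> mP [N [mN N0 PN]]; apply/eqP; rewrite -measure_le0 -N0.
by apply: le_measure; rewrite ?inE // => t /= Pt; apply: PN.
Qed.

End AlmostEverywhere.

(** * Indicators and unordered sums *)
Section Indicator.
Context {R : realType}.

(** Indicators of propositions, rather than of sets, keep the conditions in
    sums and integrals in the form in which they are reasoned about. *)
Definition ind (P : Prop) : \bar R := if `[< P >] then 1%E else 0%E.

Lemma indT (P : Prop) : P -> ind P = 1%E.
Proof. by rewrite /ind => /asboolT ->. Qed.

Lemma indF (P : Prop) : ~ P -> ind P = 0%E.
Proof. by rewrite /ind => /asboolF ->. Qed.

Lemma ind_ge0 P : (0 <= ind P)%E.
Proof. by rewrite /ind; case: ifP. Qed.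

Lemma ind_le1 P : (ind P <= 1)%E.
Proof. by rewrite /ind; case: ifP. Qed.

Lemma ind_iff (P P' : Prop) : (P <-> P') -> ind P = ind P'.
Proof. by move=> /propext ->. Qed.

Lemma ind_le (P P' : Prop) : (P -> P') -> (ind P <= ind P')%E.
Proof.
move=> PP'; have [p|p] := pselect P; last by rewrite (indF p) ind_ge0.
by rewrite !indT //; exact: PP'.
Qed.

Lemma ind_and (P P' : Prop) : ind (P /\ P') = (ind P * ind P')%E.
Proof.
have [p|p] := pselect P; last by rewrite (indF p) mul0e indF // => -[].
by rewrite (indT p) mul1e; apply: ind_iff; split => [[]|].
Qed.

Lemma ind_mul_ge0 P (a : \bar R) : (0 <= a)%E -> (0 <= ind P * a)%E.
Proof. by move=> a0; rewrite mule_ge0 // ind_ge0. Qed.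

Context d (T : measurableType d).

Lemma measurable_ind (P : T -> Prop) : measurable [set t | P t] ->
  measurable_fun [set: T] (fun t => ind (P t)).
Proof.
move=> mP; apply: measurable_fun_ifT => //.
by apply: measurable_fun_prop; rewrite (_ : mkset _ = [set t | P t]) //;
  apply/seteqP; split => t /=; move/asboolP.
Qed.

Lemma integral_ind (mu : {measure set T -> \bar R}) (P : T -> Prop) :
  measurable [set t | P t] -> (\int[mu]_t ind (P t) = mu [set t | P t])%E.
Proof.
move=> mP; rewrite -[in RHS](setIT [set t | P t]) -integral_indic //.
apply: eq_integral => t _; rewrite indicE /ind.
by have -> : (t \in [set t | P t]) = `[< P t >] by []; case: ifP.
Qed.

End Indicator.

Section Esum.
Context {R : realType}.
Local Open Scope ereal_scope.

Lemma esum_swap (I J : choiceType) (a : I -> J -> \bar R) :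
  (forall i j, 0 <= a i j) ->
  \esum_(i in [set: I]) \esum_(j in [set: J]) a i j =
  \esum_(j in [set: J]) \esum_(i in [set: I]) a i j.
Proof.
move=> a0; rewrite !esum_esum //.
rewrite (reindex_esum ([set: J] `*` [set: I]) _ (fun x => (x.2, x.1))) //; split=> //=.
- by move=> [i1 i2] [j1 j2] /= _ _ [] -> ->.
- by move=> [i1 i2] _ /=; exists (i2, i1).
Qed.

Lemma esum_only (I : choiceType) (i0 : I) (a : I -> \bar R) :
  0 <= a i0 -> (forall i, i <> i0 -> a i = 0) ->
  \esum_(i in [set: I]) a i = a i0.
Proof.
move=> a0 aE; rewrite -[RHS](esum_set1 a0) [RHS]esum_mkcond; apply: eq_esum => i _.
by case: ifPn => //; rewrite notin_setE; exact: aE.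
Qed.

Lemma esumZl (I : choiceType) (c : R) (a : I -> \bar R) :
  (0 <= c)%R -> (forall i, 0 <= a i) ->
  \esum_(i in [set: I]) (c%:E * a i) = c%:E * \esum_(i in [set: I]) a i.
Proof.
move=> c0 a0.
have le (k : R) (b : I -> \bar R) : (0 <= k)%R -> (forall i, 0 <= b i) ->
    \esum_(i in [set: I]) (k%:E * b i) <= k%:E * \esum_(i in [set: I]) b i.
  move=> k0 b0; apply: ge_ereal_sup => /= _ [X [finX _] <-].
  rewrite -ge0_mule_fsumr //; apply: lee_wpmul2l; first by rewrite lee_fin.
  by apply: ereal_sup_ubound; exists X.
apply/eqP; rewrite eq_le le //=.
have [->|cn0] := eqVneq c 0%R; first by rewrite mul0e esum_ge0 // => i _; rewrite mul0e.
have cp : (0 < c)%R by rewrite lt_neqAle eq_sym cn0.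
rewrite -lee_pdivlMl //.
have := le c^-1%R (fun i => c%:E * a i); rewrite invr_ge0 c0.
move=> /(_ isT) h; apply: le_trans (h _); last first.
  by move=> i; rewrite mule_ge0 // lee_fin.
by apply: le_esum => i _; rewrite muleA -EFinM mulVf // mul1e.
Qed.

Lemma esum_ge1 (I : choiceType) (i0 : I) (a : I -> \bar R) :
  (forall i, 0 <= a i) -> a i0 <= \esum_(i in [set: I]) a i.
Proof.
move=> a0; rewrite -[leLHS](esum_set1 (a0 i0)) esum_mkcond; apply: le_esum => i _.
by case: ifP.
Qed.

Lemma esumeZl (I : choiceType) (c : \bar R) (a : I -> \bar R) :
  0 <= c -> (forall i, 0 <= a i) ->
  \esum_(i in [set: I]) (c * a i) = c * \esum_(i in [set: I]) a i.
Proof.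
case: c => [c c0 a0|_ a0|//]; first by apply: esumZl => //; rewrite -lee_fin.
have [[i ai]|na] := pselect (exists i, a i <> 0); last first.
  have aE i : a i = 0 by apply: contrapT => ai; apply: na; exists i.
  by rewrite !esum1 ?mule0 // => i _; rewrite aE mule0.
have aip : 0 < a i by rewrite lt_neqAle a0 andbT eq_sym; apply/eqP.
have sp : 0 < \esum_(i in [set: I]) a i by apply: lt_le_trans (esum_ge1 i a0).
rewrite [RHS]gt0_mulye //.
apply/eqP; rewrite -leye_eq -{1}(gt0_mulye aip).
by apply: (@esum_ge1 I i (fun i => +oo * a i)) => j; rewrite mule_ge0.
Qed.

(** Sums over a countable type become series, for which the monotone
    convergence theorem is available. Positions [n] that are not codes
    contribute [0]. *)
Lemma esum_series (I : choiceType) (i0 : I) : countable [set: I] ->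
  exists (e : nat -> I) (P : pred nat), forall a : I -> \bar R,
  (forall i, 0 <= a i) ->
  \esum_(i in [set: I]) a i = \sum_(n <oo) (if P n then a (e n) else 0).
Proof.
move=> /countable_injP[f finj].
pose e n := xget i0 [set i | f i = n].
have ef i : e (f i) = i.
  rewrite /e; case: xgetP => [j _ /= fj|/(_ i) /= []//].
  by apply: finj; rewrite ?inE.
exists e, (fun n => `[< range f n >]) => a a0.
rewrite -eseries_mkcond nneseries_esum //.
have -> : [set x | `[< range f x >]] = [set f i | i in [set: I]].
  by apply/seteqP; split => x /= /asboolP.
by rewrite esum_image //; apply: eq_esum => i _; rewrite ef.
Qed.

Context d (T : measurableType d).

Lemma measurable_esum (I : choiceType) (f : I -> T -> \bar R) :
  countable [set: I] -> (forall i t, 0 <= f i t) ->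
  (forall i, measurable_fun [set: T] (f i)) ->
  measurable_fun [set: T] (fun t => \esum_(i in [set: I]) f i t).
Proof.
move=> cI f0 mf; have [[i0]|nI] := pselect (inhabited I); last first.
  have -> : (fun t => \esum_(i in [set: I]) f i t) = cst 0 => //.
  by apply/funext => t /=; rewrite esum1 // => i; exfalso; apply: nI.
have [e [P eP]] := esum_series i0 cI.
have -> : (fun t => \esum_(i in [set: I]) f i t) =
    (fun t => \sum_(n <oo | n \in predT) (if P n then f (e n) t else 0)).
  by apply/funext => t; rewrite eP.
by apply: ge0_emeasurable_sum => [k x _ _|k _]; case: (P k).
Qed.

Lemma integral_esum (mu : {measure set T -> \bar R}) (I : choiceType)
    (f : I -> T -> \bar R) :
  countable [set: I] -> (forall i t, 0 <= f i t) ->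
  (forall i, measurable_fun [set: T] (f i)) ->
  \int[mu]_t (\esum_(i in [set: I]) f i t) =
  \esum_(i in [set: I]) (\int[mu]_t f i t).
Proof.
move=> cI f0 mf; have [[i0]|nI] := pselect (inhabited I); last first.
  rewrite [RHS]esum1; last by move=> i; exfalso; apply: nI.
  by apply: integral0_eq => t _; rewrite esum1 // => i; exfalso; apply: nI.
have [e [P eP]] := esum_series i0 cI.
rewrite eP; last by move=> i; exact: integral_ge0.
under eq_integral do rewrite eP //.
rewrite integral_nneseries //.
- by apply: eq_eseriesr => n _; case: (P n) => //; rewrite integral0.
- by move=> n; case: (P n).
- by move=> n t _; case: (P n).
Qed.

Lemma measure_esum (mu : {measure set T -> \bar R}) (I : choiceType)
    (E : set T) (F : I -> set T) :
  countable [set: I] -> measurable E -> (forall i, measurable (F i)) ->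
  (forall t, E t -> exists i, F i t /\ forall j, F j t -> j = i) ->
  mu E = \esum_(i in [set: I]) mu (E `&` F i).
Proof.
move=> cI mE mF part.
have mEF i : measurable [set t | E t /\ F i t] by apply: measurableI.
rewrite -[LHS](integral_ind mu (P := E)) //.
transitivity (\int[mu]_t (\esum_(i in [set: I]) ind (R := R) (E t /\ F i t))).
  apply: eq_integral => t _; have [Et|Et] := pselect (E t); last first.
    by rewrite (indF Et) esum1 // => i _; rewrite indF // => -[].
  have [i [Fi Fj]] := part t Et.
  rewrite (esum_only (i0 := i)) ?ind_ge0 // ?indT // => j ji.
  by rewrite indF // => -[_ /Fj].
rewrite integral_esum //; last 2 first.
- by move=> i t; exact: ind_ge0.
- by move=> i; exact: measurable_ind.
by apply: eq_esum => i _; rewrite integral_ind.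
Qed.

End Esum.

(** * Balls, and compactness of stabilisers *)
Section Balls.
Context {V : choiceType} (G : sgraph V).
Hypothesis Gconn : connected_graph G.
Hypothesis Glf : locally_finite_graph G.

(** Walks of length exactly [n] are easier to count than balls and still
    exhaust the graph. *)
Definition walk_ends (x : V) (n : nat) : set V :=
  [set y | exists2 p : seq V, path (adj G) x p /\ size p = n & last x p = y].

Lemma finite_walk_ends x n : finite_set (walk_ends x n).
Proof.
elim: n => [|n IH].
  apply: (@sub_finite_set _ _ [set x]) (finite_set1 x) => y [p [_ /size0nil ->] <-] //.
apply: (@sub_finite_set _ _ (\bigcup_(y in walk_ends x n) neighbours (adj G) y)).
  move=> y [p]; case/lastP: p => [|p z] [] // pp /eqP; rewrite size_rcons eqSS.
  move=> /eqP sp; rewrite last_rcons => <-.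
  move: pp; rewrite rcons_path => /andP[pp az]; exists (last x p) => //.
  by exists p.
by apply: bigcup_finite => // y _; exact: Glf.
Qed.

Lemma walk_ends_cover x y : exists n, walk_ends x n y.
Proof.
have : component (adj G) x y by rewrite Gconn.
by move=> [p pp pl]; exists (size p), p.
Qed.

Lemma countable_vertices (x : V) : countable [set: V].
Proof.
have -> : [set: V] = \bigcup_n walk_ends x n.
  apply/seteqP; split => // y _.
  by have [n yn] := walk_ends_cover x y; exists n.
by apply: bigcup_countable => // n _; exact/finite_set_countable/finite_walk_ends.
Qed.

Lemma walk_ends_aut (g : aut G) x n y :
  walk_ends x n y -> walk_ends (g x) n (g y).
Proof.
move=> [p [pp sp] <-]; exists (map g p); last by rewrite last_map.
split; last by rewrite size_map.
by move: pp; rewrite path_map; apply: sub_path => a b; rewrite /= aut_adj.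
Qed.

End Balls.

Section Topology.
Context {V : choiceType} {G : sgraph V}.

Lemma open_aut_point (x y : V) : open [set g : aut G | g x = y].
Proof.
exists [set f : {ptws V -> discrete_topology V} | f x = y] => //.
have -> : [set f : {ptws V -> discrete_topology V} | f x = y]
  = (fun f => f x) @^-1` [set y] by [].
apply: (@open_comp {ptws V -> discrete_topology V} (discrete_topology V)).
  move=> f _; exact: (@proj_continuous _ (fun=> discrete_topology V) x f).
exact: discrete_open.
Qed.

Lemma aut_cvg (F : set_system (aut G)) (h : aut G) : Filter F ->
  (forall x, F [set g : aut G | g x = h x]) -> F --> h.
Proof.
move=> FF Fh A [B [[C oC <-] Ch] CA].
apply: (filterS CA).
have : nbhs (aut_ptws h) C by exact: open_nbhs_nbhs.
suff : fmap (@aut_ptws V G) F --> (aut_ptws h : {ptws V -> discrete_topology V}).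
  by move=> cF nC; exact: (cF _ nC).
apply/cvg_sup => x D [E [[E' oE <-] Eh] ED] /=.
suff : F [set g : aut G | D (aut_ptws g)] by [].
apply: filterS (Fh x) => g gh; apply: ED.
have : E' (h x) by exact: Eh.
by rewrite -[h x]gh.
Qed.

Variable Gam : groupClosed (aut G).

Lemma subgrp_cvg (F : set_system (subgrp Gam)) (h : subgrp Gam) : Filter F ->
  (forall x, F [set g | (val g : aut G) x = (val h : aut G) x]) -> F --> h.
Proof.
move=> FF Fh A [B [[C oC <-] Ch] CA].
apply: (filterS CA).
have : nbhs (val h : aut G) C by exact: open_nbhs_nbhs.
by apply: (@aut_cvg (fmap (val : subgrp Gam -> aut G) F)).
Qed.

Lemma open_subgrp_point (x y : V) :
  open [set g : subgrp Gam | (val g : aut G) x = y].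
Proof. by exists [set g : aut G | g x = y] => //; exact: open_aut_point. Qed.


(** An ultrafilter has to choose between finitely many values. *)
Lemma ultra_finite_range T (F : set_system T) (f : T -> V) (s : seq V) :
  UltraFilter F -> F [set g | f g \in s] -> exists z, F [set g | f g = z].
Proof.
move=> UF; elim: s => [|z s IH] Fs.
  by exfalso; apply: (@filter_not_empty _ F); apply: filterS Fs.
have [?|Fz] := in_ultra_setVsetC [set g | f g = z] UF; first by exists z.
apply: IH; apply: filterS (filterI Fs Fz) => g [] /=.
by rewrite inE => /orP[/eqP|].
Qed.

Hypothesis Gconn : connected_graph G.
Hypothesis Glf : locally_finite_graph G.
Hypothesis Gam_closed : closed_subgroup Gam.

(** Elements fixing [x] move every vertex within a finite set, and so do their
    inverses. An ultrafilter on the stabiliser therefore determines the image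
    and the preimage of every vertex, that is, a limit automorphism; the
    preimages are what makes the limit surjective. *)
Lemma compact_stabiliser x : compact (@stabiliser V G Gam x).
Proof.
rewrite compact_ultra => F UF Fx.
have FF : Filter F := ultra_proper.
have lim y : exists z, F [set g | (val g : aut G) y = z].
  have [n yn] := walk_ends_cover Gconn x y.
  have /finite_seqP[s es] := finite_walk_ends Glf x n.
  apply: (@ultra_finite_range _ F (fun g => (val g : aut G) y) s) => //.
  apply: filterS Fx => g gx /=.
  have : walk_ends G x n ((val g : aut G) y).
    by have := walk_ends_aut (val g : aut G) yn; rewrite (gx : (val g : aut G) x = x).
  by rewrite es.
have liminv y : exists z, F [set g | aut_inv (val g : aut G) y = z].
  have [n yn] := walk_ends_cover Gconn x y.
  have /finite_seqP[s es] := finite_walk_ends Glf x n.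
  apply: (@ultra_finite_range _ F (fun g => aut_inv (val g : aut G) y) s) => //.
  apply: filterS Fx => g gx /=.
  have gVx : aut_inv (val g : aut G) x = x.
    by rewrite -{1}(gx : (val g : aut G) x = x) aut_funK.
  have : walk_ends G x n (aut_inv (val g : aut G) y).
    by have := walk_ends_aut (autV (val g : aut G)) yn; rewrite /= gVx.
  by rewrite es.
have [f Ff] := choice lim; have [f' Ff'] := choice liminv.
have fK : cancel f f'.
  move=> y; have [g [/= fy f'y]] := filter_ex (filterI (Ff y) (Ff' (f y))).
  by rewrite -f'y -fy aut_funK.
have f'K : cancel f' f.
  move=> y; have [g [/= fy f'y]] := filter_ex (filterI (Ff' y) (Ff (f' y))).
  by rewrite -f'y -fy aut_invK.
have fadj : {mono f : x y / adj G x y}.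
  move=> y z; have [g [/= <- <-]] := filter_ex (filterI (Ff y) (Ff z)).
  exact: aut_adj.
pose h : aut G := Aut fK f'K fadj.
have Fh : fmap (val : subgrp Gam -> aut G) F --> h by exact: aut_cvg.
have hGam : h \in Gam.
  have : [set g : aut G | g \in Gam] h.
    apply: (@closed_cvg _ _ F _ (fun g : subgrp Gam => val g : aut G)
      [set g : aut G | g \in Gam] Gam_closed _ h Fh).
    by apply: filterE => g; exact: valP.
  by [].
exists (exist _ h hGam); split.
  have [g [/= gx fx]] := filter_ex (filterI Fx (Ff x)).
  by rewrite /stabiliser /= -fx.
exact: subgrp_cvg.
Qed.

End Topology.

(** * Haar measure and the mass transport principle *)
Section Haar.
Context (R : realType) (V : choiceType) (G : sgraph V).
Hypothesis Gconn : connected_graph G.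
Hypothesis Glf : locally_finite_graph G.
Variable Gam : groupClosed (aut G).
Hypothesis Gam_closed : closed_subgroup Gam.
Variable m : {measure set (borel_subgrp Gam) -> \bar R}.
Hypothesis m_haar : haar_measure m.

Definition subgrp_app (g : subgrp Gam) : V -> V := (val g : aut G).

Lemma subgrp_appM g h x : subgrp_app (g * h)%g x = subgrp_app g (subgrp_app h x).
Proof. by rewrite /subgrp_app valM. Qed.

Lemma subgrp_app1 x : subgrp_app 1%g x = x.
Proof. by rewrite /subgrp_app val1. Qed.

Lemma subgrp_appVK g x : subgrp_app g^-1%g (subgrp_app g x) = x.
Proof. by rewrite -subgrp_appM mulVg subgrp_app1. Qed.

Lemma subgrp_appKV g x : subgrp_app g (subgrp_app g^-1%g x) = x.
Proof. by rewrite -subgrp_appM mulgV subgrp_app1. Qed.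

(** The nonempty transporters are the left cosets of stabilisers; all Haar
    measures that are needed are those of intersections of two of them. *)
Definition transporter (x y : V) : set (borel_subgrp Gam) :=
  [set g : subgrp Gam | subgrp_app g x = y].

Lemma measurable_transporter x y : measurable (transporter x y).
Proof. by apply: sub_sigma_algebra; exact: open_subgrp_point. Qed.

Lemma transporter_translate g x y a b :
  left_translate g (transporter x y `&` transporter a b) =
  transporter x (subgrp_app g y) `&` transporter a (subgrp_app g b).
Proof.
apply/seteqP; split => [_ [h [hx ha] <-]|h [hx ha]].
  by split; rewrite /transporter /= subgrp_appM ?hx ?ha.
exists (g^-1 * h)%g; last by rewrite mulgA mulgV mul1g.
by split; rewrite /transporter /= subgrp_appM ?hx ?ha subgrp_appVK.
Qed.

Lemma haar_transporter2 g x y a b :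
  m (transporter x (subgrp_app g y) `&` transporter a (subgrp_app g b)) =
  m (transporter x y `&` transporter a b).
Proof.
rewrite -transporter_translate; have [mL _ _] := m_haar; apply: mL.
by apply: measurableI; exact: measurable_transporter.
Qed.

Lemma haar_transporter g x y :
  m (transporter x (subgrp_app g y)) = m (transporter x y).
Proof.
by rewrite -[X in m X]setIid haar_transporter2 setIid.
Qed.

(** The group is the union of countably many transporters of [x], all of
    which are translates of the stabiliser or empty. *)
Lemma haar_stabiliser_gt0 x : (0 < m (stabiliser x))%E.
Proof.
rewrite lt_neqAle measure_ge0 andbT eq_sym; apply/eqP => m0.
have [_ _] := m_haar; apply/negP; rewrite -leNgt.
rewrite (@measure_esum _ _ _ m V setT (transporter x)) //.
- rewrite esum1 // => y _; rewrite setTI.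
  have [[g gx]|ng] := pselect (exists g, subgrp_app g x = y).
    by rewrite -gx haar_transporter.
  rewrite (_ : transporter x y = set0) ?measure0 //.
  by apply/seteqP; split => // g gx; apply: ng; exists g.
- exact: countable_vertices Gconn Glf x.
- by move=> y; exact: measurable_transporter.
- by move=> g _; exists (subgrp_app g x); split => // y <-.
Qed.

Lemma haar_stabiliser_fin x : m (stabiliser x) \is a fin_num.
Proof.
rewrite ge0_fin_numE //; have [_ mK _] := m_haar; apply: mK.
exact: compact_stabiliser.
Qed.

Definition haar_weight (x : V) : R := fine (m (stabiliser x)).

Lemma haar_weightE x : (haar_weight x)%:E = m (stabiliser x).
Proof. by rewrite /haar_weight fineK // haar_stabiliser_fin. Qed.

Lemma haar_weight_gt0 x : 0 < haar_weight x.
Proof. by rewrite -lte_fin haar_weightE haar_stabiliser_gt0. Qed.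

Lemma in_orbit x y : vertex_orbit Gam x y <-> exists g, subgrp_app g x = y.
Proof.
split=> [[g Gg <-]|[g <-]]; last by exists (val g) => //; exact: valP.
by exists (exist _ g Gg).
Qed.

(** The measure of a nonempty transporter depends on its source only. This asymmetry is
    the reason why weights enter the mass transport principle. *)
Lemma haar_orbit x y :
  m (transporter x y) = (ind (vertex_orbit Gam x y) * (haar_weight x)%:E)%E.
Proof.
have [xy|nxy] := pselect (vertex_orbit Gam x y).
  rewrite indT // mul1e haar_weightE; have /in_orbit[g <-] := xy.
  exact: haar_transporter.
rewrite indF // mul0e (_ : transporter x y = set0) ?measure0 //.
by apply/seteqP; split => // g gx; apply/nxy/in_orbit; exists g.
Qed.

Lemma measure_transporter_targets x (E : set (borel_subgrp Gam)) : measurable E ->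
  m E = (\esum_(z in [set: V]) m (E `&` transporter x z))%E.
Proof.
move=> mE; apply: (@measure_esum _ _ _ m V E (transporter x)) => //.
- exact: countable_vertices Gconn Glf x.
- by move=> y; exact: measurable_transporter.
- by move=> g _; exists (subgrp_app g x); split => // y <-.
Qed.

Lemma measure_transporter_sources y (E : set (borel_subgrp Gam)) : measurable E ->
  m E = (\esum_(z in [set: V]) m (E `&` transporter z y))%E.
Proof.
move=> mE; apply: (@measure_esum _ _ _ m V E (transporter ^~ y)) => //.
- exact: countable_vertices Gconn Glf y.
- by move=> z; exact: measurable_transporter.
- move=> g _; exists (subgrp_app g^-1%g y); split; first exact: subgrp_appKV.
  by move=> z <-; rewrite subgrp_appVK.
Qed.

(** Both sides compute the sum over [(z, u)] of [f z y] times the measure of the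
    set of [g] sending [x] to [z] and [u] to [y]: on that set, invariance under
    [g] gives [f z y = f x u]. *)
Lemma mass_transport (f : V -> V -> \bar R) (x y : V) :
  (forall u v, 0 <= f u v)%E ->
  (forall g u v, g \in Gam -> f ((g : aut G) u) (g v) = f u v) ->
  (\esum_(z in [set: V]) (ind (vertex_orbit Gam x z) * (f z y * (haar_weight x)%:E)) =
   \esum_(z in [set: V]) (ind (vertex_orbit Gam y z) * (f x z * (haar_weight z)%:E)))%E.
Proof.
move=> f0 finv.
transitivity (\esum_(z in [set: V]) (f z y * m (transporter x z)))%E.
  by apply: eq_esum => z _; rewrite haar_orbit muleCA.
transitivity (\esum_(z in [set: V]) (f x z * m (transporter z y)))%E; last first.
  apply: eq_esum => z _; rewrite haar_orbit muleCA; congr (_ * _)%E.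
  apply: ind_iff; split=> /in_orbit[g <-]; apply/in_orbit.
    by exists g^-1%g; rewrite subgrp_appVK.
  by exists g^-1%g; rewrite subgrp_appVK.
transitivity (\esum_(z in [set: V]) \esum_(u in [set: V])
    (f z y * m (transporter x z `&` transporter u y)))%E.
  apply: eq_esum => z _; rewrite esumeZl //; congr (_ * _)%E.
  by apply: measure_transporter_sources; exact: measurable_transporter.
rewrite esum_swap; last by move=> z u; rewrite mule_ge0.
apply: eq_esum => u _.
transitivity (\esum_(z in [set: V])
    (f x u * m (transporter u y `&` transporter x z)))%E.
  apply: eq_esum => z _; rewrite [in RHS]setIC.
  have [[g [gx gu]]|ng] := pselect (exists g, subgrp_app g x = z /\ subgrp_app g u = y).
    by rewrite -{1}gx -{1}gu /subgrp_app finv //; exact: valP.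
  rewrite (_ : transporter x z `&` transporter u y = set0) ?measure0 ?mule0 //.
  by apply/seteqP; split => // g [gx gu]; apply: ng; exists g.
rewrite esumeZl //; congr (_ * _)%E.
apply/esym; apply: measure_transporter_targets.
exact: measurable_transporter.
Qed.

(** The cardinality of the orbit of [y] under the stabiliser of [x]. *)
Let suborbit_size x y : \bar R := (\esum_(z in [set: V])
  ind (exists g, subgrp_app g x = x /\ subgrp_app g y = z))%E.

Let suborbit_size_aut g x y :
  suborbit_size (subgrp_app g x) (subgrp_app g y) = suborbit_size x y.
Proof.
rewrite /suborbit_size (reindex_esum [set: V] _ (subgrp_app g)); last first.
  split=> //.
  - by move=> a b _ _ /(congr1 (subgrp_app g^-1%g)); rewrite !subgrp_appVK.
  - by move=> z _; exists (subgrp_app g^-1%g z) => //; rewrite subgrp_appKV.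
apply: eq_esum => z _; apply: ind_iff; split => -[h [hx hy]].
  exists (g^-1 * h * g)%g; rewrite !subgrp_appM hx hy !subgrp_appVK; split => //.
exists (g * h * g^-1)%g; rewrite !subgrp_appM !subgrp_appVK hx hy; split => //.
Qed.

Let haar_suborbit_size x y :
  m (stabiliser x) = (suborbit_size x y * m (stabiliser x `&` stabiliser y))%E.
Proof.
rewrite (@measure_transporter_targets y); last exact: (measurable_transporter x x).
rewrite /suborbit_size muleC -esumeZl // => [|i]; last exact: ind_ge0.
apply: eq_esum => z _.
have [[g [gx gy]]|ng] := pselect (exists g, subgrp_app g x = x /\ subgrp_app g y = z).
  rewrite indT ?mule1; last by exists g.
  by have := haar_transporter2 g x x y y; rewrite gx gy.
rewrite indF // mule0 (_ : _ `&` _ = set0) ?measure0 //.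
by apply/seteqP; split => // g [gx gu]; apply: ng; exists g.
Qed.

(** The weight itself is not invariant unless the group is unimodular, but its
    ratios are: [haar_weight x] is the size of a suborbit times the measure of
    the common stabiliser of [x] and [y], so that a ratio of weights is a ratio
    of suborbit sizes. *)
Lemma haar_weight_ratio g x y :
  haar_weight (subgrp_app g x) * haar_weight y =
  haar_weight x * haar_weight (subgrp_app g y).
Proof.
have key a b : exists c k l : R,
    [/\ haar_weight a = k * c, haar_weight b = l * c,
        suborbit_size a b = k%:E & suborbit_size b a = l%:E].
  have mab : m (stabiliser a `&` stabiliser b) \is a fin_num.
    rewrite ge0_fin_numE //; apply: le_lt_trans (_ : m (stabiliser a) < +oo)%E.
      apply: le_measure; rewrite ?inE /=; [|exact: (measurable_transporter a a)|
                                          exact: subIsetl].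
      by apply: measurableI; [exact: (measurable_transporter a a)|
                              exact: (measurable_transporter b b)].
    by rewrite -ge0_fin_numE // haar_stabiliser_fin.
  have fin a' b' : m (stabiliser a' `&` stabiliser b') \is a fin_num ->
      exists2 k : R, suborbit_size a' b' = k%:E &
        haar_weight a' = k * fine (m (stabiliser a' `&` stabiliser b')).
    move=> fin; have := haar_suborbit_size a' b'.
    have := haar_weight_gt0 a'; rewrite -haar_weightE.
    move: fin; set c := m _ => /fineK <-.
    have : (0 <= suborbit_size a' b')%E by apply: esum_ge0 => z _; exact: ind_ge0.
    case: (suborbit_size a' b') => [k|_|//] => [_|] ap.
      by rewrite -EFinM => -[->]; exists k.
    have [c0|c0|c0] := ltgtP (fine c) 0.
    - by rewrite lt0_mulye ?lte_fin.
    - by rewrite gt0_mulye ?lte_fin.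
    - by rewrite c0 mule0 => -[a0]; rewrite a0 ltxx in ap.
  have [k kE hk] := fin a b mab.
  have mba : m (stabiliser b `&` stabiliser a) \is a fin_num by rewrite setIC.
  have [l lE hl] := fin b a mba.
  exists (fine (m (stabiliser a `&` stabiliser b))), k, l; split => //.
  by rewrite hl setIC.
have [c [k [l [-> -> kE lE]]]] := key x y.
have [c' [k' [l' [-> ->]]]] := key (subgrp_app g x) (subgrp_app g y).
rewrite !suborbit_size_aut kE lE => -[<-] [<-].
by rewrite mulrACA [RHS]mulrACA [c' * c]mulrC.
Qed.

End Haar.

(** * Transport from random finite sets to their boundaries *)
Section Orbits.
Context {V : choiceType} {G : sgraph V}.
Variable Gam : groupClosed (aut G).

Lemma orbit_refl x : vertex_orbit Gam x x.
Proof. by apply/in_orbit; exists 1%g; rewrite subgrp_app1. Qed.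

Lemma orbit_sym x y : vertex_orbit Gam x y -> vertex_orbit Gam y x.
Proof.
by move=> /in_orbit[g <-]; apply/in_orbit; exists g^-1%g; rewrite subgrp_appVK.
Qed.

Lemma orbit_trans x y z :
  vertex_orbit Gam x y -> vertex_orbit Gam y z -> vertex_orbit Gam x z.
Proof.
move=> /in_orbit[g <-] /in_orbit[h <-]; apply/in_orbit.
by exists (h * g)%g; rewrite subgrp_appM.
Qed.

Lemma orbit_eq x y : vertex_orbit Gam x y -> vertex_orbit Gam x = vertex_orbit Gam y.
Proof.
move=> xy; apply/seteqP; split => z; last exact: orbit_trans.
by apply: orbit_trans; exact: orbit_sym.
Qed.

Record transversal (r : seq V) : Prop := Transversal {
  transversal_uniq : uniq r;
  transversal_cover : forall z, exists2 x, x \in r & vertex_orbit Gam x z;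
  transversal_sep : forall x y, x \in r -> y \in r -> vertex_orbit Gam x y -> x = y }.

(** Prescribing a representative makes statements about the vertices of a
    transversal apply to every vertex. *)
Lemma transversal_exists (x0 : V) : quasi_transitive Gam ->
  exists2 r, transversal r & x0 \in r.
Proof.
move=> qt.
pose rep (O : set V) := if `[< O x0 >] then x0 else xget x0 O.
have repP x : vertex_orbit Gam x (rep (vertex_orbit Gam x)).
  rewrite /rep; case: asboolP => // _; case: xgetP => [y _ //|/(_ x)].
  by move=> h; exfalso; apply: h; exact: orbit_refl.
have /finite_seqP[s es] : finite_set (rep @` range (vertex_orbit Gam)).
  exact: finite_image.
have ins x : (x \in s) <-> (rep @` range (vertex_orbit Gam)) x by rewrite es.
exists (undup s); last first.
  rewrite mem_undup; apply/ins; exists (vertex_orbit Gam x0) => //.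
  by rewrite /rep asboolT //; exact: orbit_refl.
split; first exact: undup_uniq.
- move=> z; exists (rep (vertex_orbit Gam z)); last exact: orbit_sym.
  by rewrite mem_undup; apply/ins; exists (vertex_orbit Gam z).
- move=> x y; rewrite !mem_undup => /ins[_ [u _ <-] <-] /ins[_ [v _ <-] <-] uv.
  congr rep; apply: orbit_eq.
  exact: orbit_trans (orbit_trans (repP u) uv) (orbit_sym (repP v)).
Qed.

Lemma esum_transversal (R : realType) r (a : V -> \bar R) : transversal r ->
  (forall z, 0 <= a z)%E ->
  (\esum_(z in [set: V]) a z =
   \sum_(x <- r) \esum_(z in [set: V]) (ind (vertex_orbit Gam x z) * a z))%E.
Proof.
move=> [ru rc rs] a0; rewrite -esum_sum; last first.
  by move=> z x _ _; exact: ind_mul_ge0.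
apply: eq_esum => z _; have [x xr xz] := rc z.
rewrite (bigD1_seq x) //= indT // mul1e big_seq_cond big1 ?adde0 //.
move=> y /andP[yr yx]; rewrite indF ?mul0e // => yz.
by move/eqP: yx; apply; apply: rs => //; apply: orbit_trans yz _; exact: orbit_sym.
Qed.

End Orbits.

Section SetTransport.
Context (R : realType) (V : choiceType) (G : sgraph V).
Hypothesis Gconn : connected_graph G.
Hypothesis Glf : locally_finite_graph G.
Variable Gam : groupClosed (aut G).
Hypothesis Gam_closed : closed_subgroup Gam.
Variable m : {measure set (borel_subgrp Gam) -> \bar R}.
Hypothesis m_haar : haar_measure m.

Let W := haar_weight m.
Let W0 x : 0 < W x.
Proof. exact: haar_weight_gt0. Qed.

Let We x : (0 <= (haar_weight m x)%:E)%E.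
Proof. by rewrite lee_fin ltW. Qed.

Let WVe x : (0 <= ((haar_weight m x)^-1)%:E)%E.
Proof. by rewrite lee_fin invr_ge0 ltW. Qed.

Definition total_weight (F : {fset V}) : R := \sum_(x <- F) haar_weight m x.
Local Notation WF := total_weight.

Lemma total_weight_ge0 F : 0 <= WF F.
Proof. by apply: sumr_ge0 => x _; exact/ltW. Qed.

Lemma total_weight_gt0 (F : {fset V}) x : x \in F -> 0 < WF F.
Proof.
move=> xF; rewrite /total_weight (big_fsetD1 x) //=.
by apply: ltr_pwDl; [exact: W0|apply: sumr_ge0 => y _; exact/ltW].
Qed.

Lemma sum_imfset (g : V -> V) (F : {fset V}) (b : V -> R) : injective g ->
  \sum_(x <- (g @` F)%fset) b x = \sum_(x <- F) b (g x).
Proof. by move=> gi; rewrite big_imfset //= => x y _ _; exact: gi. Qed.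

Lemma aut_inj (g : aut G) : injective g.
Proof. exact: can_inj (aut_funK g). Qed.

Lemma total_weight_ratio (g : aut G) x F : g \in Gam ->
  W (g x) / WF (g @` F)%fset = W x / WF F.
Proof.
move=> gG; have e : W (g x) * WF F = W x * WF (g @` F)%fset.
  rewrite /total_weight sum_imfset; last exact: aut_inj.
  rewrite !mulr_sumr; apply: eq_bigr => y _.
  exact: (haar_weight_ratio Gconn Glf Gam_closed m_haar (exist _ g gG)).
have [F0|[y yF]] := fset_0Vmem F; last first.
  have gyF : g y \in (g @` F)%fset by apply/imfsetP; exists y.
  have n1 := lt0r_neq0 (total_weight_gt0 yF); have n2 := lt0r_neq0 (total_weight_gt0 gyF).
  by apply/eqP; rewrite eqr_div // e.
by rewrite F0 imfset0 /total_weight big_seq_fset0 invr0 !mulr0.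
Qed.

Lemma esum_fset_ind (F : {fset V}) (b : V -> R) : (forall z, 0 <= b z) ->
  (\esum_(z in [set: V]) (ind (z \in F) * (b z)%:E) =
   (\sum_(z <- F) b z)%:E)%E.
Proof.
move=> b0; transitivity (\esum_(z in [set` F]) (b z)%:E)%E.
  rewrite [RHS]esum_mkcond; apply: eq_esum => z _.
  rewrite /ind; case: ifPn => [/asboolP zF|/asboolPn zF].
    by rewrite mul1e ifT // inE.
  by rewrite mul0e ifF //; apply/negbTE; rewrite notin_setE.
rewrite esum_fset //; last by move=> z _; rewrite lee_fin.
by rewrite fsbig_finite //= set_fsetK sumEFin.
Qed.

Lemma imfset_bij (g : aut G) : set_bij [set: {fset V}] [set: {fset V}]
  (fun F : {fset V} => (g @` F)%fset).
Proof.
have can (h k : V -> V) (F : {fset V}) : cancel h k -> (k @` (h @` F))%fset = F.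
  move=> hK; apply/fsetP => x; apply/imfsetP/idP => /=.
    by move=> [_ /imfsetP[y /= yF ->] ->]; rewrite hK.
  by move=> xF; exists (h x); rewrite ?hK // in_imfset.
split => //.
- move=> F F' _ _ FF'; rewrite -(can _ _ F (aut_funK g)) FF'.
  exact: can (aut_funK g).
- move=> F _; exists (aut_inv g @` F)%fset => //; exact: can (aut_invK g).
Qed.

(** [M F y] is the mass attached to the pair of a block [F] and a boundary point
    [y]. *)
Section Deterministic.
Variable M : {fset V} -> V -> \bar R.
Hypothesis M0 : forall F y, (0 <= M F y)%E.
Hypothesis Minv : forall g : aut G, g \in Gam -> forall F y,
  M (g @` F)%fset (g y) = M F y.

(** Each point of a block receives the share of its mass that corresponds to
    its weight, which makes [f] an invariant function of two vertices. *)
Let f (x z : V) : \bar R := (\esum_(F in [set: {fset V}])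
  (ind (x \in F) * (M F z * (W x / WF F)%:E)))%E.

Let ratio0 x F : (0 <= (W x / WF F)%:E)%E.
Proof.
by rewrite lee_fin; apply: divr_ge0; [exact/ltW/W0|exact: total_weight_ge0].
Qed.

Let f0 x z : (0 <= f x z)%E.
Proof. by apply: esum_ge0 => F _; rewrite ind_mul_ge0 // mule_ge0. Qed.

Let finv (g : aut G) u v : g \in Gam -> f (g u) (g v) = f u v.
Proof.
move=> gG; rewrite /f (reindex_esum [set: {fset V}] _ _ _ (imfset_bij g)).
apply: eq_esum => F _; rewrite Minv // total_weight_ratio //; congr (_ * _)%E.
apply: ind_iff; split => [/imfsetP[x /= xF /aut_inj -> //]|uF].
by apply/imfsetP; exists u.
Qed.

(** Apply [mass_transport] to [f], for every pair of orbits. On the right-hand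
    side the shares of the points of [F] add up to [1]. *)
Lemma set_transport r : transversal Gam r ->
  (\sum_(x <- r) \esum_(F in [set: {fset V}]) \esum_(y in [set: V])
      (ind (x \in F) * (M F y * (W y / WF F)%:E)) =
   \sum_(y <- r) \esum_(F in [set: {fset V}]) (ind (F != fset0) * M F y))%E.
Proof.
move=> rT.
transitivity (\sum_(x <- r) \sum_(j <- r)
    \esum_(z in [set: V]) (ind (vertex_orbit Gam x z) * f z j))%E.
  apply: eq_bigr => x _.
  rewrite esum_swap; last first.
    by move=> F y; rewrite ind_mul_ge0 // mule_ge0.
  have Wx : (W x != 0) by rewrite gt_eqF.
  transitivity (\esum_(y in [set: V]) ((W x)^-1%:E * (f x y * (W y)%:E)))%E.
    apply: eq_esum => y _; rewrite muleCA [RHS]muleC -EFinM -esumZl; last 2 first.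
    - by rewrite mulr_ge0 ?invr_ge0 // ltW.
    - by move=> F; rewrite ind_mul_ge0 // mule_ge0.
    apply: eq_esum => F _; rewrite [RHS]muleCA; congr (_ * _)%E.
    rewrite [RHS]muleCA -EFinM; congr (_ * _%:E)%E.
    by rewrite [RHS]mulrACA mulVf // mul1r.
  rewrite (esum_transversal rT); last first.
    by move=> y; apply: mule_ge0 => //; exact: mule_ge0.
  apply: eq_bigr => j _.
  under eq_esum do rewrite muleCA.
  rewrite esumZl ?invr_ge0 ?ltW //; last first.
    by move=> y; apply: ind_mul_ge0; exact: mule_ge0.
  rewrite -(mass_transport Gconn Glf Gam_closed m_haar x j f0) //.
  rewrite -esumZl ?invr_ge0 ?ltW //; last first.
    by move=> y; apply: ind_mul_ge0; exact: mule_ge0.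
  apply: eq_esum => z _; rewrite muleCA; congr (_ * _)%E.
  by rewrite muleCA -EFinM mulVf // mule1.
rewrite exchange_big /=; apply: eq_bigr => j _.
rewrite -(esum_transversal rT); last by [].
rewrite esum_swap; last by move=> z F; rewrite ind_mul_ge0 // mule_ge0.
apply: eq_esum => F _.
under eq_esum do rewrite muleCA.
rewrite esumeZl //; last by move=> z; rewrite ind_mul_ge0.
rewrite esum_fset_ind; last by move=> z; rewrite -lee_fin.
rewrite muleC; congr (_ * _)%E.
rewrite -mulr_suml -/(WF F).
have [->|[y yF]] := fset_0Vmem F.
  by rewrite indF ?eqxx // /total_weight big_seq_fset0 mul0r.
rewrite divff ?gt_eqF ?(total_weight_gt0 yF) // indT //.
by apply/eqP => F0; rewrite F0 in yF.
Qed.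

End Deterministic.

Section Random.
Context d (T : measurableType d) (mu : {measure set T -> \bar R}).
Variable act : aut G -> T -> T.
Hypothesis act_meas : forall g, g \in Gam -> measurable_fun [set: T] (act g).
Hypothesis act_inv : law_invariant Gam act mu.

Lemma integral_inv (g : aut G) (h : T -> \bar R) : g \in Gam ->
  (forall t, 0 <= h t)%E -> measurable_fun [set: T] h ->
  (\int[mu]_t h (act g t) = \int[mu]_t h t)%E.
Proof.
move=> gG h0 mh.
have := ge0_integral_pushforward (act_meas gG) mu measurableT mh (fun t _ => h0 t).
rewrite preimage_setT => <-.
apply: eq_measure_integral; first exact: act_meas.
by move=> mg A mA _; exact: act_inv.
Qed.

Variable a : {fset V} -> T -> \bar R.
Variable b : {fset V} -> V -> T -> Prop.
Hypothesis a0 : forall F t, (0 <= a F t)%E.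
Hypothesis a_meas : forall F, measurable_fun [set: T] (a F).
Hypothesis b_meas : forall F y, measurable [set t | b F y t].
Hypothesis a_inv : forall g, g \in Gam -> forall F,
  \forall t \ae mu, a (g @` F)%fset (act g t) = a F t.
Hypothesis b_inv : forall g, g \in Gam -> forall F y t,
  b (g @` F)%fset (g y) (act g t) <-> b F y t.

Definition random_weight F t : \bar R :=
  (\esum_(y in [set: V]) (ind (b F y t) * (haar_weight m y)%:E))%E.

Let Vcount : countable [set: V].
Proof.
have [[x]|nV] := pselect (inhabited V); first exact: countable_vertices Gconn Glf x.
by rewrite (_ : [set: V] = set0) //; apply/seteqP; split => // x _; exfalso; apply: nV.
Qed.

Let bW_ge0 F y t : (0 <= ind (b F y t) * (haar_weight m y)%:E)%E.
Proof. by rewrite ind_mul_ge0 // lee_fin ltW. Qed.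

Let bW_meas F y : measurable_fun [set: T] (fun t => ind (b F y t) * (haar_weight m y)%:E)%E.
Proof. by apply: emeasurable_funM => //; exact: measurable_ind. Qed.

Lemma random_weight_ge0 F t : (0 <= random_weight F t)%E.
Proof. by apply: esum_ge0 => y _. Qed.

Lemma measurable_random_weight F : measurable_fun [set: T] (random_weight F).
Proof. exact: measurable_esum. Qed.

Let M F y := (\int[mu]_t (a F t * ind (b F y t)))%E.

Let M0 F y : (0 <= M F y)%E.
Proof. by apply: integral_ge0 => t _; rewrite mule_ge0 // ind_ge0. Qed.

Let aM_meas F y : measurable_fun [set: T] (fun t => a F t * ind (b F y t))%E.
Proof. by apply: emeasurable_funM => //; exact: measurable_ind. Qed.

Let Minv (g : aut G) : g \in Gam -> forall F y, M (g @` F)%fset (g y) = M F y.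
Proof.
move=> gG F y; rewrite /M.
rewrite -(integral_inv (g := g)) //; last first.
  by move=> t; rewrite mule_ge0 // ind_ge0.
apply: ge0_ae_eq_integral => //.
- exact: (measurableT_comp (aM_meas _ _) (act_meas gG)).
- by move=> t _; rewrite mule_ge0 // ind_ge0.
- by move=> t _; rewrite mule_ge0 // ind_ge0.
- have := a_inv gG F; apply: filterS => t at_ _; rewrite at_.
  by congr (_ * _)%E; apply: ind_iff; exact: b_inv.
Qed.

(** The intensity [a] need only be equivariant almost surely: it will be made
    from Radon-Nikodym derivatives. *)
Lemma block_transport r : transversal Gam r ->
  (\sum_(x <- r) \esum_(F in [set: {fset V}])
     (ind (x \in F) * \int[mu]_t (a F t * (random_weight F t * (total_weight F)^-1%:E))) =
   \sum_(y <- r) \esum_(F in [set: {fset V}])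
     (ind (F != fset0) * \int[mu]_t (a F t * ind (b F y t))))%E.
Proof.
move=> rT; rewrite -(set_transport M0 Minv rT).
apply: eq_bigr => x _; apply: eq_esum => F _.
have WFV : 0 <= (total_weight F)^-1 by rewrite invr_ge0 total_weight_ge0.
rewrite esumeZl ?ind_ge0 //; last first.
  by move=> y; rewrite mule_ge0 // lee_fin mulr_ge0 // ltW.
congr (_ * _)%E.
transitivity (\int[mu]_t (\esum_(y in [set: V])
    (a F t * ind (b F y t) * (W y / total_weight F)%:E)))%E.
  apply: eq_integral => t _.
  rewrite muleA muleC /random_weight -!esumeZl //.
  + by apply: eq_esum => y _; rewrite muleC EFinM !muleA.
  + by move=> y; exact: mule_ge0.
rewrite integral_esum //.
- apply: eq_esum => y _.
  rewrite ge0_integralZr //.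
  + by move=> t _; rewrite mule_ge0 // ind_ge0.
  + by rewrite lee_fin mulr_ge0 // ltW.
- by move=> y t; rewrite mule_ge0 // ?mule_ge0 ?ind_ge0 // lee_fin mulr_ge0 // ltW.
- by move=> y; apply: emeasurable_funM.
Qed.

End Random.
End SetTransport.

(** * Blocks of a configuration and their boundaries *)
Section Blocks.
Context {V : choiceType}.
Implicit Types (w : config V) (A : vset V) (F : {fset V}).

Lemma config_adj_sym w : symmetric (config_adj w).
Proof. by move=> x y; rewrite /config_adj orbC. Qed.

(** Connectedness of a finite set is expressed by cuts and not by paths, so
    that it is visibly a measurable condition, that components are unique by
    comparing a set with its intersection with another one, and that a
    disconnected set splits without further work. *)
Definition cut_connected w F := forall F' : {fset V}, (F' `<=` F)%fset ->
  F' != fset0 -> F' != F ->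
  exists2 x, x \in F' & exists2 y, y \in F & y \notin F' /\ config_adj w x y.

(** The finite components of the subgraph induced on [A]. *)
Definition is_block w A F := [/\ F != fset0, forall x, x \in F -> A x,
  cut_connected w F &
  forall x y, x \in F -> A y -> config_adj w x y -> y \in F].

(** If [F] were not contained in [F'], an edge would leave the intersection of
    the two sets within [F], against the closedness of [F']. *)
Lemma block_sub w A F F' x : is_block w A F -> is_block w A F' ->
  x \in F -> x \in F' -> (F `<=` F')%fset.
Proof.
move=> [_ FA Fc _] [_ _ _ F'c] xF xF'.
have [e|ne] := eqVneq (F `&` F')%fset F; first by rewrite -e fsubsetIr.
have [|u] := Fc _ (fsubsetIl F F') _ ne.
  by apply/fset0Pn; exists x; rewrite inE xF.
rewrite inE => /andP[uF uF'] [v vF [+ uv]]; rewrite inE vF /= => /negP vF'.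
by exfalso; apply: vF'; apply: F'c uF' _ uv; exact: FA.
Qed.

Lemma block_eq w A F F' x : is_block w A F -> is_block w A F' ->
  x \in F -> x \in F' -> F = F'.
Proof.
move=> bF bF' xF xF'; apply/eqP; rewrite eqEfsubset.
by rewrite (block_sub bF bF' xF xF') (block_sub bF' bF xF' xF).
Qed.

Lemma component_sub (e : rel V) (S : set V) x :
  (forall u v, S u -> e u v -> S v) -> S x -> component e x `<=` S.
Proof.
move=> Scl Sx y [p pp <-]; elim: p x Sx pp => //= z p IH x Sx /andP[xz pp].
by apply: IH pp; exact: Scl xz.
Qed.

Lemma component_closed (e : rel V) x u v :
  component e x u -> e u v -> component e x v.
Proof.
move=> [p pp <-] uv; exists (rcons p v); last by rewrite last_rcons.
by rewrite rcons_path pp.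
Qed.

Lemma block_exists w x : finite_set (component (config_adj w) x) ->
  exists2 F, is_block w (fun=> true) F & x \in F.
Proof.
move=> fin; exists (fset_set (component (config_adj w) x)); last first.
  by rewrite in_fset_set // inE; exists [::].
have inC y : (y \in fset_set (component (config_adj w) x)) <-> component (config_adj w) x y.
  by rewrite in_fset_set // inE.
split => //.
- by apply/fset0Pn; exists x; apply/inC; exists [::].
- move=> F' sF' /fset0Pn[u uF'] neF'; apply: contrapT => nocut.
  have cl a b : a \in F' -> config_adj w a b -> b \in F'.
    move=> aF' ab; apply/negPn/negP => bF'; apply: nocut.
    exists a => //; exists b => //; apply/inC.
    by apply: component_closed ab; apply/inC; exact: (fsubsetP sF').
  have [xF'|xF'] := boolP (x \in F').
    move/eqP: neF'; apply; apply/eqP; rewrite eqEfsubset sF' /=.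
    by apply/fsubsetP => y /inC /(component_sub (S := [set` F']) cl); apply.
  have : ~ u \in F'.
    have := @component_sub (config_adj w) [set y | y \notin F'] x.
    move=> /(_ _ xF') h; apply/negP; apply: h; last by apply/inC; exact: (fsubsetP sF').
    move=> a b /= aF' ab; apply/negP => bF'; move/negP: aF'; apply.
    by apply: cl bF' _; rewrite config_adj_sym.
  by apply.
- by move=> a b /inC xa _ ab; apply/inC; exact: component_closed ab.
Qed.

Definition boundary w A F : set V :=
  outer_vertex_boundary (induced_subgraph w A) [set` F].

Lemma boundaryP w A F y : (forall x, x \in F -> A x) ->
  boundary w A F y <-> [/\ A y, y \notin F & exists2 x, x \in F & config_adj w x y].
Proof.
move=> FA; split=> [[Ay yF [x xF /and3P[_ _ xy]]]|[Ay yF [x xF xy]]].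
  by split => //; [apply/negP|exists x].
split => //; first exact/negP.
by exists x => //; apply/and3P; split => //; exact: FA.
Qed.

End Blocks.

Section Invariance.
Context {V : choiceType} {G : sgraph V}.
Implicit Types (w : config V) (A : vset V) (F : {fset V}) (g : aut G).

Lemma aut_VK g x : (g^-1)%g (g x) = x.
Proof. exact: aut_funK. Qed.

Lemma aut_KV g x : g ((g^-1)%g x) = x.
Proof. exact: aut_invK. Qed.

Lemma act_vsetE g A x : act_vset g A (g x) = A x.
Proof. by rewrite /act_vset aut_VK. Qed.

Lemma act_configE g w x y : act_config g w (g x, g y) = w (x, y).
Proof. by rewrite /act_config /= !aut_funK. Qed.

Lemma act_adjE g w x y : config_adj (act_config g w) (g x) (g y) = config_adj w x y.
Proof. by rewrite /config_adj !act_configE. Qed.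

Lemma act_vsetK g A : act_vset g^-1%g (act_vset g A) = A.
Proof. by apply/funext => x; rewrite /act_vset /= aut_funK. Qed.

Lemma act_configK g w : act_config g^-1%g (act_config g w) = w.
Proof. by apply/funext => -[x y]; rewrite /act_config /= !aut_funK. Qed.

Lemma imfset_autK g F : (g^-1%g @` (g @` F))%fset = F.
Proof.
apply/fsetP => x; apply/imfsetP/idP => /=.
  by move=> [_ /imfsetP[y /= yF ->] ->]; rewrite aut_funK.
by move=> xF; exists (g x); rewrite ?aut_funK // in_imfset.
Qed.

Lemma mem_imfset_aut g F x : (g x \in (g @` F)%fset) = (x \in F).
Proof. by rewrite mem_imfset //; exact: aut_inj. Qed.

Lemma imfset_autP g F y : y \in (g @` F)%fset -> exists2 x, x \in F & y = g x.
Proof. by move=> /imfsetP[x /= xF ->]; exists x. Qed.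

Lemma imfset_aut0 g F : (g @` F)%fset != fset0 <-> F != fset0.
Proof.
split=> /fset0Pn[x xF]; apply/fset0Pn.
  by have [y yF _] := imfset_autP xF; exists y.
by exists (g x); rewrite mem_imfset_aut.
Qed.

(** It suffices to prove one direction for all [g], and to use it for the
    inverse. *)
Lemma is_block_act g w A F :
  is_block (act_config g w) (act_vset g A) (g @` F)%fset <-> is_block w A F.
Proof.
have dir (h : aut G) w' A' F' : is_block w' A' F' ->
    is_block (act_config h w') (act_vset h A') (h @` F')%fset.
  move=> [F0 FA Fc Fcl]; split.
  - exact: (imfset_aut0 h F').2 F0.
  - by move=> _ /imfset_autP[x xF ->]; rewrite act_vsetE; exact: FA.
  - move=> K KF K0 neK.
    pose K' := (h^-1%g @` K)%fset.
    have KE : K = (h @` K')%fset by rewrite -[LHS](imfset_autK h^-1%g) invgK.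
    have s1 : (K' `<=` F')%fset.
      apply/fsubsetP => x xK'.
      by rewrite -(mem_imfset_aut h); apply: (fsubsetP KF); rewrite KE mem_imfset_aut.
    have s2 : K' != fset0 by exact: (imfset_aut0 h^-1%g K).2 K0.
    have s3 : K' != F' by apply: contra_neq neK => <-.
    have [x xK' [y yF [yK xy]]] := Fc K' s1 s2 s3.
    exists (h x); first by rewrite KE mem_imfset_aut.
    exists (h y); first by rewrite mem_imfset_aut.
    by rewrite act_adjE; split => //; rewrite KE mem_imfset_aut.
  - move=> _ y /imfset_autP[x xF ->]; rewrite -(aut_KV h y) act_vsetE act_adjE.
    by rewrite mem_imfset_aut; exact: Fcl.
split=> [/(dir g^-1%g)|]; last exact: dir.
by rewrite act_configK act_vsetK imfset_autK.
Qed.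

Lemma boundary_act g w A F y :
  boundary (act_config g w) (act_vset g A) (g @` F)%fset (g y) <-> boundary w A F y.
Proof.
rewrite /boundary /outer_vertex_boundary /=; split=> -[Ay yF [x xF xy]].
  move: xF => /imfset_autP[x' xF xE]; split.
  - by move: Ay; rewrite act_vsetE.
  - by move=> yF'; apply: yF; rewrite mem_imfset_aut.
  - by exists x' => //; move: xy; rewrite xE !act_vsetE act_adjE.
split.
- by rewrite act_vsetE.
- by rewrite mem_imfset_aut.
- by exists (g x); rewrite ?mem_imfset_aut // !act_vsetE act_adjE.
Qed.

End Invariance.

Section BlockMeasurable.
Context {V : choiceType} d (T : measurableType d).
Hypothesis Vcount : countable [set: V].
Variables (w : T -> config V) (A : T -> vset V).
Hypothesis mw : measurable_fun [set: T] w.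
Hypothesis mA : measurable_fun [set: T] A.

Lemma measurable_adj x y : measurable [set t | config_adj (w t) x y].
Proof.
have -> : [set t | config_adj (w t) x y] = [set t | w t (x, y) \/ w t (y, x)].
  by apply/seteqP; split => t /= /orP.
by apply: measurable_or; exact: measurable_atom.
Qed.

Lemma measurable_cut_connected F : measurable [set t | cut_connected (w t) F].
Proof.
apply: measurable_forall => [|K]; first exact: countable_fset.
do 3!(apply: measurable_imp; first exact: measurable_const).
apply: measurable_exists_in => // x; apply: measurable_exists_in => // y.
by apply: measurable_and; [exact: measurable_const|exact: measurable_adj].
Qed.

Lemma measurable_is_block F : measurable [set t | is_block (w t) (A t) F].
Proof.
have -> : [set t | is_block (w t) (A t) F] = [set t | F != fset0 /\
    ((forall x, x \in F -> A t x) /\ (cut_connected (w t) F /\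
    (forall x, forall y, x \in F -> A t y -> config_adj (w t) x y -> y \in F)))].
  by apply/seteqP; split => t /=; [move=> [? ? ? ?]|move=> [? [? [? ?]]]].
apply: measurable_and; first exact: measurable_const.
apply: measurable_and.
  apply: measurable_forall => // x; apply: measurable_imp; first exact: measurable_const.
  exact: measurable_atom.
apply: measurable_and; first exact: measurable_cut_connected.
apply: measurable_forall => // x; apply: measurable_forall => // y.
apply: measurable_imp; first exact: measurable_const.
apply: measurable_imp; first exact: measurable_atom.
apply: measurable_imp; first exact: measurable_adj.
exact: measurable_const.
Qed.

Lemma measurable_boundary F y : measurable [set t | boundary (w t) (A t) F y].
Proof.
have -> : [set t | boundary (w t) (A t) F y] = [set t | A t y /\ (y \notin F /\
    exists2 x, x \in F & (A t x /\ (A t y /\ config_adj (w t) x y)))].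
  apply/seteqP; split => t /=.
    move=> [Ay yF [x xF /and3P[Ax _ xy]]]; split => //; split; first exact/negP.
    by exists x.
  move=> [Ay [yF [x xF [Ax [_ xy]]]]]; split => //; first exact/negP.
  by exists x => //; apply/and3P.
apply: measurable_and; first exact: measurable_atom.
apply: measurable_and; first exact: measurable_const.
apply: measurable_exists_in => // x.
apply: measurable_and; first exact: measurable_atom.
by apply: measurable_and; [exact: measurable_atom|exact: measurable_adj].
Qed.

End BlockMeasurable.

Section Weights.
Context (R : realType) (V : choiceType) (G : sgraph V).
Hypothesis Gconn : connected_graph G.
Hypothesis Glf : locally_finite_graph G.
Variable Gam : groupClosed (aut G).
Hypothesis Gam_closed : closed_subgroup Gam.
Variable m : {measure set (borel_subgrp Gam) -> \bar R}.
Hypothesis m_haar : haar_measure m.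
Implicit Types (w : config V) (A : vset V) (F : {fset V}).

Let W := haar_weight m.
Let W0 x : 0 < W x.
Proof. exact: (haar_weight_gt0 Gconn Glf Gam_closed m_haar). Qed.
Let We x : (0 <= (haar_weight m x)%:E)%E.
Proof. by rewrite lee_fin ltW. Qed.
Local Notation WF := (total_weight m).
Let WF0 F : 0 <= WF F.
Proof. exact: (total_weight_ge0 Gconn Glf Gam_closed m_haar). Qed.
Let WFp F x : x \in F -> 0 < WF F.
Proof. exact: (total_weight_gt0 Gconn Glf Gam_closed m_haar). Qed.

Definition boundary_weight w A F : \bar R :=
  (\esum_(y in [set: V]) (ind (boundary w A F y) * (haar_weight m y)%:E))%E.

Lemma boundary_weight_ge0 w A F : (0 <= boundary_weight w A F)%E.
Proof. by apply: esum_ge0 => y _; exact: ind_mul_ge0. Qed.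

Lemma haar_weight_scale (o : V) (g : aut G) : g \in Gam ->
  exists2 rho : R, 0 < rho & forall y, W (g y) = rho * W y.
Proof.
move=> gG; exists (W (g o) / W o); first exact: divr_gt0.
move=> y; have := haar_weight_ratio Gconn Glf Gam_closed m_haar (exist _ g gG) y o.
rewrite /subgrp_app /= => e.
have Wo : W o != 0 by rewrite gt_eqF.
by apply: (mulIf Wo); rewrite e mulrAC divfK // mulrC.
Qed.

(** Both sides of either inequality are multiplied by the same factor, the one
    by which [g] scales all weights. *)
Lemma boundary_weight_act (o : V) (g : aut G) w A F (c : R) : g \in Gam ->
  (boundary_weight (act_config g w) (act_vset g A) (g @` F)%fset <=
     (c * WF (g @` F)%fset)%:E)%E =
  (boundary_weight w A F <= (c * WF F)%:E)%E /\
  ((c * WF (g @` F)%fset)%:E <=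
     boundary_weight (act_config g w) (act_vset g A) (g @` F)%fset)%E =
  ((c * WF F)%:E <= boundary_weight w A F)%E.
Proof.
move=> gG; have [rho rho0 rhoE] := haar_weight_scale o gG.
have -> : WF (g @` F)%fset = rho * WF F.
  rewrite /total_weight sum_imfset; last exact: aut_inj.
  by rewrite mulr_sumr; apply: eq_bigr => y _; exact: rhoE.
have -> : boundary_weight (act_config g w) (act_vset g A) (g @` F)%fset =
    (rho%:E * boundary_weight w A F)%E.
  rewrite /boundary_weight (reindex_esum [set: V] _ g); last first.
    split => //; first by move=> x y _ _; exact: aut_inj.
    by move=> y _; exists (g^-1%g y) => //; exact: aut_KV.
  rewrite -esumZl ?ltW //; last by move=> y; exact: ind_mul_ge0.
  apply: eq_esum => y _; rewrite muleCA -EFinM -rhoE; congr (_ * _)%E.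
  exact/ind_iff/boundary_act.
by rewrite mulrCA EFinM; split; rewrite lee_pmul2l.
Qed.

Lemma set_weightE o (S : set V) : set_weight (weight m o) S =
  ((W o)^-1%:E * \esum_(y in [set: V]) (ind (S y) * (W y)%:E))%E.
Proof.
rewrite -esumZl ?invr_ge0 ?ltW //; last by move=> y; exact: ind_mul_ge0.
rewrite /set_weight esum_mkcond; apply: eq_esum => y _.
rewrite /weight -!(haar_weightE Gconn Glf Gam_closed m_haar).
have [Sy|Sy] := pselect (S y).
  rewrite mem_set // indT // mul1e muleC inver gt_eqF //.
by rewrite memNset // indF // mul0e mule0.
Qed.

(** The reference vertex cancels in the boundary ratios. *)
Lemma cheeger_neq0 (o : V) w A :
  cheeger (weight m o) (induced_subgraph w A) <> 0%E <->
  exists2 c : R, 0 < c & forall F, F != fset0 -> (forall x, x \in F -> A x) ->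
    ((c * WF F)%:E <= boundary_weight w A F)%E.
Proof.
have ratio F x : x \in F ->
    (set_weight (weight m o) (boundary w A F) / set_weight (weight m o) [set` F] =
     boundary_weight w A F * (WF F)^-1%:E)%E.
  move=> xF; rewrite !set_weightE -/(boundary_weight w A F).
  rewrite esum_fset_ind; last by move=> y; exact/ltW.
  rewrite -/(WF F) -EFinM inver gt_eqF; last first.
    by rewrite mulr_gt0 ?invr_gt0 // (WFp xF).
  rewrite invfM invrK muleAC -EFinM mulrA mulVf ?gt_eqF // mul1r.
  by rewrite muleC.
have nn (F : set V) : finite_set F -> F !=set0 -> (0 <= set_weight (weight m o)
    (outer_vertex_boundary (induced_subgraph w A) F) / set_weight (weight m o) F)%E.
  move=> fF [x Fx]; rewrite -(fset_setK fF) (ratio _ x).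
    by rewrite mule_ge0 ?boundary_weight_ge0 // lee_fin invr_ge0.
  by rewrite in_fset_set // inE.
split.
- move=> ch0.
  have chp : (0 < cheeger (weight m o) (induced_subgraph w A))%E.
    rewrite lt_neqAle; apply/andP; split; first by rewrite eq_sym; apply/eqP.
    by apply: le_ereal_inf_tmp => _ [F [fF F0 _] <-]; exact: nn.
  have [c c0 cch] : exists2 c : R, 0 < c &
      (c%:E <= cheeger (weight m o) (induced_subgraph w A))%E.
    move: chp; case: (cheeger _ _) => [c|_|//]; first by exists c.
    by exists 1 => //; rewrite leey.
  exists c => // F /fset0Pn[x xF] FA.
  have := le_trans cch
    (@ereal_inf_lbound _ _ _ (_ : _ (boundary_weight w A F * (WF F)^-1%:E)%E)).
  rewrite lee_pdivlMr ?(WFp xF) // -EFinM; apply.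
  by exists [set` F]; [split => //; exists x|exact: (ratio F x)].
- move=> [c c0 cF] ch0.
  have : (c%:E <= cheeger (weight m o) (induced_subgraph w A))%E.
    apply: le_ereal_inf_tmp => _ [F [fF [x Fx] FA] <-].
    have xF : x \in fset_set F by rewrite in_fset_set // inE.
    rewrite -(fset_setK fF) (ratio _ x xF) lee_pdivlMr ?(WFp xF) // -EFinM.
    apply: cF; first by apply/fset0Pn; exists x.
    by move=> y; rewrite in_fset_set // inE => /FA.
  by rewrite ch0 lee_fin leNgt c0.
Qed.

End Weights.

Section Degree.
Context (R : realType) (V : choiceType).
Variables (w : config V) (D : nat).
Hypothesis deg : forall x, (neighbours (config_adj w) x #<= `I_D)%card.
Local Open Scope ereal_scope.

Lemma deg_esum y : \esum_(z in [set: V]) ind (R := R) (config_adj w z y) <= D%:R%:E.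
Proof.
have fin : finite_set (neighbours (config_adj w) y).
  exact: card_le_finite (deg y) (finite_II D).
set N := fset_set (neighbours (config_adj w) y).
have -> : \esum_(z in [set: V]) ind (R := R) (config_adj w z y) =
    \esum_(z in [set: V]) (ind (z \in N) * 1%R%:E).
  apply: eq_esum => z _; rewrite mule1; apply: ind_iff.
  by rewrite in_fset_set // inE config_adj_sym.
rewrite esum_fset_ind // big_const_seq count_predT iter_addr_0 lee_fin ler_nat.
exact: geq_card_fset_set.
Qed.

Lemma sum_le_esum (F : {fset V}) (a : V -> \bar R) : (forall z, 0 <= a z) ->
  \sum_(z <- F) a z <= \esum_(z in [set: V]) a z.
Proof.
move=> a0; apply: esum_ge; exists [set` F]; first by split.
by rewrite fsbig_finite //= set_fsetK.
Qed.

Lemma deg_sum y (F : {fset V}) :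
  \sum_(z <- F) ind (R := R) (config_adj w z y) <= D%:R%:E.
Proof.
by apply: le_trans (deg_esum y); apply: sum_le_esum => z; exact: ind_ge0.
Qed.

End Degree.

Section Reduction.
Context (R : realType) (V : choiceType) (G : sgraph V).
Hypothesis Gconn : connected_graph G.
Hypothesis Glf : locally_finite_graph G.
Variable Gam : groupClosed (aut G).
Hypothesis Gam_closed : closed_subgroup Gam.
Variable m : {measure set (borel_subgrp Gam) -> \bar R}.
Hypothesis m_haar : haar_measure m.
Local Open Scope ereal_scope.

Let We x : 0 <= (haar_weight m x)%:E.
Proof. by rewrite lee_fin ltW // (haar_weight_gt0 Gconn Glf Gam_closed m_haar). Qed.

Variables (w : config V) (A : vset V) (D : nat).
Hypothesis deg : forall x, (neighbours (config_adj w) x #<= `I_D)%card.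

(** Summed over [z] in [F], this is the weight of the boundary of [F], counted
    with the multiplicity of the boundary edges. *)
Let e (F : {fset V}) (z : V) : \bar R := \esum_(y in [set: V])
  (ind [/\ A y, y \notin F & config_adj w z y] * (haar_weight m y)%:E).

Let boundary_weight_le_e (F : {fset V}) : (forall x, x \in F -> A x) ->
  boundary_weight m w A F <= \sum_(z <- F) e F z.
Proof.
move=> FA; rewrite /e -esum_sum; last by move=> y z _ _; exact: ind_mul_ge0.
apply: le_esum => y _; have [|nb] := pselect (boundary w A F y); last first.
  by rewrite indF // mul0e; apply: sume_ge0 => z _; exact: ind_mul_ge0.
move=> /(boundaryP _ _ FA)[Ay yF [x xF xy]].
rewrite (big_fsetD1 x) //= (indT (P := [/\ A y, _ & _])) //.
apply: le_trans (_ : 1 * (haar_weight m y)%:E <= _).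
  by apply: lee_wpmul2r => //; exact: ind_le1.
by rewrite leeDl //; apply: sume_ge0 => z _; exact: ind_mul_ge0.
Qed.

Let e_le_boundary_weight (F : {fset V}) : (forall x, x \in F -> A x) ->
  \sum_(z <- F) e F z <= D%:R%:E * boundary_weight m w A F.
Proof.
move=> FA; rewrite /e -esum_sum; last by move=> y z _ _; exact: ind_mul_ge0.
rewrite /boundary_weight -esumZl //; last by move=> y; exact: ind_mul_ge0.
apply: le_esum => y _; have [b|nb] := pselect (boundary w A F y); last first.
  rewrite indF // mul0e mule0 big_seq big1 // => z zF.
  rewrite indF ?mul0e // => -[Ay yF zy]; apply: nb; apply/(boundaryP _ _ FA).
  by split => //; exists z.
rewrite indT // mul1e -ge0_sume_distrl; last by move=> z _; exact: ind_ge0.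
apply: lee_wpmul2r => //; apply: le_trans (deg_sum R deg y F).
by apply: lee_sum => z _; apply: ind_le => -[].
Qed.

(** An isoperimetric inequality for connected sets extends to all finite sets
    at the cost of the degree bound. Boundary points may be shared by several
    components, so the induction is carried out for the edge boundary
    [e], which is additive over components and is at most [D] times larger. *)
Lemma connected_reduction (eps : R) :
  (forall F : {fset V}, F != fset0 -> (forall x, x \in F -> A x) -> cut_connected w F ->
    (eps * total_weight m F)%:E <= boundary_weight m w A F) ->
  forall F : {fset V}, (forall x, x \in F -> A x) ->
    (eps * total_weight m F)%:E <= D%:R%:E * boundary_weight m w A F.
Proof.
move=> conn F FA; apply: le_trans (e_le_boundary_weight FA).
have [n] := ubnP #|` F|; elim: n F FA => // n IH F FA Fn.
have [->|F0] := eqVneq F fset0.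
  by rewrite /total_weight !big_seq_fset0 mulr0.
have [cF|ncF] := pselect (cut_connected w F).
  exact: le_trans (conn F F0 FA cF) (boundary_weight_le_e FA).
have [K [KF K0 KneF nocut]] : exists K : {fset V}, [/\ (K `<=` F)%fset, K != fset0,
    K != F & forall x y, x \in K -> y \in F -> y \notin K -> ~ config_adj w x y].
  apply: contrapT => nK; apply: ncF => K KF K0 KneF; apply: contrapT => nex.
  apply: nK; exists K; split => // x y xK yF yK xy; apply: nex.
  by exists x => //; exists y.
have KA x : x \in K -> A x by move=> /(fsubsetP KF); exact: FA.
have K'A x : x \in (F `\` K)%fset -> A x by rewrite inE => /andP[_]; exact: FA.
have KpF : (K `<` F)%fset by rewrite fproperEneq KneF.
have split_sum (T : nmodType) (b : V -> T) : (\sum_(z <- F) b z =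
    \sum_(z <- K) b z + \sum_(z <- (F `\` K)%fset) b z)%R.
  rewrite -big_cat; apply: perm_big; apply: uniq_perm.
  - exact: fset_uniq.
  - rewrite cat_uniq !fset_uniq andbT /=; apply/hasPn => z.
    by rewrite /= inE => /andP[].
  - move=> z; rewrite mem_cat inE.
    by case: (boolP (z \in K)) => //= zK; rewrite (fsubsetP KF _ zK).
rewrite /total_weight (split_sum _ (haar_weight m)) mulrDr EFinD (split_sum _ (e F)).
apply: leeD.
- apply: le_trans (IH K KA _) _.
    by apply: leq_trans (fproper_ltn_card KpF) _.
  rewrite big_seq [leRHS]big_seq; apply: lee_sum => z zK.
  apply: le_esum => y _; apply: lee_wpmul2r => //; apply: ind_le => -[Ay yK zy].
  by split => //; apply/negP => yF; exact: nocut zK yF yK zy.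
- apply: le_trans (IH _ K'A _) _.
    apply: leq_trans (_ : #|` F| <= n)%N => //.
    apply: fproper_ltn_card; rewrite fproperEneq fsubDset fsubsetUr andbT.
    apply: contra_neq K0 => e1; apply/eqP; rewrite -fsubset0; apply/fsubsetP => x xK.
    by have := fsubsetP KF x xK; rewrite -e1 inE xK.
  rewrite big_seq [leRHS]big_seq; apply: lee_sum => z; rewrite inE => /andP[zK zF].
  apply: le_esum => y _; apply: lee_wpmul2r => //; apply: ind_le => -[Ay yK zy].
  split => //; apply/negP => yF; move: yK; rewrite inE yF andbT negbK => yK.
  by apply: nocut yK zF zK _; rewrite config_adj_sym.
Qed.

End Reduction.

(** * Fair coins indexed by a countable type *)
Section Dyadic.
Context (R : realType).

Definition dyadic (n k : nat) : set R :=
  [set` `[(k%:R / 2 ^+ n : R), (k.+1%:R / 2 ^+ n : R)[ ].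

Lemma dyadicP n k t : dyadic n k t <-> k%:R <= t * 2 ^+ n < k.+1%:R.
Proof.
have p : 0 < 2 ^+ n :> R by rewrite exprn_gt0.
by rewrite /dyadic /= in_itv /= ler_pdivrMr // ltr_pdivlMr.
Qed.

Lemma measurable_dyadic n k : measurable (dyadic n k).
Proof. exact: measurable_itv. Qed.

Lemma dyadic_measure n k : lebesgue_measure (dyadic n k) = ((2 ^+ n)^-1)%:E.
Proof.
have p : 0 < 2 ^+ n :> R by rewrite exprn_gt0.
rewrite lebesgue_measure_itv /= lte_fin ltr_pM2r ?invr_gt0 // ltr_nat ltnSn.
by rewrite -EFinD -mulrBl -natrB // subSnn mul1r.
Qed.

Lemma dyadic_inj n k k' t : dyadic n k t -> dyadic n k' t -> k = k'.
Proof.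
move=> /dyadicP/andP[a b] /dyadicP/andP[c e].
apply/eqP; rewrite eqn_leq; apply/andP; split; rewrite -ltnS -(ltr_nat R).
  exact: le_lt_trans a e.
exact: le_lt_trans c b.
Qed.

Lemma dyadic_split n k :
  dyadic n k = dyadic n.+1 k.*2 `|` dyadic n.+1 k.*2.+1.
Proof.
apply/seteqP; split => t.
  move=> /dyadicP/andP[a b].
  have [lt|ge] := ltP (t * 2 ^+ n.+1) (k.*2.+1)%:R; [left|right]; apply/dyadicP.
    rewrite lt andbT exprS -muln2 natrM; lra.
  rewrite ge /= exprS -doubleS -muln2 natrM; lra.
move=> [] /dyadicP/andP[a b]; apply/dyadicP; move: a b;
  rewrite exprS -?doubleS -?muln2 ?natrM -?(natr1 R k.*2) -?muln2 ?natrM;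
  rewrite -?(natr1 R k.*2.+1) -?(natr1 R k) => a b; apply/andP; split; lra.
Qed.

(** Inside the unit interval, this is the [n]-th binary digit of [t]. *)
Definition binary_digit (n : nat) (t : R) : bool :=
  `[< exists2 k, odd k & dyadic n.+1 k t >].

Lemma binary_digitE n k t : dyadic n.+1 k t -> binary_digit n t = odd k.
Proof.
move=> tk; apply/asboolP/idP => [[k' ok' tk']|ok]; last by exists k.
by rewrite (dyadic_inj tk tk').
Qed.

Lemma measurable_binary_digit n : measurable [set t | binary_digit n t].
Proof.
have -> : [set t | binary_digit n t] = [set t | exists2 k, odd k & dyadic n.+1 k t].
  by apply/seteqP; split => t /= /asboolP.
apply: measurable_exists_in => [|k]; first exact: countableP.
exact: measurable_dyadic.
Qed.

Definition digit_pattern (S : {fset nat}) (b : nat -> bool) (n j : nat) : set R :=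
  [set t | forall i, (n <= i < n + j)%N -> i \in S -> binary_digit i t = b i].

Lemma measurable_digit_pattern S b n j : measurable (digit_pattern S b n j).
Proof.
apply: measurable_forall => [|i]; first exact: countableP.
apply: measurable_imp; first exact: measurable_const.
apply: measurable_imp; first exact: measurable_const.
case: (b i); first exact: measurable_binary_digit.
have -> : [set t | binary_digit i t = false] = [set t | ~ binary_digit i t].
  by apply/seteqP; split => t /= => [->|/negP/negbTE].
by apply: measurable_not; exact: measurable_binary_digit.
Qed.

Lemma digit_pattern_rec S b n j k t : dyadic n.+1 k t ->
  digit_pattern S b n j.+1 t <-> (n \in S -> odd k = b n) /\ digit_pattern S b n.+1 j t.
Proof.
move=> tk; split=> [h|[h1 h2] i /andP[ni ij] iS].
  split=> [nS|i /andP[ni ij] iS].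
    by rewrite -(binary_digitE tk); apply: h => //; rewrite leqnn /= addnS ltnS leq_addr.
  by apply: h => //; rewrite (ltnW ni) addnS -addSn.
have [e|ne] := eqVneq i n; first by rewrite e (binary_digitE tk); apply: h1; rewrite -e.
by apply: h2 => //; rewrite ltn_neqAle eq_sym ne ni addSn -addnS.
Qed.

(** Halving a dyadic interval fixes the next digit, so every prescribed digit
    halves the measure and a free one does not change it. *)
Lemma digit_pattern_measure S b n j k :
  lebesgue_measure (dyadic n k `&` digit_pattern S b n j) =
  ((2 ^+ n)^-1 * (2 ^+ count (mem S) (iota n j))^-1)%:E.
Proof.
elim: j n k => [|j IH] n k.
  rewrite /= expr0 invr1 mulr1 -(dyadic_measure n k); congr (_ _).
  apply/seteqP; split => t; first by case.
  by move=> tk; split => // i; rewrite addn0 => /andP[ni]; rewrite ltnNge ni.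
rewrite dyadic_split setIUl measureU; last 3 first.
- by apply: measurableI; [exact: measurable_dyadic|exact: measurable_digit_pattern].
- by apply: measurableI; [exact: measurable_dyadic|exact: measurable_digit_pattern].
- apply/seteqP; split => // t [[t1 _] [t2 _]].
  by have := dyadic_inj t1 t2 => /eqP; rewrite -[X in X == _]addn0 -addn1 eqn_add2l.
have half k' : lebesgue_measure (dyadic n.+1 k' `&` digit_pattern S b n j.+1) =
    if (n \in S) ==> (odd k' == b n) then
      ((2 ^+ n.+1)^-1 * (2 ^+ count (mem S) (iota n.+1 j))^-1)%:E else 0%E.
  rewrite -(IH n.+1 k'); case: implyP => [h|h].
    congr (_ _); apply/seteqP; split => t [tk].
      by move=> /(digit_pattern_rec _ _ _ tk)[].
    by move=> h2; split => //; apply/(digit_pattern_rec _ _ _ tk); split => // /h/eqP.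
  rewrite (_ : _ `&` _ = set0) ?measure0 //; apply/seteqP; split => // t [tk].
  by move=> /(digit_pattern_rec _ _ _ tk)[h' _]; apply: h => /h' ->.
transitivity (lebesgue_measure (dyadic n.+1 k.*2 `&` digit_pattern S b n j.+1) +
    lebesgue_measure (dyadic n.+1 k.*2.+1 `&` digit_pattern S b n j.+1))%E => //.
rewrite !half /= odd_double /= -[(false == b n)]/(false == b n).
have -> : (2 ^+ n.+1)^-1 = (2 ^+ n)^-1 / 2 :> R by rewrite exprSr invfM.
case: (n \in S) => /=; last first.
  by rewrite add0n -EFinD; congr (_%:E); lra.
by rewrite add1n exprSr invfM; case: (b n) => /=; rewrite ?add0e ?adde0; congr (_%:E); lra.
Qed.

End Dyadic.

Section UnitMeasure.
Context (R : realType).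

Definition unit_measure := mrestr lebesgue_measure (@measurable_dyadic R 0 0).

HB.instance Definition _ := Measure.on unit_measure.

Let unit_measure_setT : unit_measure setT = 1%E.
Proof. by rewrite /unit_measure /mrestr setTI dyadic_measure expr0 invr1. Qed.

HB.instance Definition _ :=
  Measure_isProbability.Build _ _ _ unit_measure unit_measure_setT.

End UnitMeasure.

Section Coins.
Context (R : realType) (I : choiceType).
Hypothesis Icount : countable [set: I].

Definition fair_coins (beta : probability (power I bool) R) :=
  forall (s : {fset I}) (b : I -> bool),
    beta [set f : power I bool | forall i, i \in s -> f i = b i]
    = ((2 ^+ #|` s|)^-1)%:E.

(** The binary digits of a uniform point of the unit interval are fair coins. *)
Lemma fair_coins_exist : exists beta, fair_coins beta.
Proof.
have /countable_injP[c cinj] := Icount.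
have ci : injective c by move=> x y cxy; apply: cinj; rewrite ?inE.
pose X (t : R) : power I bool := fun i => binary_digit (c i) t.
have mX : measurable_fun [set: R] X.
  by apply: measurable_fun_power => i; apply: measurable_fun_prop; exact: measurable_binary_digit.
pose Xf : {mfun (measurableTypeR R) >-> power I bool} :=
  HB.pack X (isMeasurableFun.Build _ _ (measurableTypeR R) _ X mX).
pose beta0 := pushforward (@unit_measure R) X.
have betaE (s : {fset I}) (b : I -> bool) :
    beta0 [set f : power I bool | forall i, i \in s -> f i = b i] =
    ((2 ^+ #|` s|)^-1)%:E.
  pose b' n := `[< exists2 i, c i = n & b i >].
  have b'E i : b' (c i) = b i.
    by apply/asboolP/idP => [[j /ci ->]//|bi]; exists i.
  pose S := (c @` s)%fset.
  (* any strict upper bound of the codes that occur *)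
  pose N := (\sum_(n <- S) n.+1)%N.
  have SN n : n \in S -> (n < N)%N.
    by move=> nS; rewrite /N (big_fsetD1 n) //= leq_addr.
  rewrite /beta0 /pushforward /unit_measure /mrestr /=.
  have -> : X @^-1` [set f : power I bool | forall i, i \in s -> f i = b i]
      `&` dyadic 0 0 = (dyadic 0 0 : set R) `&` digit_pattern S b' 0 N.
    rewrite setIC; apply/seteqP; split => t [t0 ht]; split => //.
      by move=> n _ /imfsetP[i /= si ->]; rewrite b'E; exact: ht.
    move=> i si; rewrite /X -b'E; apply: ht; last by apply/imfsetP; exists i.
    by rewrite /= add0n; apply: SN; apply/imfsetP; exists i.
  rewrite digit_pattern_measure expr0 invr1 mul1r.
  suff -> : count (mem S) (iota 0 N) = #|` s| by [].
  have <- : #|` S| = #|` s| by rewrite card_imfset.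
  rewrite -size_filter.
  apply: perm_size; apply: uniq_perm.
  - by rewrite filter_uniq // iota_uniq.
  - exact: fset_uniq.
  - move=> n; rewrite mem_filter mem_iota /= add0n.
    by apply/andP/idP => [[]//|nS]; split => //; exact: SN.
exists (distribution (@unit_measure R) Xf); exact: betaE.
Qed.

End Coins.

Section CoinsTheory.
Context (R : realType) (I : choiceType).
Hypothesis Icount : countable [set: I].
Variable beta : probability (power I bool) R.
Hypothesis fair : fair_coins beta.

Definition all_heads (s : {fset I}) : set (power I bool) :=
  [set f | forall i, i \in s -> f i].

Lemma all_heads_measure s : beta (all_heads s) = ((2 ^+ #|` s|)^-1)%:E.
Proof.
by rewrite -(fair s (fun=> true)).
Qed.

Lemma all_heads_generate :
  @measurable _ (power I bool) = <<s range all_heads >>.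
Proof.
apply/seteqP; split.
  apply: smallest_sub; first exact: smallest_sigma_algebra.
  move=> _ [i [B [mB ->]]].
  have mi : <<s range all_heads >> [set f : power I bool | f i].
    apply: sub_sigma_algebra; exists [fset i]%fset => //.
    apply/seteqP; split => f /= h; first by apply: h; rewrite inE.
    by move=> j; rewrite inE => /eqP ->.
  have [Bt|Bt] := pselect (B true); have [Bf|Bf] := pselect (B false).
  - rewrite (_ : [set f : I -> bool | B (f i)] = setT).
      exact: (@measurableT _ (g_sigma_algebraType (range all_heads))).
    by apply/seteqP; split => // f _ /=; case: (f i).
  - rewrite (_ : [set f : I -> bool | B (f i)] = [set f | f i]) //.
    by apply/seteqP; split => f /=; case: (f i).
  - rewrite (_ : [set f : I -> bool | B (f i)] = ~` [set f | f i]).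
      exact: (@measurableC _ (g_sigma_algebraType (range all_heads))).
    by apply/seteqP; split => f /=; case: (f i).
  - rewrite (_ : [set f : I -> bool | B (f i)] = set0).
      exact: (@measurable0 _ (g_sigma_algebraType (range all_heads))).
    by apply/seteqP; split => f /=; case: (f i).
apply: smallest_sub; first exact: sigma_algebra_measurable.
move=> _ [s _ <-].
apply: (@measurable_forall _ (power I bool)) => // i.
apply: (@measurable_imp _ (power I bool)); first exact: measurable_const.
apply: (@measurable_atom _ (power I bool) I id i).
exact: measurable_id.
Qed.

Lemma measurable_reindex (sg : I -> I) :
  measurable_fun [set: power I bool] (fun f : power I bool => (f \o sg : power I bool)).
Proof. by apply: measurable_fun_power => i; exact: measurable_coord. Qed.

(** The events that finitely many coins show heads form a generating
    pi-system, and their probability only depends on the number of coins. *)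
Lemma fair_coins_reindex (sg : I -> I) (B : set (power I bool)) : injective sg ->
  measurable B ->
  beta ((fun f : power I bool => (f \o sg : power I bool)) @^-1` B) = beta B.
Proof.
move=> sgi mB.
pose Xf : {mfun power I bool >-> power I bool} :=
  HB.pack (fun f : power I bool => (f \o sg : power I bool))
    (isMeasurableFun.Build _ _ _ _ _ (@measurable_reindex sg)).
apply: (@measure_unique _ R (power I bool) (range all_heads) (fun=> setT)
  all_heads_generate _ _ _ (distribution beta Xf) beta) => //.
- move=> _ _ [s _ <-] [s' _ <-]; exists (s `|` s')%fset => //.
  apply/seteqP; split => f /=.
    by move=> h; split => i si; apply: h; rewrite inE si ?orbT.
  by move=> [h h'] i; rewrite inE => /orP[/h|/h'].
- move=> _; exists fset0 => //; by apply/seteqP; split.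
- by apply/seteqP; split => // f _; exists 0%N.
- move=> _ [s _ <-].
  have E : beta (all_heads (sg @` s)%fset) = beta (all_heads s).
    by rewrite !all_heads_measure card_imfset.
  transitivity (beta (all_heads (sg @` s)%fset)); last exact: E.
  rewrite /distribution /pushforward /=; congr (beta _).
  apply/seteqP; split => f /= h.
    by move=> _ /imfsetP[i /= si ->]; exact: h.
  by move=> i si; apply: h; apply/imfsetP; exists i.
- move=> _; apply: (@le_lt_trans _ _ 1%E); last exact: ltry.
  exact: (@probability_le1 _ _ _ (distribution beta Xf)).
Qed.

End CoinsTheory.

Section Patterns.
Context (R : realType) (V : choiceType).
Hypothesis Vcount : countable [set: V].
Variable beta : probability (power (nat * V) bool) R.
Hypothesis fair : fair_coins beta.
Variables F N : {fset V}.
Hypothesis FN : [disjoint F & N]%fset.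

Let U := (F `|` N)%fset.
Let q : R := (2 ^+ #|` U|)^-1.

Definition row (k : nat) : {fset nat * V} := [fset (k, x) | x in U]%fset.

(** At time [k], the coins show heads on [F] and tails on [N]. *)
Definition row_match (k : nat) (f : power (nat * V) bool) :=
  forall i, i \in row k -> f i = (i.2 \in F).

Let agree_on (s : {fset nat * V}) : set (power (nat * V) bool) :=
  [set f | forall i, i \in s -> f i = (i.2 \in F)].

Let agree_onE s : beta (agree_on s) = ((2 ^+ #|` s|)^-1)%:E.
Proof. exact: (fair s (fun i => i.2 \in F)). Qed.

Let measurable_agree_on s : measurable (agree_on s).
Proof.
apply: (@measurable_forall _ (power (nat * V) bool)) => [|i].
  by apply: countable_prod => //; exact: countableP.
apply: (@measurable_imp _ (power (nat * V) bool)); first exact: measurable_const.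
have ma := @measurable_atom _ (power (nat * V) bool) (nat * V)%type id i (@measurable_id _ _ _).
case: (i.2 \in F) => //.
rewrite (_ : mkset _ = [set f : power (nat * V) bool | ~ f i]).
  exact: measurable_not.
by apply/seteqP; split => f /=; case: (f i).
Qed.

Let all_rows_fail (k0 n : nat) : set (power (nat * V) bool) :=
  [set f | forall k, (k0 <= k < k0 + n)%N -> ~ row_match k f].

Let measurable_row_match k : measurable [set f | row_match k f].
Proof. exact: measurable_agree_on. Qed.

Let measurable_all_rows_fail k0 n : measurable (all_rows_fail k0 n).
Proof.
apply: (@measurable_forall _ (power (nat * V) bool)) => [|k]; first exact: countableP.
apply: (@measurable_imp _ (power (nat * V) bool)); first exact: measurable_const.
by apply: (@measurable_not _ (power (nat * V) bool)); exact: measurable_row_match.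
Qed.

(** Rows at different times are independent. The cylinder [s] is there for the
    induction, where the event that one more row matches is absorbed into it. *)
Let all_rows_fail_measure k0 n s :
  (forall i, i \in s -> (i.1 < k0)%N || (k0 + n <= i.1)%N) ->
  beta (agree_on s `&` all_rows_fail k0 n) = ((2 ^+ #|` s|)^-1 * (1 - q) ^+ n)%:E.
Proof.
elim: n s => [|n IH] s sk.
  rewrite expr0 mulr1 -agree_onE; congr (beta _); apply/seteqP; split => f; first by case.
  by move=> h; split => // k; rewrite addn0 => /andP[ni]; rewrite ltnNge ni.
have -> : agree_on s `&` all_rows_fail k0 n.+1 =
    (agree_on s `&` all_rows_fail k0 n) `\` [set f | row_match (k0 + n) f].
  apply/seteqP; split => f.
    move=> [h m]; split; last by apply: m; rewrite leq_addr addnS /=.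
    split => // k /andP[k1 k2]; apply: m.
    by rewrite k1 addnS ltnS ltnW.
  move=> [[h m] nm]; split => // k /andP[k1]; rewrite addnS ltnS leq_eqVlt.
  move=> /orP[/eqP -> //|k2]; apply: m.
  by rewrite k1.
have -> : beta ((agree_on s `&` all_rows_fail k0 n) `\` [set f | row_match (k0 + n) f]) =
    (beta (agree_on s `&` all_rows_fail k0 n) -
     beta ((agree_on s `&` all_rows_fail k0 n) `&` [set f | row_match (k0 + n) f]))%E.
  apply: measureD.
  - by apply: measurableI.
  - exact: measurable_row_match.
  - apply: (@le_lt_trans _ _ 1%E); last exact: ltry.
    by apply: (@probability_le1 _ _ _ beta); apply: measurableI.
have -> : (agree_on s `&` all_rows_fail k0 n) `&` [set f | row_match (k0 + n) f] =
    agree_on (s `|` row (k0 + n))%fset `&` all_rows_fail k0 n.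
  apply/seteqP; split => f.
    move=> [[h m] r]; split => // i; rewrite inE => /orP[/h //|]; exact: r.
  move=> [h m]; split; last by move=> i ir; apply: h; rewrite inE ir orbT.
  by split => // i si; apply: h; rewrite inE si.
have sk' i : i \in s -> (i.1 < k0)%N || (k0 + n <= i.1)%N.
  by move=> /sk /orP[->//|]; rewrite addnS => /ltnW ->; rewrite orbT.
rewrite !IH //; last first.
  move=> i; rewrite inE => /orP[/sk' //|/imfsetP[x /= _ ->]] /=.
  by rewrite leqnn orbT.
have -> : #|` (s `|` row (k0 + n))%fset| = (#|` s| + #|` U|)%N.
  have dis : [disjoint s & row (k0 + n)]%fset.
    apply/fdisjointP => i /sk; apply: contraL => /imfsetP[x /= _ ->] /=.
    by rewrite negb_or -leqNgt leq_addr -ltnNge addnS ltnSn.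
  move: dis; rewrite -fsetI_eq0 => /eqP dis.
  have := cardfsUI s (row (k0 + n)); rewrite dis cardfs0 addn0 => ->.
  by rewrite card_imfset //= => x y [].
rewrite -EFinB; congr (_%:E); rewrite exprD invfM -/q exprS.
by rewrite -/q mulrBl mul1r mulrBr mulrA.
Qed.

Lemma rows_match_ae :
  \forall f \ae beta, forall k0, exists2 k, (k0 <= k)%N & row_match k f.
Proof.
apply: ae_forall_countable => [|k0]; first exact: countableP.
have mE : measurable [set f : power (nat * V) bool | forall k, (k0 <= k)%N -> ~ row_match k f].
  apply: (@measurable_forall _ (power (nat * V) bool)) => [|k]; first exact: countableP.
  apply: (@measurable_imp _ (power (nat * V) bool)); first exact: measurable_const.
  by apply: (@measurable_not _ (power (nat * V) bool)); exact: measurable_row_match.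
have q0 : 0 < q by rewrite invr_gt0 exprn_gt0.
have q1 : q <= 1 by rewrite invf_le1 ?exprn_gt0 // exprn_ege1 // ler1n.
have E0 : beta [set f | forall k, (k0 <= k)%N -> ~ row_match k f] = 0%E.
  have bnd n : (beta [set f | forall k, (k0 <= k)%N -> ~ row_match k f] <=
      ((1 - q) ^+ n)%:E)%E.
    have := @all_rows_fail_measure k0 n fset0; rewrite cardfs0 expr0 invr1 mul1r => <- //.
    apply: le_measure; rewrite ?inE //; first exact: measurableI.
    by move=> f h; split => // k /andP[+ _]; exact: h.
  have : (fun n => ((1 - q) ^+ n)%:E) @ \oo --> 0%:E.
    apply: cvg_EFin; first by near=> n.
    by apply: cvg_expr; rewrite ger0_norm ?subr_ge0 // ltrBlDr ltrDl.
  move=> cv; apply/eqP; rewrite -measure_le0.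
  by apply: (cvge_ge _ cv); exact: nearW.
apply: filterS (ae_measure0 mE E0) => f nf.
apply: contrapT => h; apply: nf => k k0k rk; apply: h; by exists k.
Unshelve. all: by end_near. Qed.

End Patterns.

(** * Conditional densities *)

Lemma integral_ind_set d (T : measurableType d) (R : realType)
    (mu : {measure set T -> \bar R}) (f : T -> \bar R) (E : set T) :
  (\int[mu]_(x in E) f x = \int[mu]_x (f x * ind (E x)))%E.
Proof.
rewrite integral_mkcond; apply: eq_integral => x _; rewrite patchE.
have [Ex|Ex] := pselect (E x); first by rewrite mem_set // indT // mule1.
by rewrite memNset // indF // mule0.
Qed.

Lemma ae_eq_ind d (T : measurableType d) (R : realType)
    (mu : {measure set T -> \bar R}) (f g : T -> \bar R) :
  measurable_fun [set: T] f -> measurable_fun [set: T] g ->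
  (forall x, 0 <= f x)%E -> (\int[mu]_x f x < +oo)%E ->
  (forall E, measurable E ->
     \int[mu]_x (f x * ind (E x)) = \int[mu]_x (g x * ind (E x)))%E ->
  \forall x \ae mu, f x = g x.
Proof.
move=> mf mg f0 foo fg.
have : ae_eq mu [set: T] f g.
  apply: integral_ae_eq => //.
    apply/integrableP; split => //.
    by under eq_integral do rewrite gee0_abs //.
  by move=> E _ mE; rewrite [LHS]integral_ind_set [RHS]integral_ind_set fg.
by apply: filterS => x; apply.
Qed.

Section CondMeasure.
Context d d' (Om : measurableType d) (T : measurableType d') (R : realType).
Variables (Q : probability Om R) (X : {mfun Om >-> T}) (C : set Om).
Hypothesis mC : measurable C.

(** The joint law of the event [C] and of [X]; its density with respect to the
    law of [X] is the conditional probability of [C] given [X]. *)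
Definition cond_measure (E : set T) : \bar R := Q (C `&` X @^-1` E).

Let cond0 : cond_measure set0 = 0%E.
Proof. by rewrite /cond_measure preimage_set0 setI0 measure0. Qed.

Let cond_ge0 E : (0 <= cond_measure E)%E.
Proof. exact: measure_ge0. Qed.

Let mXC E : measurable E -> measurable (C `&` X @^-1` E).
Proof.
move=> mE; apply: measurableI => //.
by rewrite -[X in measurable X]setTI; exact: (measurable_funPT X).
Qed.

Let cond_additive : semi_sigma_additive cond_measure.
Proof.
move=> F mF tF mUF.
rewrite /cond_measure preimage_bigcup setI_bigcupr.
apply: (measure_semi_sigma_additive (fun n => C `&` X @^-1` F n)).
- by move=> n; exact: mXC.
- apply/trivIsetP => i j _ _ ij.
  rewrite setIACA setIid -preimage_setI.
  by have /trivIsetP/(_ i j I I ij) -> := tF; rewrite preimage_set0 setI0.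
- by rewrite -setI_bigcupr -preimage_bigcup; exact: mXC.
Qed.

HB.instance Definition _ := isMeasure.Build _ _ _ cond_measure
  cond0 cond_ge0 cond_additive.

Let cond_fin : fin_num_fun cond_measure.
Proof.
move=> E mE; rewrite ge0_fin_numE //; apply: (@le_lt_trans _ _ 1%E); last exact: ltry.
by apply: (@probability_le1 _ _ _ Q); exact: mXC.
Qed.

HB.instance Definition _ := Measure_isFinite.Build _ _ _ cond_measure cond_fin.

Lemma conditional_density (P : probability T R) :
  (forall B, measurable B -> Q (X @^-1` B) = P B) ->
  exists p : T -> \bar R, [/\ forall x, (0 <= p x)%E,
    measurable_fun [set: T] p, (\int[P]_x p x < +oo)%E &
    forall E, measurable E ->
      (\int[P]_x (p x * ind (E x)) = Q (C `&` X @^-1` E))%E].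
Proof.
move=> law.
have dom : cond_measure `<< P.
  apply/null_content_dominatesP => E mE E0.
  apply/eqP; rewrite -measure_le0; apply: (@le_trans _ _ (Q (X @^-1` E))); last first.
    by rewrite (law _ mE) [X in (X <= _)%E]E0.
  apply: (@le_measure _ _ _ Q); rewrite ?inE; [exact: mXC| |exact: subIsetr].
  by rewrite -[X in measurable X]setTI; exact: (measurable_funPT X).
have [p [p0 pint pE]] := radon_nikodym_finite dom.
have mp := measurable_int _ pint.
exists p; split => //; last by move=> E mE; rewrite -(integral_ind_set P) -pE.
move/integrableP : pint => [_]; apply: le_lt_trans.
rewrite (_ : (\int[P]_x p x = \int[P]_x `|p x|)%E) //.
by apply: eq_integral => x _; rewrite gee0_abs.
Qed.

End CondMeasure.

Lemma ae_comp d d' (Om : measurableType d) (T : measurableType d') (R : realType)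
    (Q : {measure set Om -> \bar R}) (P : {measure set T -> \bar R}) (X : Om -> T)
    (S : T -> Prop) : measurable_fun [set: Om] X ->
  (forall B, measurable B -> Q (X @^-1` B) = P B) ->
  (\forall x \ae P, S x) -> \forall t \ae Q, S (X t).
Proof.
move=> mX law [N [mN N0 SN]]; exists (X @^-1` N); split.
- by rewrite -[X in measurable X]setTI; exact: mX.
- by rewrite law.
- by move=> t /= nS; apply: SN.
Qed.

Lemma measureD_null d (T : measurableType d) (R : realType)
    (mu : {measure set T -> \bar R}) (A N : set T) :
  measurable A -> measurable N -> mu N = 0%E -> mu (A `\` N) = mu A.
Proof.
move=> mA mN N0; rewrite [RHS](measureDI mu mA mN).
by rewrite (@subset_measure0 _ _ _ mu (A `&` N) N) ?adde0 //; exact: measurableI.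
Qed.

Lemma integral_law d d' (Om : measurableType d) (T : measurableType d') (R : realType)
    (Q : {measure set Om -> \bar R}) (P : {measure set T -> \bar R}) (X : Om -> T)
    (h : T -> \bar R) : measurable_fun [set: Om] X ->
  (forall B, measurable B -> Q (X @^-1` B) = P B) ->
  (forall x, 0 <= h x)%E -> measurable_fun [set: T] h ->
  (\int[Q]_t h (X t) = \int[P]_x h x)%E.
Proof.
move=> mX law h0 mh.
have := ge0_integral_pushforward mX Q measurableT mh (fun t _ => h0 t).
rewrite preimage_setT => <-.
by apply: eq_measure_integral => A mA _; exact: law.
Qed.

Lemma esum_ind_unique (R : realType) (I : choiceType) (S : I -> Prop) :
  (forall i j, S i -> S j -> i = j) ->
  (\esum_(i in [set: I]) ind (R := R) (S i) <= ind (exists i, S i))%E.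
Proof.
move=> Su; have [[i Si]|nS] := pselect (exists i, S i).
  rewrite (esum_only (i0 := i)) ?ind_ge0 //; first by apply: ind_le => _; exists i.
  by move=> j ji; rewrite indF // => Sj; apply: ji; exact: Su.
rewrite esum1 ?ind_ge0 // => i _; rewrite indF // => Si; apply: nS; by exists i.
Qed.

(** * Hyperfinite configurations have vanishing Cheeger constants *)
Section Actions.
Context {V : choiceType} {G : sgraph V}.

Lemma measurable_act_vset (g : aut G) : measurable_fun [set: vset V] (act_vset g).
Proof. by apply: measurable_fun_power => x; exact: measurable_coord. Qed.

Lemma measurable_act_config (g : aut G) : measurable_fun [set: config V] (act_config g).
Proof. by apply: measurable_fun_power => x; exact: measurable_coord. Qed.

Lemma measurable_act_pair (g : aut G) :
  measurable_fun [set: config V * vset V] (act_pair g).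
Proof.
apply/measurable_fun_pairP; split.
- exact: (measurableT_comp (measurable_act_config g) measurable_fst).
- exact: (measurableT_comp (measurable_act_vset g) measurable_snd).
Qed.

Lemma measurable_act_filtration (g : aut G) :
  measurable_fun [set: config V * power nat (config V)] (act_filtration g).
Proof.
apply/measurable_fun_pairP; split.
  exact: (measurableT_comp (measurable_act_config g) measurable_fst).
apply: measurable_fun_power => n.
apply: (measurableT_comp (measurable_act_config g)).
exact: (measurableT_comp (@measurable_coord nat _ _ n) measurable_snd).
Qed.

End Actions.

Section Forward.
Context (R : realType) (V : choiceType) (G : sgraph V).
Hypothesis Gconn : connected_graph G.
Hypothesis Glf : locally_finite_graph G.
Variable Gam : groupClosed (aut G).
Hypothesis Gam_closed : closed_subgroup Gam.
Hypothesis Gam_qt : quasi_transitive Gam.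
Variable m : {measure set (borel_subgrp Gam) -> \bar R}.
Hypothesis m_haar : haar_measure m.
Variable P : probability (config V) R.
Hypothesis P_inv : law_invariant Gam (@act_config V G) P.
Variable D : nat.
Hypothesis P_deg : \forall w \ae P, forall x, (neighbours (config_adj w) x #<= `I_D)%card.
Hypothesis Vcount : countable [set: V].

Variables (d : measure_display) (Om : measurableType d) (Q : probability Om R).
Variables (w : {mfun Om >-> config V}) (wn : {mfun Om >-> power nat (config V)}).
Hypothesis w_law : forall B, measurable B -> Q (w @^-1` B) = P B.
Hypothesis wn_mono : \forall t \ae Q, forall n,
  config_sub (wn t n) (wn t n.+1) /\ config_sub (wn t n) (w t).
Hypothesis wn_inv : law_invariant Gam (@act_filtration V G)
  (pushforward Q (fun t => (w t, wn t))).
Hypothesis wn_union : \forall t \ae Q, \bigcup_n [set` wn t n] = [set` w t].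
Hypothesis wn_fin : forall n, \forall t \ae Q, forall x,
  finite_set (component (config_adj (wn t n)) x).

Let mw : measurable_fun [set: Om] w := measurable_funPT w.
Let mwn n : measurable_fun [set: Om] (fun t => wn t n : config V).
Proof. exact: (measurableT_comp (@measurable_coord nat _ _ n) (measurable_funPT wn)). Qed.

Let FVcount : countable [set: {fset V}] := countable_fset Vcount.

Let is_cluster n (K : {fset V}) (t : Om) := is_block (wn t n) (fun=> true) K.

Let measurable_is_cluster n K : measurable [set t | is_cluster n K t].
Proof. by apply: measurable_is_block => //; exact: measurable_cst. Qed.

(** The density is the conditional probability that [K] is a cluster of the
    [n]-th approximation, as a function of the configuration. *)
Let density_ex n K := conditional_density (measurable_is_cluster n K) w_law.
Let density n K := sval (cid (density_ex n K)).

Let density_ge0 n K x : (0 <= density n K x)%E.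
Proof. by rewrite /density; case: cid => p []. Qed.
Let measurable_density n K : measurable_fun [set: config V] (density n K).
Proof. by rewrite /density; case: cid => p []. Qed.
Let density_fin n K : (\int[P]_x density n K x < +oo)%E.
Proof. by rewrite /density; case: cid => p []. Qed.
Let densityE n K E : measurable E ->
  (\int[P]_x (density n K x * ind (E x)) = Q ([set t | is_cluster n K t] `&` w @^-1` E))%E.
Proof. by rewrite /density; case: cid => p /= [? ? ? h]; exact: h. Qed.

Let mwE E : measurable E -> measurable (w @^-1` E).
Proof. by move=> mE; rewrite -[X in measurable X]setTI; exact: mw. Qed.

(** Almost surely, exactly one finite cluster contains [x]. *)
Let density_sum n x : \forall v \ae P,
  (\esum_(K in [set: {fset V}]) (ind (x \in K) * density n K v) = 1)%E.
Proof.
have m1 K : measurable_fun [set: config V] (fun v => ind (x \in K) * density n K v)%E.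
  by apply: emeasurable_funM => //; exact: measurable_cst.
have key E : measurable E -> (\int[P]_v ((\esum_(K in [set: {fset V}])
    (ind (x \in K) * density n K v)) * ind (E v)) = P E)%E.
  move=> mE.
  transitivity (\int[P]_v (\esum_(K in [set: {fset V}])
      (ind (x \in K) * (density n K v * ind (E v)))))%E.
    apply: eq_integral => v _; rewrite muleC -esumeZl ?ind_ge0 //.
      by apply: eq_esum => K _; rewrite muleCA [(ind (E v) * _)%E]muleC.
    by move=> K; exact: ind_mul_ge0.
  rewrite integral_esum //; last 2 first.
  - by move=> K v; apply: ind_mul_ge0; rewrite mule_ge0 ?ind_ge0.
  - move=> K; apply: emeasurable_funM; first exact: measurable_cst.
    by apply: emeasurable_funM => //; exact: measurable_ind.
  transitivity (\esum_(K in [set: {fset V}])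
      Q ((w @^-1` E) `&` [set t | x \in K /\ is_cluster n K t]))%E.
    apply: eq_esum => K _.
    rewrite ge0_integralZl ?ind_ge0 //; last 2 first.
    - by apply: emeasurable_funM => //; exact: measurable_ind.
    - by move=> v _; rewrite mule_ge0 ?ind_ge0.
    rewrite densityE //; have [xK|xK] := pselect (x \in K).
      rewrite indT // mul1e; congr (Q _).
      by apply/seteqP; split => t /= [a b]; [|case: b => _ b]; split.
    by rewrite indF // mul0e (_ : _ `&` _ = set0) ?measure0 //;
      apply/seteqP; split => // t [_ []].
  have [N [mN N0 finN]] := wn_fin n.
  rewrite -w_law //; transitivity (Q (w @^-1` E `\` N)).
    transitivity (\esum_(K in [set: {fset V}])
        Q ((w @^-1` E `\` N) `&` [set t | x \in K /\ is_cluster n K t]))%E.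
      apply: eq_esum => K _; apply/esym.
      rewrite setIDAC setIDA; apply: (@measureD_null _ _ _ Q) => //.
      apply: measurableI; first exact: mwE.
      by apply: measurable_and => //; exact: measurable_const.
    apply/esym; apply: (@measure_esum _ _ _ Q) => //.
    - by apply: measurableD => //; exact: mwE.
    - by move=> K; apply: measurable_and => //; exact: measurable_const.
    - move=> t [_ nN].
      have fin : finite_set (component (config_adj (wn t n)) x).
        by apply: contrapT => nf; apply: nN; apply: finN => /(_ x).
      have [K bK xK] := block_exists fin.
      exists K; split => // K' [xK' bK']; exact: block_eq bK' bK xK' xK.
  by apply: (@measureD_null _ _ _ Q) => //; exact: mwE.
apply: (@ae_eq_ind _ _ _ P (fun v => \esum_(K in [set: {fset V}])
  (ind (x \in K) * density n K v))%E (cst 1%E)) => //.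
- by apply: measurable_esum => // K v; exact: ind_mul_ge0.
- by move=> v; apply: esum_ge0 => K _; exact: ind_mul_ge0.
- have := key setT measurableT; rewrite probability_setT => k1.
  rewrite (_ : (\int[P]_v _ = 1)%E) ?ltry // -k1.
  by apply: eq_integral => v _; rewrite (indT (P := setT v)) // mule1.
- move=> E mE; rewrite key //.
  by under eq_integral do rewrite mul1e; rewrite integral_ind.
Qed.

Variable mu : probability (config V * vset V)%type R.
Hypothesis mu_inv : law_invariant Gam (@act_pair V G) mu.
Hypothesis mu_fst : forall B, measurable B -> mu (fst @^-1` B) = P B.

(** Both sides have the same integral over every event, by the invariance of the
    joint law of the configuration and its approximations. *)
Let density_inv n K (g : aut G) : g \in Gam ->
  \forall v \ae P, density n (g @` K)%fset (act_config g v) = density n K v.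
Proof.
move=> gG; have mag := @measurable_act_config V G.
have mag' := fun h : aut G => fun _ : h \in Gam => mag h.
have mdg : measurable_fun [set: config V] (fun v => density n (g @` K)%fset (act_config g v)).
  exact: (measurableT_comp (measurable_density n (g @` K)%fset) (mag g)).
apply: ae_eq_ind => //.
  by rewrite (integral_inv mag' P_inv gG (h := density n (g @` K)%fset)).
move=> E mE; rewrite densityE //.
pose E' := act_config g^-1%g @^-1` E.
have mE' : measurable E' by rewrite -[E']setTI; exact: mag.
transitivity (\int[P]_v (density n (g @` K)%fset (act_config g v) *
    ind (E' (act_config g v))))%E.
  by apply: eq_integral => v _; rewrite /E' /preimage /= act_configK.
rewrite (integral_inv mag' P_inv gG
  (h := fun v => density n (g @` K)%fset v * ind (E' v))%E); last 2 first.
- by move=> v; rewrite mule_ge0 ?ind_ge0.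
- by apply: emeasurable_funM => //; exact: measurable_ind.
rewrite densityE //.
pose B : set (config V * power nat (config V)) :=
  [set z | is_block (z.2 n : config V) (fun=> true) K /\ E z.1].
have mB : measurable B.
  apply: measurable_and; last first.
    by rewrite -[X in measurable X]setTI; exact: measurable_fst.
  apply: (@measurable_is_block V _ (config V * power nat (config V))%type Vcount
    (fun z => z.2 n : config V) (fun=> (fun=> true))); last exact: measurable_cst.
  exact: (measurableT_comp (@measurable_coord nat _ _ n) measurable_snd).
have := wn_inv (gpredVr _ gG) mB; rewrite /pushforward => inv.
have -> : [set t | is_cluster n K t] `&` w @^-1` E = (fun t => (w t, wn t)) @^-1` B by [].
rewrite -inv; congr (Q _); apply/seteqP.
have eqv t : is_block (act_config g^-1%g (wn t n)) (fun=> true) K <->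
    is_block (wn t n) (fun=> true) (g @` K)%fset.
  rewrite -[K in X in X <-> _](imfset_autK g K).
  exact: (is_block_act g^-1%g (wn t n) (fun=> true) (g @` K)%fset).
by split => t /= [a b]; split => //; apply/eqv.
Qed.

Let expanding (c : R) (z : config V * vset V) := forall F, F != fset0 ->
  (forall x, x \in F -> z.2 x) ->
  ((c * total_weight m F)%:E <= boundary_weight m z.1 z.2 F)%E.

Let mbd F y : measurable [set z : config V * vset V | boundary z.1 z.2 F y].
Proof. exact: measurable_boundary. Qed.

Let We x : (0 <= (haar_weight m x)%:E)%E.
Proof. by rewrite lee_fin ltW // (haar_weight_gt0 Gconn Glf Gam_closed m_haar). Qed.

Let mbdw F : measurable_fun [set: config V * vset V] (fun z => boundary_weight m z.1 z.2 F).
Proof.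
apply: measurable_esum => // [y z|y]; first exact: ind_mul_ge0.
by apply: emeasurable_funM => //; exact: measurable_ind.
Qed.

Let matom x : measurable [set z : config V * vset V | z.2 x].
Proof. by apply: measurable_atom; exact: measurable_snd. Qed.

Let measurable_expanding c : measurable [set z | expanding c z].
Proof.
apply: measurable_forall => // F; apply: measurable_imp; first exact: measurable_const.
apply: measurable_imp.
  apply: measurable_forall => // x; apply: measurable_imp => //.
  exact: measurable_const.
rewrite -[X in measurable X]setTI.
exact: emeasurable_fun_c_infty.
Qed.

Let expanding_act c (g : aut G) z : g \in Gam -> expanding c (act_pair g z) <-> expanding c z.
Proof.
have dir (h : aut G) z' : h \in Gam -> expanding c (act_pair h z') -> expanding c z'.
  move=> hG e F /fset0Pn[x xF] FA.
  have [_ <-] := boundary_weight_act Gconn Glf Gam_closed m_haar x z'.1 z'.2 F c hG.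
  apply: e; first by apply/imfset_aut0/fset0Pn; exists x.
  by move=> _ /imfset_autP[y yF ->]; rewrite /= act_vsetE; exact: FA.
move=> gG; split; first exact: dir.
move=> e; apply: (dir g^-1%g); first exact: gpredVr.
by case: z e => a b; rewrite /act_pair /= act_configK act_vsetK.
Qed.

Let trace (K : {fset V}) (A : vset V) : {fset V} := [fset x in K | A x]%fset.

Let in_trace K A x : (x \in trace K A) = (x \in K) && A x.
Proof. by rewrite !inE. Qed.

Let trace_act (g : aut G) K A :
  trace (g @` K)%fset (act_vset g A) = (g @` trace K A)%fset.
Proof.
apply/fsetP => y; rewrite -(aut_KV g y) in_trace !mem_imfset_aut in_trace.
by rewrite act_vsetE.
Qed.

Let measurable_trace K F : measurable [set z : config V * vset V | trace K z.2 = F].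
Proof.
have -> : [set z : config V * vset V | trace K z.2 = F] =
    [set z : config V * vset V | forall x,
       (x \in F -> x \in K /\ z.2 x) /\ (x \in K -> z.2 x -> x \in F)].
  apply/seteqP; split => z /= h.
    by move=> x; rewrite -h in_trace; split=> [/andP//|-> ->].
  apply/fsetP => x; rewrite in_trace; have [h1 h2] := h x.
  by apply/andP/idP => [[]//|/h1].
apply: measurable_forall => // x; apply: measurable_and.
  apply: measurable_imp; first exact: measurable_const.
  by apply: measurable_and => //; exact: measurable_const.
apply: measurable_imp; first exact: measurable_const.
by apply: measurable_imp => //; exact: measurable_const.
Qed.

(** The blocks are the traces on the random set of the clusters of the [n]-th
    approximation. The random set and the approximations need not be defined
    together: the densities replace the clusters. *)
Section FixedLevel.
Variables (n : nat) (c : R).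
Hypothesis c0 : 0 < c.

Let a (F : {fset V}) (z : config V * vset V) : \bar R :=
  (\esum_(K in [set: {fset V}]) (density n K z.1 * ind (trace K z.2 = F /\ expanding c z)))%E.

Let a0 F z : (0 <= a F z)%E.
Proof. by apply: esum_ge0 => K _; rewrite mule_ge0 ?ind_ge0. Qed.

Let measurable_density_fst K : measurable_fun [set: config V * vset V] (fun z => density n K z.1).
Proof. exact: (measurableT_comp (measurable_density n K) measurable_fst). Qed.

Let a_meas F : measurable_fun [set: config V * vset V] (a F).
Proof.
apply: measurable_esum => // [K z|K]; first by rewrite mule_ge0 ?ind_ge0.
apply: emeasurable_funM => //; apply: measurable_ind.
by apply: measurable_and.
Qed.

Let a_inv (g : aut G) : g \in Gam -> forall F : {fset V},
  \forall z \ae mu, a (g @` F)%fset (act_pair g z) = a F z.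
Proof.
move=> gG F.
have dz1 K := ae_comp measurable_fst mu_fst (density_inv n K gG).
have := ae_forall_countable FVcount dz1.
apply: filterS => z dz.
rewrite /a (reindex_esum [set: {fset V}] _ _ _ (imfset_bij g)).
apply: eq_esum => K _ /=; rewrite dz; congr (_ * _)%E; apply: ind_iff.
rewrite trace_act expanding_act //; split=> -[e E]; split => //; last by rewrite e.
by rewrite -(imfset_autK g (trace K z.2)) e imfset_autK.
Qed.

(** The event that makes [y] a possible boundary point of the cluster [K]. *)
Let touch (K : {fset V}) y (v : config V) := y \notin K /\ exists2 x, x \in K & config_adj v x y.

Let mtouch K y : measurable [set v : config V | touch K y v].
Proof.
apply: measurable_and; first exact: measurable_const.
by apply: measurable_exists_in => // x; apply: measurable_adj; exact: measurable_id.
Qed.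

Let mS x : measurable [set z : config V * vset V | z.2 x /\ expanding c z].
Proof. exact: measurable_and. Qed.

Let a_total x : mu [set z : config V * vset V | z.2 x /\ expanding c z] =
  (\esum_(F in [set: {fset V}]) (ind (x \in F) * \int[mu]_z a F z))%E.
Proof.
rewrite -(integral_ind mu (mS x)).
transitivity (\int[mu]_z (\esum_(F in [set: {fset V}]) (ind (x \in F) * a F z)))%E.
  apply: ge0_ae_eq_integral => //.
  - exact: measurable_ind.
  - apply: measurable_esum => // [F z|F]; first exact: ind_mul_ge0.
    by apply: emeasurable_funM => //; exact: measurable_cst.
  - by move=> z _; exact: ind_ge0.
  - by move=> z _; apply: esum_ge0 => F _; exact: ind_mul_ge0.
  have := ae_comp measurable_fst mu_fst (density_sum n x).
  apply: filterS => z dz _; apply/esym.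
  transitivity (\esum_(F in [set: {fset V}]) \esum_(K in [set: {fset V}])
      (ind (x \in F) * (density n K z.1 * ind (trace K z.2 = F /\ expanding c z))))%E.
    apply: eq_esum => F _; rewrite esumeZl ?ind_ge0 //.
    by move=> K; rewrite mule_ge0 ?ind_ge0.
  rewrite esum_swap; last first.
    by move=> F K; apply: ind_mul_ge0; rewrite mule_ge0 ?ind_ge0.
  transitivity (\esum_(K in [set: {fset V}])
      (ind (z.2 x /\ expanding c z) * (ind (x \in K) * density n K z.1)))%E; last first.
    rewrite esumeZl ?ind_ge0 ?dz ?mule1 //.
    by move=> K; exact: ind_mul_ge0.
  apply: eq_esum => K _; rewrite (esum_only (i0 := trace K z.2)); last 2 first.
  - by apply: ind_mul_ge0; rewrite mule_ge0 ?ind_ge0.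
  - by move=> F ne; rewrite (indF (P := _ /\ _)) ?mule0 // => -[e _]; apply: ne.
  rewrite muleCA -ind_and [RHS]muleA -ind_and [RHS]muleC; congr (_ * _)%E.
  apply: ind_iff; rewrite in_trace; split=> [[/andP[xK Ax] [_ E]]|[[Ax E] xK]] //.
  by split=> //; apply/andP.
rewrite integral_esum //; last 2 first.
- by move=> F z; exact: ind_mul_ge0.
- by move=> F; apply: emeasurable_funM => //; exact: measurable_cst.
by apply: eq_esum => F _; rewrite ge0_integralZl ?ind_ge0.
Qed.

Let rw := random_weight m (fun (F : {fset V}) y (z : config V * vset V) => boundary z.1 z.2 F y).

Let lower (x : V) : (c%:E * mu [set z : config V * vset V | z.2 x /\ expanding c z] <=
  \esum_(F in [set: {fset V}]) (ind (x \in F) *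
     \int[mu]_z (a F z * (rw F z * (total_weight m F)^-1%:E))))%E.
Proof.
have c0' : 0 <= c := ltW c0.
rewrite a_total -esumZl //; last first.
  by move=> F; apply: ind_mul_ge0; exact: integral_ge0.
apply: le_esum => F _; rewrite muleCA.
have [xF|xF] := pselect (x \in F); last by rewrite indF // !mul0e.
rewrite indT // !mul1e -ge0_integralZl ?lee_fin //.
have WFp : 0 < total_weight m F by exact: (total_weight_gt0 Gconn Glf Gam_closed m_haar xF).
have WFV : (0 <= (total_weight m F)^-1%:E :> \bar R)%E by rewrite lee_fin invr_ge0 ltW.
apply: ge0_le_integral => //.
- by move=> z _; rewrite mule_ge0 // lee_fin ltW.
- by apply: emeasurable_funM => //; exact: measurable_cst.
- apply: emeasurable_funM => //; apply: emeasurable_funM; first exact: (mbdw F).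
  exact: measurable_cst.
move=> z _; rewrite muleC.
have [[K [cK E]]|nK] := pselect (exists K, trace K z.2 = F /\ expanding c z); last first.
  rewrite (_ : a F z = 0%E) ?mul0e // /a esum1 // => K _.
  by rewrite indF ?mule0 // => h; apply: nK; exists K.
apply: lee_wpmul2l => //; rewrite lee_pdivlMr // -EFinM.
apply: E; first by apply/fset0Pn; exists x.
by move=> u; rewrite -cK in_trace => /andP[].
Qed.

Let upper (y : V) : (\esum_(F in [set: {fset V}]) (ind (F != fset0) *
     \int[mu]_z (a F z * ind (boundary z.1 z.2 F y))) <=
  \esum_(K in [set: {fset V}]) Q [set t | is_cluster n K t /\ touch K y (w t)])%E.
Proof.
have mab F : measurable_fun [set: config V * vset V]
    (fun z => a F z * ind (boundary z.1 z.2 F y))%E.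
  by apply: emeasurable_funM => //; exact: measurable_ind.
have ab0 F z : (0 <= a F z * ind (boundary z.1 z.2 F y))%E by rewrite mule_ge0 ?ind_ge0.
apply: (@le_trans _ _ (\esum_(F in [set: {fset V}])
    \int[mu]_z (a F z * ind (boundary z.1 z.2 F y)))%E).
  apply: le_esum => F _; rewrite -[leRHS]mul1e; apply: lee_wpmul2r; last exact: ind_le1.
  exact: integral_ge0.
rewrite -integral_esum //.
have mtouch1 K : measurable_fun [set: config V] (fun v => density n K v * ind (touch K y v))%E.
  by apply: emeasurable_funM => //; exact: measurable_ind.
have dt0 K v : (0 <= density n K v * ind (touch K y v))%E by rewrite mule_ge0 ?ind_ge0.
apply: (@le_trans _ _ (\int[mu]_z (\esum_(K in [set: {fset V}])
    (density n K z.1 * ind (touch K y z.1))))%E).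
  apply: ge0_le_integral => //.
  - by move=> z _; exact: esum_ge0.
  - exact: measurable_esum.
  - apply: measurable_esum => // K.
    exact: (measurableT_comp (mtouch1 K) measurable_fst).
  move=> z _.
  apply: (@le_trans _ _ (\esum_(F in [set: {fset V}]) \esum_(K in [set: {fset V}])
      (density n K z.1 * ind ((trace K z.2 = F /\ expanding c z) /\ boundary z.1 z.2 F y)))%E).
    apply: le_esum => F _; rewrite /a muleC -esumeZl ?ind_ge0 //; last first.
      by move=> K; rewrite mule_ge0 ?ind_ge0.
    by apply: le_esum => K _; rewrite muleC -muleA -ind_and.
  rewrite esum_swap; last by move=> F K; rewrite mule_ge0 ?ind_ge0.
  apply: le_esum => K _; rewrite esumeZl //; last by move=> F; exact: ind_ge0.
  apply: lee_wpmul2l => //; rewrite (esum_only (i0 := trace K z.2)) ?ind_ge0 //.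
    apply: ind_le => -[_]; rewrite /boundary /outer_vertex_boundary /=.
    move=> [Ay yF [u uF /and3P[Au _ uy]]]; split.
      by apply/negP => yK; apply: yF; rewrite in_trace yK.
    by exists u => //; move: uF; rewrite in_trace => /andP[].
  by move=> F ne; rewrite indF // => -[[e _] _]; apply: ne.
rewrite integral_esum //; last first.
  by move=> K; exact: (measurableT_comp (mtouch1 K) measurable_fst).
apply: le_esum => K _.
rewrite (integral_law measurable_fst mu_fst (h := fun v => density n K v * ind (touch K y v))%E) //.
by rewrite (densityE n K (mtouch K y)) le_refl.
Qed.

Lemma level_bound r x0 : transversal Gam r -> x0 \in r ->
  (c%:E * mu [set z : config V * vset V | z.2 x0 /\ expanding c z] <=
   \sum_(y <- r) \esum_(K in [set: {fset V}]) Q [set t | is_cluster n K t /\ touch K y (w t)])%E.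
Proof.
move=> rT x0r.
have mag' := fun h : aut G => fun _ : h \in Gam => @measurable_act_pair V G h.
have b_inv (g : aut G) : g \in Gam -> forall (F : {fset V}) y z,
    boundary (act_pair g z).1 (act_pair g z).2 (g @` F)%fset (g y) <-> boundary z.1 z.2 F y.
  by move=> gG F y z; exact: boundary_act.
have bt := block_transport Gconn Glf Gam_closed m_haar mag' mu_inv a0 a_meas mbd
  a_inv b_inv rT.
apply: (@le_trans _ _ (\sum_(y <- r) \esum_(F in [set: {fset V}])
     (ind (F != fset0) * \int[mu]_z (a F z * ind (boundary z.1 z.2 F y))))%E); last first.
  by apply: lee_sum => y _; exact: upper.
rewrite -bt (big_rem x0) //=; apply: le_trans (lower x0) _.
rewrite leeDl //; apply: sume_ge0 => x _; apply: esum_ge0 => F _.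
rewrite mule_ge0 ?ind_ge0 //; apply: integral_ge0 => z _.
rewrite mule_ge0 // mule_ge0 //.
  exact: (random_weight_ge0 Gconn Glf Gam_closed m_haar).
by rewrite lee_fin invr_ge0 (total_weight_ge0 Gconn Glf Gam_closed m_haar).
Qed.

End FixedLevel.


(** Taking all later approximations into account makes the event decrease with
    [n]. *)
Let missing_edge n (y : V) (t : Om) := exists k, (n <= k)%N /\
  exists z, config_adj (w t) z y /\ ~ config_adj (wn t k) z y.

Let measurable_missing_edge n y : measurable [set t | missing_edge n y t].
Proof.
apply: measurable_exists => [|k]; first exact: countableP.
apply: measurable_and; first exact: measurable_const.
apply: measurable_exists => // z; apply: measurable_and; first exact: measurable_adj.
by apply: measurable_not; exact: measurable_adj.
Qed.

(** A cluster that is adjacent to [y] without containing it contains a neighbour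
    of [y] that is not joined to [y] in the approximation; there are at most [D]
    neighbours, each in one cluster. *)
Let touch_missing_edge n y : (\esum_(K in [set: {fset V}])
    Q [set t | is_cluster n K t /\ (y \notin K /\ exists2 x, x \in K & config_adj (w t) x y)] <=
  D%:R%:E * Q [set t | missing_edge n y t])%E.
Proof.
have mt K : measurable [set t | is_cluster n K t /\
    (y \notin K /\ exists2 x, x \in K & config_adj (w t) x y)].
  apply: measurable_and => //; apply: measurable_and; first exact: measurable_const.
  by apply: measurable_exists_in => // x; exact: measurable_adj.
rewrite (eq_esum (b := fun K => (\int[Q]_t ind (is_cluster n K t /\
    (y \notin K /\ exists2 x, x \in K & config_adj (w t) x y)))%E)); last first.
  by move=> K _; rewrite integral_ind.
rewrite -integral_esum //; last 2 first.
- by move=> K t; exact: ind_ge0.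
- by move=> K; exact: measurable_ind.
rewrite -(integral_ind Q (measurable_missing_edge n y)) -ge0_integralZl //; last 2 first.
- exact: measurable_ind.
- by move=> t _; exact: ind_ge0.
apply: ae_ge0_le_integral => //.
- by move=> t _; apply: esum_ge0 => K _; exact: ind_ge0.
- apply: measurable_esum => // [K t|K]; first exact: ind_ge0.
  exact: measurable_ind.
- by move=> t _; rewrite mule_ge0 ?ind_ge0 // lee_fin.
- by apply: emeasurable_funM; [exact: measurable_cst|exact: measurable_ind].
apply: filterS (ae_comp mw w_law P_deg) => t deg _.
apply: (@le_trans _ _ (\esum_(K in [set: {fset V}]) \esum_(z in [set: V])
    ind (is_cluster n K t /\ z \in K /\ y \notin K /\ config_adj (w t) z y))%E).
  apply: le_esum => K _.
  have [[cK [yK [x xK xy]]]|h] := pselect (is_cluster n K t /\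
    (y \notin K /\ exists2 x, x \in K & config_adj (w t) x y)); last first.
    by rewrite indF // esum_ge0 // => z _; exact: ind_ge0.
  rewrite indT; last by split=> //; split=> //; exists x.
  have <- : ind (R := R) (is_cluster n K t /\ x \in K /\ y \notin K /\
    config_adj (w t) x y) = 1%E by rewrite indT.
  by apply: (@esum_ge1 R V x (fun z => ind (is_cluster n K t /\ z \in K /\ y \notin K /\
    config_adj (w t) z y))) => z; exact: ind_ge0.
rewrite esum_swap; last by move=> K z; exact: ind_ge0.
apply: (@le_trans _ _ (\esum_(z in [set: V])
    (ind (missing_edge n y t) * ind (config_adj (w t) z y)))%E).
  apply: le_esum => z _; rewrite -ind_and.
  apply: le_trans (esum_ind_unique R _) _.
    by move=> K K' [cK [zK _]] [cK' [zK' _]]; exact: block_eq cK cK' zK zK'.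
  apply: ind_le => -[K [cK [zK [/negP yK zy]]]]; split => //.
  exists n; split => //; exists z; split => // zy'; apply: yK.
  by case: cK => _ _ _; apply; [exact: zK| |].
rewrite esumeZl ?ind_ge0 //; last by move=> z; exact: ind_ge0.
by rewrite muleC; apply: lee_wpmul2r; [exact: ind_ge0|exact: deg_esum].
Qed.

(** The finitely many edges at [y] all appear in the approximations, and stay. *)
Let missing_edge_null y : Q (\bigcap_n [set t | missing_edge n y t]) = 0%E.
Proof.
have mcap : measurable (\bigcap_n [set t | missing_edge n y t]).
  by apply: bigcapT_measurable => n; exact: measurable_missing_edge.
apply: (@measure0_ae_not _ _ _ Q (fun t => (\bigcap_n [set t | missing_edge n y t]) t)) => //.
apply: filterS3 wn_mono wn_union (ae_comp mw w_law P_deg) => t mono un deg badn.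
have mono' e i j : (i <= j)%N -> wn t i e -> wn t j e.
  elim: j => [|j IH]; first by rewrite leqn0 => /eqP ->.
  rewrite leq_eqVlt => /orP[/eqP -> //|ij wi].
  by apply: (mono j).1; exact: IH.
have edge e : w t e -> exists i, wn t i e.
  move=> we; have : [set` w t] e by [].
  by rewrite -un => -[i _ wi]; exists i.
have adj z : exists i, config_adj (w t) z y -> forall j, (i <= j)%N -> config_adj (wn t j) z y.
  have [zy|nzy] := pselect (config_adj (w t) z y); last by exists 0%N.
  move/orP: zy => -[/edge[i wi]|/edge[i wi]]; exists i => _ j ij; apply/orP.
    by left; exact: mono' wi.
  by right; exact: mono' wi.
have [i iP] := choice adj.
have fin : finite_set (neighbours (config_adj (w t)) y).
  exact: card_le_finite (deg y) (finite_II D).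
pose N := fset_set (neighbours (config_adj (w t)) y).
(* the sum serves as a common upper bound of the indices [i z] *)
have [k [Nk [z [zy nzy]]]] := badn (\sum_(z <- N) i z)%N I.
apply: nzy; apply: iP => //; apply: leq_trans Nk.
have zN : z \in N by rewrite in_fset_set // inE /neighbours /= config_adj_sym.
by rewrite (big_fsetD1 z) //= leq_addr.
Qed.

Lemma forward_null (x0 : V) (c : R) : 0 < c ->
  mu [set z : config V * vset V | z.2 x0 /\ expanding c z] = 0%E.
Proof.
move=> c0; have [r rT x0r] := transversal_exists x0 Gam_qt.
have bnd n : (c%:E * mu [set z : config V * vset V | z.2 x0 /\ expanding c z] <=
    \sum_(y <- r) (D%:R%:E * Q [set t | missing_edge n y t]))%E.
  apply: le_trans (level_bound n c0 rT x0r) _.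
  by apply: lee_sum => y _; exact: touch_missing_edge.
have lim0 : (fun n => \sum_(y <- r) (D%:R%:E * Q [set t | missing_edge n y t]))%E @ \oo -->
    (\sum_(y <- r) 0)%E.
  apply: cvg_nnesum => [y _|y _].
    by apply: nearW => n; rewrite mule_ge0 // lee_fin.
  have lim_bad : (fun n => Q [set t | missing_edge n y t]) @ \oo --> 0%E.
    rewrite -(missing_edge_null y).
    apply: (@nonincreasing_cvg_mu _ _ _ Q (fun n => [set t | missing_edge n y t])) => //.
    - apply: (@le_lt_trans _ _ 1%E); last exact: ltry.
      by apply: (@probability_le1 _ _ _ Q).
    - by apply: bigcapT_measurable => n; exact: measurable_missing_edge.
    - move=> i j ij; apply/subsetPset => t [k [jk bk]]; exists k; split => //.
      exact: leq_trans jk.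
  have := cvgeZl (_ : D%:R%:E \is a fin_num) lim_bad.
  by rewrite mule0; apply.
have : (c%:E * mu [set z : config V * vset V | z.2 x0 /\ expanding c z] <= \sum_(y <- r) 0)%E.
  by apply: (cvge_ge _ lim0); exact: nearW.
by rewrite big1 // pmule_rle0 ?lte_fin // measure_le0 => /eqP.
Qed.

Lemma forward_ae (o : V) : \forall z \ae mu, [set` z.2] !=set0 ->
  cheeger (weight m o) (induced_subgraph z.1 z.2) = 0%E.
Proof.
have nul x k : \forall z \ae mu, ~ ((z : config V * vset V).2 x /\ expanding k.+1%:R^-1 z).
  apply: (@ae_measure0 _ _ _ mu
    (fun z : config V * vset V => z.2 x /\ expanding k.+1%:R^-1 z)).
    exact: measurable_and.
  by apply: forward_null; rewrite invr_gt0.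
have := ae_forall_countable Vcount (fun x => ae_foralln (nul x)).
apply: filterS => z nz [x zx]; apply: contrapT.
move=> /(cheeger_neq0 Gconn Glf Gam_closed m_haar)[c c0 cE].
have [k kc] : exists k : nat, k.+1%:R^-1 <= c.
  (* any integer above the inverse of [c] works *)
  exists (Num.truncn c^-1).
  rewrite -[leRHS]invrK lef_pV2 ?posrE ?invr_gt0 // ltW // truncnS_gt //.
apply: (nz x k); split => // F F0 FA; apply: le_trans (cE F F0 FA).
by rewrite lee_fin ler_wpM2r // (total_weight_ge0 Gconn Glf Gam_closed m_haar).
Qed.

End Forward.

(** * Configurations with vanishing Cheeger constants are hyperfinite *)
Lemma ind_exists_le (R : realType) (I : choiceType) (S : I -> Prop) :
  (ind (R := R) (exists i, S i) <= \esum_(i in [set: I]) ind (S i))%E.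
Proof.
have [[i Si]|nS] := pselect (exists i, S i); last first.
  by rewrite indF // esum_ge0 // => i _; exact: ind_ge0.
rewrite indT; last by exists i.
rewrite -(indT (R := R) Si); apply: (@esum_ge1 R I i (fun i => ind (S i))) => j.
exact: ind_ge0.
Qed.

Lemma measure_exists_le d (T : measurableType d) (R : realType)
    (mu : {measure set T -> \bar R}) (I : choiceType) (S : I -> T -> Prop) :
  countable [set: I] -> (forall i, measurable [set t | S i t]) ->
  (mu [set t | exists i, S i t] <= \esum_(i in [set: I]) mu [set t | S i t])%E.
Proof.
move=> cI mS.
rewrite (eq_esum (b := fun i => (\int[mu]_t ind (S i t))%E)); last first.
  by move=> i _; rewrite integral_ind.
rewrite -integral_esum //; last 2 first.
- by move=> i t; exact: ind_ge0.
- by move=> i; exact: measurable_ind.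
have mE : measurable [set t | exists i, S i t] by exact: measurable_exists.
rewrite -(integral_ind mu mE); apply: ge0_le_integral => //.
- by move=> t _; exact: ind_ge0.
- exact: measurable_ind.
- apply: measurable_esum => // [i t|i]; first exact: ind_ge0.
  exact: measurable_ind.
- by move=> t _; exact: ind_exists_le.
Qed.

Section Backward.
Context (R : realType) (V : choiceType) (G : sgraph V).
Hypothesis Gconn : connected_graph G.
Hypothesis Glf : locally_finite_graph G.
Variable Gam : groupClosed (aut G).
Hypothesis Gam_closed : closed_subgroup Gam.
Hypothesis Gam_qt : quasi_transitive Gam.
Variable m : {measure set (borel_subgrp Gam) -> \bar R}.
Hypothesis m_haar : haar_measure m.
Hypothesis Vcount : countable [set: V].

Let FVcount : countable [set: {fset V}] := countable_fset Vcount.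

Let We x : (0 <= (haar_weight m x)%:E)%E.
Proof. by rewrite lee_fin ltW // (haar_weight_gt0 Gconn Glf Gam_closed m_haar). Qed.

Notation coins := (power (nat * V) bool).
Notation space := (config V * coins)%type.

Definition act_coins (g : aut G) (f : coins) : coins := fun i => f (i.1, g^-1%g i.2).
Definition act_space (g : aut G) (t : space) : space :=
  (act_config g t.1, act_coins g t.2).

Let measurable_act_coins g : measurable_fun [set: coins] (act_coins g).
Proof. by apply: measurable_fun_power => i; exact: measurable_coord. Qed.

Let measurable_act_space g : measurable_fun [set: space] (act_space g).
Proof.
apply/measurable_fun_pairP; split.
- exact: (measurableT_comp (measurable_act_config g) measurable_fst).
- exact: (measurableT_comp (measurable_act_coins g) measurable_snd).
Qed.

(** The greedy removal of sets whose boundary ratio is at most [eps]. *)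
Section Greedy.
Variable eps : R.

(** Restricting to the vertices with heads makes the candidates at one time
    disjoint and non-adjacent, without any symmetry-breaking choice. *)
Definition selected (w : config V) (A : vset V) (f : coins) k (F : {fset V}) :=
  is_block w (fun x => A x && f (k, x)) F /\ (boundary_weight m w A F <= (eps * total_weight m F)%:E)%E.

Definition covered w A f k y := exists F, selected w A f k F /\ (y \in F \/ boundary w A F y).

Fixpoint remaining (t : space) (k : nat) : vset V :=
  if k is k'.+1 then
    fun y => remaining t k' y && ~~ `[< covered t.1 (remaining t k') t.2 k' y >]
  else fun=> true.

Definition selected_at k F (t : space) := selected t.1 (remaining t k) t.2 k F.
Definition boundary_at k F y (t : space) := boundary t.1 (remaining t k) F y.
Definition separator y (t : space) := exists k, exists F, selected_at k F t /\ boundary_at k F y t.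
Definition rest y (t : space) := forall k, remaining t k y.

(** Stated for a given [k], for use in the induction that proves that the
    remaining set is measurable. *)
Lemma measurable_selected_at_aux k : measurable_fun [set: space] (remaining ^~ k) ->
  forall F, measurable [set t | selected_at k F t] /\
    forall y, measurable [set t | boundary_at k F y t].
Proof.
move=> mr F.
have mBd y : measurable [set t | boundary_at k F y t].
  exact: (@measurable_boundary V _ space Vcount fst (remaining ^~ k) measurable_fst mr).
split=> //; apply: measurable_and.
  apply: (@measurable_is_block V _ space Vcount fst
    (fun t x => remaining t k x && t.2 (k, x)) measurable_fst).
  apply: measurable_fun_power => x; apply: measurable_fun_prop.
  have -> : [set t : space | remaining t k x && t.2 (k, x)] =
      [set t | remaining t k x /\ t.2 (k, x)].
    by apply/seteqP; split => t /= /andP.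
  apply: measurable_and; first exact: (@measurable_atom _ space V (remaining ^~ k) x mr).
  exact: (@measurable_atom _ space (nat * V)%type snd (k, x) measurable_snd).
have mb : measurable_fun [set: space] (fun t => boundary_weight m t.1 (remaining t k) F).
  apply: measurable_esum => // [y t|y]; first exact: ind_mul_ge0.
  by apply: emeasurable_funM => //; apply: measurable_ind; exact: mBd.
by rewrite -[X in measurable X]setTI; exact: emeasurable_fun_infty_c.
Qed.

Lemma measurable_remaining k : measurable_fun [set: space] (remaining ^~ k).
Proof.
elim: k => [|k IH] /=; first exact: measurable_cst.
apply: measurable_fun_power => y; apply: measurable_fun_prop.
have -> : [set t : space | remaining t k y &&
      ~~ `[< covered t.1 (remaining t k) t.2 k y >]] =
    [set t | remaining t k y /\ ~ exists F, selected_at k F t /\ (y \in F \/ boundary_at k F y t)].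
  apply/seteqP; split => t /=; first by move=> /andP[a /asboolPn].
  by move=> [a b]; apply/andP; split => //; apply/asboolPn.
apply: measurable_and; first exact: (@measurable_atom _ space V (remaining ^~ k) y IH).
apply: measurable_not; apply: measurable_exists => // F.
have [mS mB] := measurable_selected_at_aux IH F.
by apply: measurable_and => //; apply: measurable_or => //; exact: measurable_const.
Qed.

Lemma measurable_selected_at k F : measurable [set t | selected_at k F t].
Proof. by have [] := measurable_selected_at_aux (measurable_remaining k) F. Qed.

Lemma measurable_boundary_at k F y : measurable [set t | boundary_at k F y t].
Proof. by have [_] := measurable_selected_at_aux (measurable_remaining k) F; apply. Qed.

Lemma measurable_separator y : measurable [set t | separator y t].
Proof.
apply: measurable_exists => [|k]; first exact: countableP.
apply: measurable_exists => // F.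
by apply: measurable_and; [exact: measurable_selected_at|exact: measurable_boundary_at].
Qed.

Lemma measurable_rest y : measurable [set t | rest y t].
Proof.
apply: measurable_forall => [|k]; first exact: countableP.
exact: (@measurable_atom _ space V (remaining ^~ k) y (measurable_remaining k)).
Qed.

Lemma selected_act (o : V) (g : aut G) w A f k F : g \in Gam ->
  selected (act_config g w) (act_vset g A) (act_coins g f) k (g @` F)%fset <->
  selected w A f k F.
Proof.
move=> gG; rewrite /selected.
have [-> _] := boundary_weight_act Gconn Glf Gam_closed m_haar o w A F eps gG.
have := is_block_act g w (fun x => A x && f (k, x)) F.
have -> : act_vset g (fun x => A x && f (k, x)) =
  (fun x => act_vset g A x && act_coins g f (k, x)) by [].
by move=> h; split=> -[/h a b].
Qed.

Lemma covered_act (g : aut G) w A f k y : g \in Gam ->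
  covered (act_config g w) (act_vset g A) (act_coins g f) k (g y) <->
  covered w A f k y.
Proof.
move=> gG; split=> -[F [sF yF]].
  have FE : F = (g @` (g^-1%g @` F))%fset by rewrite -[LHS](imfset_autK g^-1%g) invgK.
  exists (g^-1%g @` F)%fset; move: sF yF; rewrite {1 2 3}FE.
  move=> /(selected_act y _ _ _ _ _ gG) sF [yF|yF]; split => //.
    by left; rewrite mem_imfset_aut in yF.
  by right; apply/boundary_act; exact: yF.
exists (g @` F)%fset; split; first exact/(selected_act y).
by case: yF => yF; [left; rewrite mem_imfset_aut|right; exact/boundary_act].
Qed.

Lemma remaining_act (g : aut G) t k : g \in Gam ->
  remaining (act_space g t) k = act_vset g (remaining t k).
Proof.
move=> gG; elim: k => [//|k IH] /=; apply/funext => y.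
rewrite IH -(aut_KV g y) !act_vsetE; congr (_ && ~~ _).
by apply/asboolP/asboolP => /(covered_act _ _ _ _ _ gG).
Qed.

Lemma selected_at_act (o : V) (g : aut G) k F t : g \in Gam ->
  selected_at k (g @` F)%fset (act_space g t) <-> selected_at k F t.
Proof. by move=> gG; rewrite /selected_at remaining_act //; exact: selected_act. Qed.

Lemma boundary_at_act (g : aut G) k F y t : g \in Gam ->
  boundary_at k (g @` F)%fset (g y) (act_space g t) <-> boundary_at k F y t.
Proof. by move=> gG; rewrite /boundary_at remaining_act //; exact: boundary_act. Qed.

Lemma rest_act (g : aut G) y t : g \in Gam ->
  rest (g y) (act_space g t) <-> rest y t.
Proof.
by move=> gG; split=> h k; have := h k; rewrite remaining_act // act_vsetE.
Qed.

Lemma separator_act (g : aut G) y t : g \in Gam ->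
  separator (g y) (act_space g t) <-> separator y t.
Proof.
move=> gG; split=> -[k [F [sF bF]]]; exists k.
  have FE : F = (g @` (g^-1%g @` F))%fset by rewrite -[LHS](imfset_autK g^-1%g) invgK.
  exists (g^-1%g @` F)%fset; move: sF bF; rewrite {1 2}FE.
  by move=> /(selected_at_act y _ _ _ gG) sF /(boundary_at_act _ _ _ _ gG).
exists (g @` F)%fset; split; first exact/(selected_at_act y).
exact/boundary_at_act.
Qed.

Lemma remaining_le t i j y : (i <= j)%N -> remaining t j y -> remaining t i y.
Proof.
elim: j => [|j IH]; first by rewrite leqn0 => /eqP ->.
rewrite leq_eqVlt => /orP[/eqP -> //|ij] /= /andP[rj _].
by apply: IH rj.
Qed.

Lemma selected_remaining k F t x : selected_at k F t -> x \in F -> remaining t k x.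
Proof. by move=> [[_ FA _ _] _] /FA /andP[]. Qed.

Lemma selected_gone k F t x : selected_at k F t -> x \in F \/ boundary_at k F x t -> ~~ remaining t k.+1 x.
Proof.
move=> sF xF /=; rewrite negb_and negbK; apply/orP; right.
by apply/asboolP; exists F.
Qed.

Lemma selected_unique k k' F F' t x : selected_at k F t -> selected_at k' F' t ->
  x \in F -> x \in F' -> k = k' /\ F = F'.
Proof.
have lt i j K K' : selected_at i K t -> selected_at j K' t -> x \in K -> x \in K' -> (i < j)%N -> False.
  move=> si sj xi xj ij; have := selected_gone si (or_introl xi).
  by rewrite (remaining_le ij (selected_remaining sj xj)).
move=> s s' xF xF'; have [/(lt _ _ _ _ s s' xF xF')//|/(lt _ _ _ _ s' s xF' xF)//|e] := ltngtP k k'.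
split=> //; subst k'; move: s s' => [b _] [b' _]; exact: block_eq b b' xF xF'.
Qed.

Lemma not_rest t y : ~ rest y t -> ~ separator y t -> exists k F, selected_at k F t /\ y \in F.
Proof.
move=> nr ns.
have [k rk nrk] : exists2 k, remaining t k y & ~~ remaining t k.+1 y.
  apply: contrapT => h; apply: nr; elim=> [//|k IH].
  by apply/negPn/negP => nk; apply: h; exists k.
move: nrk; rewrite /= rk negbK => /asboolP[F [sF [yF|yF]]]; first by exists k, F.
by exfalso; apply: ns; exists k, F.
Qed.

(** Let [v] be a neighbour of [u] outside the separator. It belongs to some
    selected set; if that set is selected earlier than [F], then [u] is removed
    with it, and if it is selected later, then [v] is still there at time [k],
    hence in the boundary of [F] or in [F]. *)
Lemma selected_closed t k F u v : (forall y, ~ rest y t) -> selected_at k F t -> u \in F ->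
  ~ separator v t -> config_adj t.1 u v -> v \in F.
Proof.
move=> nr sF uF nsv uv.
have [j [F' [sF' vF']]] := not_rest (nr v) nsv.
have [kj|jk] := leqP k j.
  apply/negPn/negP => vF; apply: nsv; exists k, F; split => //.
  apply/boundaryP; first by move=> x; exact: selected_remaining.
  split => //; last by exists u.
  exact: remaining_le kj (selected_remaining sF' vF').
have uj : remaining t j u by exact: remaining_le (ltnW jk) (selected_remaining sF uF).
have uj1 : remaining t j.+1 u by exact: remaining_le jk (selected_remaining sF uF).
have [uF'|uF'] := boolP (u \in F').
  by have := selected_gone sF' (or_introl uF'); rewrite uj1.
have : boundary_at j F' u t.
  apply/boundaryP; first by move=> x; exact: selected_remaining.
  by split => //; exists v => //; rewrite config_adj_sym.
by move=> bu; have := selected_gone sF' (or_intror bu); rewrite uj1.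
Qed.

(** For a set [F] of small boundary whose points are never removed, let [N] be
    the finite set of its outer neighbours. From some time on, the points of
    [N] that remain are exactly those that are never removed. When the coins
    next show heads on [F] and tails on [N], the set [F] is a block, with the
    small boundary that it has in the surviving graph, and it is removed. *)
Lemma rest_expands t D (F : {fset V}) :
  (forall x, (neighbours (config_adj t.1) x #<= `I_D)%card) ->
  (forall F N : {fset V}, [disjoint F & N]%fset ->
     forall k0, exists2 k, (k0 <= k)%N & row_match F N k t.2) ->
  F != fset0 -> (forall x, x \in F -> rest x t) -> cut_connected t.1 F ->
  ((eps * total_weight m F)%:E <= boundary_weight m t.1 (fun y => `[< rest y t >]) F)%E.
Proof.
move=> deg good F0 FA cF; apply/ltW; rewrite ltNge; apply/negP => small.
have fin : finite_set (\bigcup_(x in [set` F]) neighbours (config_adj t.1) x).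
  apply: bigcup_finite => // x _.
  exact: card_le_finite (deg x) (finite_II D).
pose N := (fset_set (\bigcup_(x in [set` F]) neighbours (config_adj t.1) x) `\` F)%fset.
have inN y : y \notin F -> (exists2 x, x \in F & config_adj t.1 x y) -> y \in N.
  by move=> yF [x xF xy]; rewrite inE yF in_fset_set // inE; exists x.
have dis : [disjoint F & N]%fset.
  by apply/fdisjointP => x xF; rewrite inE xF.
have ex y : exists k, remaining t k y -> rest y t.
  have [ry|nry] := pselect (rest y t); first by exists 0%N.
  have /existsNP[k nk] := nry; by exists k.
have [kk kkP] := choice ex.
(* the sum serves as a common upper bound of the times [kk y] *)
have [k k0k match_k] := good F N dis (\sum_(y <- N) kk y)%N.
have NP y : y \in N -> remaining t k y -> rest y t.
  move=> yN rk; apply: kkP; apply: remaining_le rk; apply: leq_trans k0k.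
  by rewrite (big_fsetD1 y) //= leq_addr.
have Bk x : x \in F -> t.2 (k, x).
  move=> xF; rewrite (match_k (k, x)) //=; apply/imfsetP; exists x => //=.
  by rewrite inE xF.
have nBk y : y \in N -> ~~ t.2 (k, y).
  move=> yN; rewrite (match_k (k, y)) /=; last first.
    by apply/imfsetP; exists y => //=; rewrite inE yN orbT.
  by move: yN; rewrite inE => /andP[].
have [x xF] := fset0Pn _ F0.
have sF : selected_at k F t.
  split; first split => //.
  - by move=> y yF; rewrite (FA y yF k) Bk.
  - move=> u v uF /andP[rv bv] uv; apply/negPn/negP => vF.
    by have := nBk v (inN v vF (ex_intro2 _ _ u uF uv)); rewrite bv.
  apply: le_trans small; apply: le_esum => y _; apply: lee_wpmul2r => //.
  apply: ind_le => /(boundaryP _ _ (fun x xF => FA x xF k))[ry yF nb].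
  apply/boundaryP; first by move=> u uF; apply/asboolP; exact: FA.
  by split => //; apply/asboolP; apply: NP ry; exact: inN.
by have := selected_gone sF (or_introl xF); rewrite (FA x xF).
Qed.

End Greedy.

Section Random.
Variable o : V.
Variable P : probability (config V) R.
Hypothesis P_inv : law_invariant Gam (@act_config V G) P.
Variable beta : probability coins R.
Hypothesis fair : fair_coins beta.

Definition coupling : probability space R := (P \x beta)%E.

Lemma coupling_fst B : measurable B -> coupling (fst @^-1` B) = P B.
Proof.
move=> mB; rewrite -[RHS]mule1 -(probability_setT beta) -product_measure1E //.
by congr (_ _); apply/seteqP; split => t //= [].
Qed.

Lemma coupling_snd B : measurable B -> coupling (snd @^-1` B) = beta B.
Proof.
move=> mB; rewrite -[RHS]mul1e -(probability_setT P) -product_measure1E //.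
by congr (_ _); apply/seteqP; split => t //= [].
Qed.

Let coins_inv (g : aut G) B : measurable B -> beta (act_coins g @^-1` B) = beta B.
Proof.
have ncount : countable [set: (nat * V)%type].
  by apply: countable_prod => //; exact: countableP.
move=> mB; apply: (fair_coins_reindex ncount fair (sg := fun i => (i.1, g^-1%g i.2))) => //.
by move=> [i x] [j y] /= [-> /(can_inj (aut_invK g)) ->].
Qed.

Lemma coupling_inv : law_invariant Gam act_space coupling.
Proof.
move=> g gG B mB.
pose Xf : {mfun space >-> space} :=
  HB.pack (act_space g) (isMeasurableFun.Build _ _ _ _ _ (measurable_act_space g)).
apply/esym; apply: (product_measure_unique (m' := distribution coupling Xf)) => //.
move=> A C mA mC.
have mA' : measurable (act_config g @^-1` A).
  by rewrite -[X in measurable X]setTI; exact: measurable_act_config.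
have mC' : measurable (act_coins g @^-1` C).
  by rewrite -[X in measurable X]setTI; exact: measurable_act_coins.
transitivity (P (act_config g @^-1` A) * beta (act_coins g @^-1` C))%E.
  exact: (product_measure1E P beta mA' mC').
by congr (_ * _)%E; [exact: P_inv|exact: coins_inv].
Qed.

(** At each time, mass transport bounds the separator by [eps] times the
    probability of being selected; each vertex is selected at most once. *)
Lemma separator_small eps r : 0 <= eps -> transversal Gam r ->
  (\sum_(y <- r) coupling [set t | separator eps y t] <= (eps * (size r)%:R)%:E)%E.
Proof.
move=> eps0 rT.
have mSel k F := measurable_selected_at eps k F.
have mBd k F y := measurable_boundary_at eps k F y.
pose SB k F y := coupling [set t | selected_at eps k F t /\ boundary_at eps k F y t].
have step1 y : (coupling [set t | separator eps y t] <=
    \esum_(k in [set: nat]) \esum_(F in [set: {fset V}]) SB k F y)%E.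
  have := @measure_exists_le _ _ _ coupling nat
    (fun k t => exists F, selected_at eps k F t /\ boundary_at eps k F y t).
  move=> /(_ (countableP _)) h; apply: le_trans (h _) _.
    by move=> k; apply: measurable_exists => // F; exact: measurable_and.
  apply: le_esum => k _; apply: measure_exists_le => // F.
  exact: measurable_and.
apply: (@le_trans _ _ (\sum_(y <- r) \esum_(k in [set: nat])
    \esum_(F in [set: {fset V}]) SB k F y)%E).
  by apply: lee_sum => y _; exact: step1.
rewrite -esum_sum; last by move=> k y _ _; apply: esum_ge0 => F _; exact: measure_ge0.
have round k : (\sum_(y <- r) \esum_(F in [set: {fset V}]) SB k F y <=
    eps%:E * \sum_(x <- r) \esum_(F in [set: {fset V}])
      coupling [set t | selected_at eps k F t /\ x \in F])%E.
  have Finv (g : aut G) : g \in Gam -> forall F : {fset V},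
      \forall t \ae coupling, ind (R := R) (selected_at eps k (g @` F)%fset (act_space g t)) =
        ind (selected_at eps k F t).
    by move=> gG F; apply: aeW => t; apply: ind_iff; exact: (selected_at_act eps o).
  have Binv (g : aut G) : g \in Gam -> forall (F : {fset V}) y t,
      boundary_at eps k (g @` F)%fset (g y) (act_space g t) <-> boundary_at eps k F y t.
    by move=> gG F y t; exact: boundary_at_act.
  have bt := block_transport Gconn Glf Gam_closed m_haar
    (fun g _ => measurable_act_space g) coupling_inv
    (fun F t => ind_ge0 (selected_at eps k F t))
    (fun F => measurable_ind (mSel k F)) (mBd k) Finv Binv rT.
  apply: (@le_trans _ _ (\sum_(y <- r) \esum_(F in [set: {fset V}])
     (ind (F != fset0) * \int[coupling]_t (ind (selected_at eps k F t) * ind (boundary_at eps k F y t)))))%E.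
    apply: lee_sum => y _; apply: le_esum => F _.
    have [F0|F0] := eqVneq F fset0.
      rewrite /SB (_ : mkset _ = set0) ?measure0 ?ind_mul_ge0 //.
        by apply: integral_ge0 => t _; rewrite mule_ge0 ?ind_ge0.
      by apply/seteqP; split => // t [[[]]]; rewrite F0 eqxx.
    rewrite indT // mul1e; under eq_integral do rewrite -ind_and.
    by rewrite integral_ind //; exact: measurable_and.
  rewrite -bt ge0_sume_distrr; last first.
    by move=> x _; apply: esum_ge0 => F _; exact: measure_ge0.
  apply: lee_sum => x _; rewrite -esumZl //.
  apply: le_esum => F _; have [xF|xF] := pselect (x \in F); last first.
    by rewrite indF // mul0e mule_ge0 ?lee_fin.
  have WFp : 0 < total_weight m F by exact: (total_weight_gt0 Gconn Glf Gam_closed m_haar xF).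
  have WFV : (0 <= (total_weight m F)^-1%:E :> \bar R)%E by rewrite lee_fin invr_ge0 ltW.
  rewrite indT // mul1e (_ : [set t | _ /\ _] = [set t | selected_at eps k F t]); last first.
    by apply/seteqP; split => t /=; [case|split].
  rewrite -(integral_ind coupling (mSel k F)) -ge0_integralZl ?lee_fin //; last 2 first.
  - exact: measurable_ind.
  - by move=> t _; exact: ind_ge0.
  have rw0 t : (0 <= random_weight m (fun F y t => boundary_at eps k F y t) F t)%E.
    exact: (random_weight_ge0 Gconn Glf Gam_closed m_haar).
  apply: ge0_le_integral => //.
  - by move=> t _; rewrite mule_ge0 ?ind_ge0 // mule_ge0.
  - apply: emeasurable_funM; first exact: measurable_ind.
    apply: emeasurable_funM; last exact: measurable_cst.
    exact: (measurable_random_weight Gconn Glf Gam_closed m_haar (mBd k)).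
  - by apply: emeasurable_funM; [exact: measurable_cst|exact: measurable_ind].
  move=> t _; rewrite muleC; have [sF|sF] := pselect (selected_at eps k F t); last first.
    by rewrite indF // !mule0.
  rewrite indT // !mule1 lee_pdivrMr // -EFinM.
  by case: sF.
apply: (@le_trans _ _ (\esum_(k in [set: nat]) (eps%:E * \sum_(x <- r)
   \esum_(F in [set: {fset V}]) coupling [set t | selected_at eps k F t /\ x \in F]))%E).
  by apply: le_esum => k _; exact: round.
rewrite esumZl //; last first.
  by move=> k; apply: sume_ge0 => x _; apply: esum_ge0 => F _; exact: measure_ge0.
rewrite EFinM; apply: lee_wpmul2l; first by rewrite lee_fin.
rewrite esum_sum; last by move=> k x _ _; apply: esum_ge0 => F _; exact: measure_ge0.
apply: (@le_trans _ _ (\sum_(x <- r) 1%E)%E); last first.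
  have -> : (\sum_(x <- r) 1 = (\sum_(x <- r) 1%R)%:E :> \bar R)%E by rewrite -sumEFin.
  by rewrite big_const_seq count_predT iter_addr_0 lexx.
apply: lee_sum => x _.
have mSx k F : measurable [set t | selected_at eps k F t /\ x \in F].
  by apply: measurable_and => //; exact: measurable_const.
apply: (@le_trans _ _ (\int[coupling]_t (\esum_(k in [set: nat])
    \esum_(F in [set: {fset V}]) ind (selected_at eps k F t /\ x \in F)))%E).
  rewrite integral_esum; last 3 first.
  - exact: countableP.
  - by move=> k t; apply: esum_ge0 => F _; exact: ind_ge0.
  - move=> k; apply: measurable_esum => // [F t|F]; first exact: ind_ge0.
    exact: measurable_ind.
  apply: le_esum => k _; rewrite integral_esum //; last 2 first.
  - by move=> F t; exact: ind_ge0.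
  - by move=> F; exact: measurable_ind.
  by apply: le_esum => F _; rewrite integral_ind.
apply: (@le_trans _ _ (\int[coupling]_t (cst 1%E t))%E); last first.
  rewrite integral_cst // mul1e.
  exact: (@probability_le1 _ _ _ coupling setT measurableT).
apply: ge0_le_integral => //.
- by move=> t _; apply: esum_ge0 => k _; apply: esum_ge0 => F _; exact: ind_ge0.
- apply: measurable_esum; first exact: countableP.
    by move=> k t; apply: esum_ge0 => F _; exact: ind_ge0.
  move=> k; apply: measurable_esum => // [F t|F]; first exact: ind_ge0.
  exact: measurable_ind.
move=> t _.
apply: (@le_trans _ _ (\esum_(k in [set: nat]) ind (exists F, selected_at eps k F t /\ x \in F))%E).
  apply: le_esum => k _; apply: esum_ind_unique => F F' [s xF] [s' xF'].
  by have [] := selected_unique s s' xF xF'.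
apply: le_trans (ind_le1 (exists k, exists F, selected_at eps k F t /\ x \in F)).
apply: esum_ind_unique => k k' [F [s xF]] [F' [s' xF']].
by have [] := selected_unique s s' xF xF'.
Qed.


Variable D : nat.
Hypothesis P_deg : \forall w \ae P,
  forall x, (neighbours (config_adj w) x #<= `I_D)%card.

Definition fst_rv : {mfun space >-> config V} :=
  HB.pack (fst : space -> config V) (isMeasurableFun.Build _ _ _ _ _
    (@measurable_fst _ _ (config V) coins)).

Let fst_law : has_law (fst_rv : {RV coupling >-> config V}) P.
Proof. by move=> B mB; exact: coupling_fst. Qed.

Let pushforward_inv d' (T' : measurableType d') (actT : aut G -> T' -> T') (X : space -> T') :
  measurable_fun [set: space] X ->
  (forall g B, g \in Gam -> measurable B -> measurable (actT g @^-1` B)) ->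
  (forall g t, g \in Gam -> X (act_space g t) = actT g (X t)) ->
  law_invariant Gam actT (pushforward coupling X).
Proof.
move=> mX mT eqv g gG B mB; rewrite /pushforward.
have mXB : measurable (X @^-1` B) by rewrite -[Y in measurable Y]setTI; exact: mX.
rewrite -[RHS](coupling_inv gG mXB); congr (coupling _).
by apply/seteqP; split => t; rewrite /preimage /= eqv.
Qed.

Let good : \forall t \ae coupling,
  (forall x, (neighbours (config_adj t.1) x #<= `I_D)%card) /\
  (forall F N : {fset V}, [disjoint F & N]%fset ->
     forall k0, exists2 k, (k0 <= k)%N & row_match F N k t.2).
Proof.
have gd := ae_comp measurable_fst coupling_fst P_deg.
have gc : \forall f \ae beta, forall p : {fset V} * {fset V}, [disjoint p.1 & p.2]%fset ->
    forall k0, exists2 k, (k0 <= k)%N & row_match p.1 p.2 k f.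
  apply: (@ae_forall_countable _ _ _ beta _ (fun (p : {fset V} * {fset V}) f =>
    [disjoint p.1 & p.2]%fset -> forall k0, exists2 k, (k0 <= k)%N & row_match p.1 p.2 k f)).
    exact: countable_prod.
  move=> [F N] /=; have [dis|ndis] := pselect ([disjoint F & N]%fset : bool); last first.
    by apply: aeW => f /ndis.
  by have := rows_match_ae Vcount fair F N; apply: filterS.
have := ae_comp measurable_snd coupling_snd gc.
apply: filterS2 gd => t deg gt; split => // F N dis k0.
exact: (gt (F, N)).
Qed.

(** The hypothesis on Cheeger constants concerns random sets that are almost
    surely nonempty. *)
Definition survivors eps (t : space) : vset V :=
  fun y => `[< rest eps y t \/ ~ exists z, rest eps z t >].

Let measurable_survivors eps : measurable_fun [set: space] (survivors eps).
Proof.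
apply: measurable_fun_power => y; apply: measurable_fun_prop.
have -> : [set t | survivors eps t y] =
    [set t | rest eps y t \/ ~ exists z, rest eps z t].
  by apply/seteqP; split => t /= /asboolP.
apply: measurable_or; first exact: measurable_rest.
by apply: measurable_not; apply: measurable_exists => // z; exact: measurable_rest.
Qed.

Definition survivors_rv eps : {mfun space >-> vset V} :=
  HB.pack (survivors eps) (isMeasurableFun.Build _ _ _ _ _ (measurable_survivors eps)).

Let survivors_act eps (g : aut G) t : g \in Gam ->
  survivors eps (act_space g t) = act_vset g (survivors eps t).
Proof.
move=> gG; apply/funext => y; rewrite -(aut_KV g y) act_vsetE.
have exE : (exists z, rest eps z (act_space g t)) <-> exists z, rest eps z t.
  split=> -[z rz]; last by exists (g z); exact/rest_act.
  by exists (g^-1%g z); move: rz; rewrite -{1}(aut_KV g z) => /(rest_act _ _ _ gG).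
apply/asboolP/asboolP => -[/(rest_act _ _ _ gG) h|h]; [by left| |by left|];
  by right => /exE.
Qed.

Let survivors_joint eps : jointly_invariant Gam P
  (fst_rv : {RV coupling >-> config V}) (survivors_rv eps : {RV coupling >-> vset V}).
Proof.
split; first exact: fst_law.
apply: pushforward_inv.
- by apply/measurable_fun_pairP; split;
    [exact: measurable_fst|exact: measurable_survivors].
- by move=> g B _ mB; rewrite -[X in measurable X]setTI; exact: measurable_act_pair.
- by move=> g t gG; rewrite /act_pair /= survivors_act.
Qed.

Hypothesis cheeger0 : forall A : {mfun space >-> vset V},
  jointly_invariant Gam P (fst_rv : {RV coupling >-> config V})
    (A : {RV coupling >-> vset V}) ->
  (\forall t \ae coupling, [set` A t] !=set0) ->
  \forall t \ae coupling, cheeger (weight m o) (induced_subgraph (fst_rv t) (A t)) = 0%E.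

(** Where some vertex survives, the survivors have a positive Cheeger constant,
    which the hypothesis forbids. *)
Let rest_empty eps : 0 < eps -> \forall t \ae coupling, forall y, ~ rest eps y t.
Proof.
move=> eps0.
have ne : \forall t \ae coupling, [set` survivors eps t] !=set0.
  apply: aeW => t; have [[z rz]|h] := pselect (exists z, rest eps z t).
    by exists z; apply/asboolP; left.
  by exists o; apply/asboolP; right.
have := cheeger0 (survivors_joint eps) ne.
apply: filterS2 good => t [deg gc] ch0 y ry.
have sE : survivors eps t = (fun y => `[< rest eps y t >]).
  apply/funext => z; apply/asboolP/asboolP => [[//|h]|rz]; last by left.
  by exfalso; apply: h; exists y.
suff ch1 : cheeger (weight m o)
    (induced_subgraph t.1 (fun y => `[< rest eps y t >])) <> 0%E.
  by move: ch0; rewrite /= sE => /ch1.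
apply/(cheeger_neq0 Gconn Glf Gam_closed m_haar).
have D0 : 0 < D.+1%:R :> R by rewrite ltr0n.
(* [D.+1] rather than [D], to divide by a positive number *)
exists (eps / D.+1%:R); first exact: divr_gt0.
move=> F F0 FA.
have FA' x : x \in F -> rest eps x t by move=> /FA /asboolP.
have red := connected_reduction Gconn Glf Gam_closed m_haar deg (eps := eps).
have {red} red : ((eps * total_weight m F)%:E <=
    D%:R%:E * boundary_weight m t.1 (fun y => `[< rest eps y t >]) F)%E.
  apply: red FA => F' F'0 F'A cF'.
  by apply: rest_expands deg gc F'0 _ cF' => x /F'A /asboolP.
rewrite mulrAC EFinM muleC lee_pdivrMl //; apply: le_trans red _.
apply: lee_wpmul2r; first exact: (boundary_weight_ge0 Gconn Glf Gam_closed m_haar).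
by rewrite lee_fin ler_nat.
Qed.

Let tol (n : nat) : R := (2 ^ n.+1)%:R^-1.

Let tol_gt0 n : 0 < tol n.
Proof. by rewrite invr_gt0 ltr0n expn_gt0. Qed.

(** Deleting the separators of all indices [j >= n] makes the remaining graphs
    increase with [n]. *)
Let removed n y (t : space) := exists j, (n <= j)%N /\ separator (tol j) y t.

Let mremoved n y : measurable [set t | removed n y t].
Proof.
apply: measurable_exists => [|j]; first exact: countableP.
by apply: measurable_and; [exact: measurable_const|exact: measurable_separator].
Qed.

Let kept (t : space) : power nat (config V) :=
  fun n e => [&& t.1 e, ~~ `[< removed n e.1 t >] & ~~ `[< removed n e.2 t >]].

Let keptP t n e : kept t n e <-> [/\ t.1 e, ~ removed n e.1 t & ~ removed n e.2 t].
Proof.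
split=> [/and3P[a /asboolPn b /asboolPn c]|[a b c]]; first by split.
by apply/and3P; split => //; apply/asboolPn.
Qed.

Let measurable_kept : measurable_fun [set: space] kept.
Proof.
apply: measurable_fun_power => n; apply: measurable_fun_power => e.
apply: measurable_fun_prop.
have -> : [set t | kept t n e] =
    [set t : space | t.1 e /\ (~ removed n e.1 t /\ ~ removed n e.2 t)].
  by apply/seteqP; split => t /=; rewrite keptP => -[a]; [|case].
apply: measurable_and.
  exact: (@measurable_atom _ space (V * V)%type fst e measurable_fst).
by apply: measurable_and; apply: measurable_not; exact: mremoved.
Qed.

Let kept_rv : {mfun space >-> power nat (config V)} :=
  HB.pack kept (isMeasurableFun.Build _ _ _ _ _ measurable_kept).

Let removed_act n (g : aut G) y t : g \in Gam ->
  removed n (g y) (act_space g t) <-> removed n y t.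
Proof.
by move=> gG; split=> -[j [nj sj]]; exists j; split => //;
  apply/(separator_act (tol j) y t gG).
Qed.

Let kept_act (g : aut G) t n : g \in Gam ->
  kept (act_space g t) n = act_config g (kept t n).
Proof.
move=> gG; apply/funext => -[x y].
rewrite -(aut_KV g x) -(aut_KV g y) act_configE /kept /=.
rewrite -/(act_config g t.1 (g (g^-1%g x), g (g^-1%g y))) act_configE.
by congr [&& _, ~~ _ & ~~ _]; apply/asboolP/asboolP => /(removed_act _ _ _ gG).
Qed.

Let separators_rare y : \forall t \ae coupling, exists n, ~ removed n y t.
Proof.
have [r rT yr] := transversal_exists y Gam_qt.
have small j : (coupling [set t | separator (tol j) y t] <=
    ((size r)%:R / (2 ^ j.+1)%:R)%:E)%E.
  apply: le_trans (le_trans (separator_small (ltW (tol_gt0 j)) rT) _); last first.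
    by rewrite mulrC.
  rewrite (big_rem y) //= leeDl //; apply: sume_ge0 => x _; exact: measure_ge0.
have null : coupling (lim_sup_set (fun j => [set t | separator (tol j) y t])) = 0%E.
  apply: lim_sup_set_cvg0; first by move=> j; exact: measurable_separator.
  apply: (@le_lt_trans _ _ (\sum_(j <oo) ((size r)%:R / (2 ^ j.+1)%:R)%:E)%E).
    by apply: lee_nneseries => j *; [exact: measure_ge0|exact: small].
  by apply: le_lt_trans (epsilon_trick0 _ _) _; rewrite ?ltry.
exists (lim_sup_set (fun j => [set t | separator (tol j) y t])); split => //.
  apply: bigcap_measurable => // n _; apply: bigcup_measurable => j _.
  exact: measurable_separator.
move=> t nr n _; have : removed n y t by apply: contrapT => h; apply: nr; exists n.
by move=> [j [nj sj]]; exists j.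
Qed.

Lemma coupling_hyperfinite : hyperfinite Gam P.
Proof.
exists _, space, coupling, fst_rv, kept_rv; split; first exact: fst_law.
have rmono t i j y : (i <= j)%N -> removed j y t -> removed i y t.
  by move=> ij [l [jl sl]]; exists l; split => //; exact: leq_trans jl.
split.
- apply: aeW => t n; split=> e; last by move=> /keptP[].
  move=> /keptP[te r1 r2]; apply/keptP; split => //.
    by move=> /(rmono _ _ _ _ (leqnSn n)).
  by move=> /(rmono _ _ _ _ (leqnSn n)).
- apply: pushforward_inv.
  + by apply/measurable_fun_pairP; split; [exact: measurable_fst|exact: measurable_kept].
  + by move=> g B _ mB; rewrite -[X in measurable X]setTI; exact: measurable_act_filtration.
  + move=> g t gG; rewrite /act_filtration /=; congr (_, _).
    by apply/funext => n; exact: kept_act.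
- have := ae_forall_countable Vcount separators_rare.
  apply: filterS => t rare; apply/seteqP; split=> e.
    by move=> [n _ /keptP[]].
  move=> te; have [n1 r1] := rare e.1; have [n2 r2] := rare e.2.
  exists (maxn n1 n2) => //; apply/keptP; split => //.
    by move=> /(rmono _ _ _ _ (leq_maxl n1 n2)).
  by move=> /(rmono _ _ _ _ (leq_maxr n1 n2)).
- move=> n; have := rest_empty (tol_gt0 n).
  apply: filterS => t nr x /=.
  have adjP u v : config_adj (kept t n) u v ->
      [/\ config_adj t.1 u v, ~ removed n u t & ~ removed n v t].
    by move=> /orP[] /keptP /= [a b c]; split => //; apply/orP; [left|right].
  have [rx|nrx] := pselect (removed n x t).
    apply: (@sub_finite_set _ _ [set x]); last exact: finite_set1.
    apply: component_sub => // u v /= -> /adjP[_ nr' _].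
    by exfalso; apply: nr'.
  have sepr v : ~ removed n v t -> ~ separator (tol n) v t.
    by move=> nr' sv; apply: nr'; exists n.
  have [k [F [sF xF]]] := not_rest (nr x) (sepr x nrx).
  apply: (@sub_finite_set _ _ [set` F]); last exact: finite_fset.
  apply: component_sub => // u v uF /adjP[uv _ nv].
  exact: selected_closed nr sF uF (sepr v nv) uv.
Qed.

End Random.

End Backward.

Theorem theorem3p4 (R : realType) (V : choiceType) (o : V) (G : sgraph V)
    (Gconn : connected_graph G) (Glf : locally_finite_graph G)
    (Gam : groupClosed (aut G)) (Gam_closed : closed_subgroup Gam)
    (Gam_qt : quasi_transitive Gam)
    (m : {measure set (borel_subgrp Gam) -> \bar R}) (m_haar : haar_measure m)
    (P : probability (config V) R)
    (P_inv : law_invariant Gam (@act_config V G) P)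
    (P_deg : bounded_degrees P) :
  hyperfinite Gam P <->
  (forall (d : measure_display) (Om : measurableType d) (Q : probability Om R)
      (w : {RV Q >-> config V}) (A : {RV Q >-> vset V}),
    jointly_invariant Gam P w A ->
    (\forall t \ae Q, [set` A t] !=set0) ->
    \forall t \ae Q, cheeger (weight m o) (induced_subgraph (w t) (A t)) = 0%E).
Proof.
have [D Pdeg] := P_deg.
have Vcount : countable [set: V] := countable_vertices Gconn Glf o.
split.
- move=> [d [Om [Q [w [wn [w_law [mono inv un fin]]]]]]] d' Om' Q' w' A [w'_law joint] ne.
  have mX : measurable_fun [set: Om'] (fun t => (w' t, A t)).
    by apply/measurable_fun_pairP; split; exact: measurable_funPT.
  pose X : {mfun Om' >-> (config V * vset V)%type} :=
    HB.pack (fun t => (w' t, A t)) (isMeasurableFun.Build _ _ _ _ _ mX).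
  have fstE B : measurable B -> distribution Q' X (fst @^-1` B) = P B.
    by move=> mB; rewrite -(w'_law B mB).
  have ae0 := forward_ae Gconn Glf Gam_closed Gam_qt m_haar P_inv Pdeg Vcount
    w_law mono inv un fin (mu := distribution Q' X) joint fstE o.
  have := @ae_comp _ _ _ _ R Q' (distribution Q' X) X _ mX (fun B _ => erefl) ae0.
  by apply: filterS2 ne => t ne0; exact.
- move=> cheeger0.
  have ncount : countable [set: (nat * V)%type].
    by apply: countable_prod => //; exact: countableP.
  have [beta fair] := fair_coins_exist R ncount.
  apply: (coupling_hyperfinite Gconn Glf Gam_closed Gam_qt m_haar Vcount P_inv fair
    (o := o) Pdeg) => A; exact: cheeger0.
Qed.
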